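(* Let $$\mathcal A:=\begin{bmatrix} A & B^T \\ B & 0 \end{bmatrix},\qquad Q:=\begin{bmatrix} Q_A & 0 \\ 0 & Q_S \end{bmatrix},$$ where $Q_A\sim A$ is a uniformly spectrally equivalent preconditioner of $A$ (symmetric positive definite, with $\gamma_1Q_A\le A\le\gamma_2Q_A$ for constants $\gamma_1,\gamma_2>0$ independent of $h$ and of the position of $\Gamma$) and $Q_S:=S_M$. For the spectrum $\sigma(Q^{-1}\mathcal A)$ of the preconditioned matrix we have $$\sigma(Q^{-1}\mathcal A)\subset[C_-,c_-]\cup[c_+,C_+],$$ with some constants $C_-<c_-<0<c_+<C_+$ independent of $h$ and the position of $\Gamma$.
   Context: $\Gamma\subset\mathbb R^3$ is a closed, sufficiently smooth surface with outward unit normal $\mathbf n$, and $\mathbf P=\mathbf I-\mathbf n\mathbf n^T$. For vector functions $\nabla\mathbf u:=(\nabla u_1\ \nabla u_2\ \nabla u_3)^T$ (Jacobian). $E_s(\mathbf u):=\tfrac12\mathbf P(\nabla\mathbf u+\nabla\mathbf u^T)\mathbf P$, $\mathbf H:=\nabla\mathbf n$ on $\Gamma$; $\mathbf u=\mathbf u_T+u_N\mathbf n$ with $\mathbf u_T\cdot\mathbf n=0$. On $\Gamma$, $$a(\mathbf u,\mathbf v):=\int_\Gamma\mathrm{tr}\big((E_s(\mathbf u_T)+u_N\mathbf H)(E_s(\mathbf v_T)+v_N\mathbf H)\big)+\mathbf u\cdot\mathbf v\,ds.$$ $\Omega\subset\mathbb R^3$ is a fixed polygonal domain strictly containing $\Gamma$,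 with a shape regular family of tetrahedral triangulations $\{\mathcal T_h\}_{h>0}$ (the outer triangulations). $\mathcal T_h^\Gamma$ is the set of tetrahedra of $\mathcal T_h$ with nonzero intersection with $\Gamma$ (the family $\{\mathcal T_h^\Gamma\}$ is assumed quasi-uniform), $\Omega_h^\Gamma:=\mathrm{int}(\overline{\cup_{T\in\mathcal T_h^\Gamma}T})$, assumed contained in a neighborhood of $\Gamma$ in which the signed distance function to $\Gamma$ is smooth; $\mathbf n$ is extended to $\Omega_h^\Gamma$ as the gradient of this function. $V_h^m$ is the space of continuous functions on $\Omega_h^\Gamma$ that are piecewise polynomial of degree $m$ on $\mathcal T_h^\Gamma$; $\mathbf U_h:=(V_h^k)^3$, $M_h:=V_h^l$ with $1\le l\le k$. With the stabilization parameter $\rho>0$: $$A_h(\mathbf u,\mathbf v):=a(\mathbf u,\mathbf v)+\rho\int_{\Omega_h^\Gamma}(\nabla\mathbf u\,\mathbf n)\cdot(\nabla\mathbf v\,\mathbf n)\,dx,$$ $$b(\mathbf u,\mu):=(\mathbf u\cdot\mathbf n,\mu)_{L^2(\Gamma)}+\rho\int_{\Omega_h^\Gamma}(\mathbf n^T\nabla\mathbf u\,\mathbf n)(\mathbf n\cdot\nabla\mu)\,dx,$$ $\|\mathbf u\|_U^2:=A_h(\mathbf u,\mathbf u)$ and $\|\mu\|_M^2:=\|\mu\|_{L^2(\Gamma)}^2+\rho\|\mathbf n\cdot\nabla\mu\|_{L^2(\Omega_h^\Gamma)}^2$. Standing assumption on $\rho$: $\rho=c_\alpha h^{1-\alpha}$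 with $\alpha\in[0,2]$, $h\le h_0\le1$ and $0<c_\alpha<d_2^{-2}h_0^{\alpha-2}$, where $d_1,d_2>0$ are constants independent of $h$ and of how $\Gamma$ intersects the outer triangulation such that $\sup_{\mathbf v_h\in(V_h^k)^3}b(\mathbf v_h,\mu_h)/\|\mathbf v_h\|_U\ge d_1(1-d_2\sqrt{\rho h})\|\mu_h\|_M$ for all $\mu_h\in V_h^k$. Matrices: let $n=\dim\mathbf U_h$, $m=\dim M_h$, and let $P_h^U:\mathbb R^n\to\mathbf U_h$, $P_h^M:\mathbb R^m\to M_h$ be the canonical mappings from vectors of nodal values to finite element functions; $\langle\cdot,\cdot\rangle$ is the Euclidean scalar product. $A\in\mathbb R^{n\times n}$, $B\in\mathbb R^{m\times n}$, $S_M\in\mathbb R^{m\times m}$ are defined by $$\langle A\vec u,\vec v\rangle=A_h(P_h^U\vec u,P_h^U\vec v),\quad\langle B\vec u,\vec\lambda\rangle=b(P_h^U\vec u,P_h^M\vec\lambda),$$ $$\langle S_M\vec\lambda,\vec\mu\rangle=(P_h^M\vec\lambda,P_h^M\vec\mu)_{L^2(\Gamma)}+\rho\big(\mathbf n\cdot\nabla(P_h^M\vec\lambda),\mathbf n\cdot\nabla(P_h^M\vec\mu)\big)_{L^2(\Omega_h^\Gamma)}$$ for all $\vec u,\vec v\in\mathbb R^n$, $\vec\lambda,\vec\mu\in\mathbb R^m$. For symmetric matrices, $X\le Y$ means that $Y-X$ is positive semidefinite. *)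

(* Defs.v *)
From HB Require Import structures.
From mathcomp Require Import all_boot all_order all_algebra.
From mathcomp Require Import all_classical all_reals all_analysis.
From mathcomp Require Import complex.

Set Implicit Arguments.
Unset Strict Implicit.
Unset Printing Implicit Defensive.

Import Order.TTheory GRing.Theory Num.Theory.
Import numFieldNormedType.Exports.

Local Open Scope classical_set_scope.
Local Open Scope ring_scope.

Section Euclidean.
Variable R : realType.
Implicit Types (x y v : 'cV[R]_3).

Definition dot n (u v : 'cV[R]_n) : R := \sum_i u i 0 * v i 0.

(* The library norm of a matrix is the max norm; it induces the same topology. *)
Definition enorm x : R := Num.sqrt (dot x x).

Definition grad (f : 'cV[R]_3 -> R) x : 'cV[R]_3 :=
  \col_j 'D_(delta_mx j 0) f x.

Definition jac (u : 'cV[R]_3 -> 'cV[R]_3) x : 'M[R]_3 :=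
  \matrix_(i, j) 'D_(delta_mx j 0) (fun y => u y i 0) x.

Fixpoint Ck (r : nat) (W : set 'cV[R]_3) (f : 'cV[R]_3 -> R) : Prop :=
  if r is s.+1 then
    (forall x, W x -> differentiable f x) /\
    (forall j : 'I_3, Ck s W (fun x => 'D_(delta_mx j 0) f x))
  else forall x, W x -> {for x, continuous f}.

End Euclidean.

Section Hausdorff.
Variable R : realType.
Local Open Scope ereal_scope.

(* The sigma-algebra in which every set is measurable: coverings by arbitrary
   sets in the outer measure construction mu_ext below. *)
Definition allsets := g_sigma_algebraType [set: set 'cV[R]_3].

(* pi/4 * diam(E)^2 if diam(E) <= delta, +oo otherwise. The factor pi/4
   normalises the two-dimensional Hausdorff measure to surface area. *)
Definition hweight (delta : R) (E : set allsets) : \bar R :=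
  ereal_inf [set (pi / 4 * r ^+ 2)%:E | r in [set r : R |
    (0 <= r <= delta)%R /\
    forall x y : 'cV[R]_3, E x -> E y -> (enorm (x - y) <= r)%R]].

Definition hausdorff2 (A : set 'cV[R]_3) : \bar R :=
  ereal_sup [set mu_ext (hweight delta) A | delta in [set d : R | (0 < d)%R]].

Lemma hweight_ge0 (delta : R) E : 0 <= hweight delta E.
Proof.
apply: le_ereal_inf_tmp => _ [r _ <-].
by rewrite lee_fin mulr_ge0 ?sqr_ge0// divr_ge0// pi_ge0.
Qed.

Lemma hweight0 (delta : R) : (0 < delta)%R -> hweight delta set0 = 0.
Proof.
move=> d0; apply/eqP; rewrite eq_le hweight_ge0 andbT.
apply: ereal_inf_lbound; exists 0%R; last by rewrite expr0n/= mulr0.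
by split => //; rewrite lexx ltW.
Qed.

Lemma hausdorff2_ge0 A : 0 <= hausdorff2 A.
Proof.
apply: le_ereal_sup_tmp; exists (mu_ext (hweight 1) A); first by exists 1%R => /=.
exact/mu_ext_ge0/hweight_ge0.
Qed.

Lemma hausdorff2_0 : hausdorff2 set0 = 0.
Proof.
apply/eqP; rewrite eq_le; apply/andP; split.
  apply: ge_ereal_sup => _ [d d0 <-].
  by rewrite mu_ext0//; [exact: hweight0|exact: hweight_ge0].
exact: hausdorff2_ge0.
Qed.

Lemma le_hausdorff2 : {homo hausdorff2 : A B / A `<=` B >-> A <= B}.
Proof.
move=> A B AB; apply: ge_ereal_sup => _ [d d0 <-].
apply: (le_trans (le_mu_ext (hweight d) (AB : (A : set allsets) `<=` B))).
by apply: ereal_sup_ubound; exists d.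
Qed.

Lemma hausdorff2_sigma_subadditive : sigma_subadditive hausdorff2.
Proof.
move=> F; apply: ge_ereal_sup => _ [d d0 <-].
apply: (le_trans (mu_ext_sigma_subadditive (@hweight_ge0 d) _)).
apply: lee_nneseries => [i _ _|i _]; first exact/mu_ext_ge0/hweight_ge0.
by apply: ereal_sup_ubound; exists d.
Qed.

HB.instance Definition _ := isOuterMeasure.Build R 'cV[R]_3 hausdorff2
  hausdorff2_0 hausdorff2_ge0 le_hausdorff2 hausdorff2_sigma_subadditive.

Definition hausdorff2_outer : {outer_measure set 'cV[R]_3 -> \bar R} := hausdorff2.

Definition hausdorff2_measure :
    {measure set (caratheodory_type hausdorff2_outer) -> \bar R} :=
  (hausdorff2_outer : set (caratheodory_type hausdorff2_outer) -> \bar R).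

Definition surf_int (S : set 'cV[R]_3) (f : 'cV[R]_3 -> R) : R :=
  (\int[hausdorff2_measure]_(x in S) f x)%R.

Definition pt3 (p : R * R * R) : 'cV[R]_3 :=
  (\col_i (if i == 0 then p.1.1 else if i == 1 then p.1.2 else p.2))%R.

Definition lebesgue3 : {measure set (measurableTypeR R * measurableTypeR R *
    measurableTypeR R) -> \bar R} :=
  ((@lebesgue_measure R \x @lebesgue_measure R) \x @lebesgue_measure R)%E.

Definition vol_int (S : set 'cV[R]_3) (f : 'cV[R]_3 -> R) : R :=
  (\int[lebesgue3]_(p in pt3 @^-1` S) f (pt3 p))%R.

End Hausdorff.

Section Surface.
Variable R : realType.
Variable Gam : set 'cV[R]_3.
Implicit Types (x : 'cV[R]_3) (u v : 'cV[R]_3 -> 'cV[R]_3).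

(* compact embedded C^2 surface without boundary *)
Definition closed_surface : Prop :=
  [/\ compact Gam, Gam !=set0 & forall x, Gam x ->
    exists W : set 'cV[R]_3, exists phi : 'cV[R]_3 -> R,
      [/\ open W, W x, Ck 2 W phi, forall y, W y -> grad phi y != 0 &
          W `&` Gam = W `&` [set y | phi y = 0]]].

Definition inside : set 'cV[R]_3 :=
  [set x | ~ Gam x /\ bounded_set (connected_component (~` Gam) x)].

(* Bounded components of the complement are inside, so grad sdist points
   outward. *)
Definition sdist x : R :=
  let r := inf [set enorm (x - y) | y in Gam] in
  if `[< inside x >] then - r else r.

Definition normal x : 'cV[R]_3 := grad sdist x.

(* the closest point of Gam, for x near Gam *)
Definition proj x : 'cV[R]_3 := x - sdist x *: normal x.

Definition Pmx x : 'M[R]_3 := 1%:M - normal x *m (normal x)^T.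

Definition Hmx x : 'M[R]_3 := jac normal x.

Definition npart u x : R := dot (u x) (normal x).
Definition tpart u x : 'cV[R]_3 := u x - npart u x *: normal x.

Definition Es u x : 'M[R]_3 :=
  2^-1 *: (Pmx x *m (jac u x + (jac u x)^T) *m Pmx x).

(* Since u lives on Gam, the Jacobian of its tangential part is that of the
   extension constant along normals. E_s sees tangential derivatives only, so
   this choice is immaterial where u is differentiable; for a finite element
   function it also gives the right value where Gam runs inside a face of the
   mesh, across which the ordinary gradient jumps. *)
Definition strain u x : 'M[R]_3 :=
  Es (tpart u \o proj) x + npart u x *: Hmx x.

Definition aform u v : R :=
  surf_int Gam (fun x => \tr (strain u x *m strain v x) + dot (u x) (v x)).

Section Stabilized.
Variables (W : set 'cV[R]_3) (rho : R).

Definition Ah u v : R :=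
  aform u v +
  rho * vol_int W (fun x => dot (jac u x *m normal x) (jac v x *m normal x)).

Definition bform u (mu : 'cV[R]_3 -> R) : R :=
  surf_int Gam (fun x => npart u x * mu x) +
  rho * vol_int W (fun x => dot (normal x) (jac u x *m normal x) *
                            dot (normal x) (grad mu x)).

Definition Mform (lam mu : 'cV[R]_3 -> R) : R :=
  surf_int Gam (fun x => lam x * mu x) +
  rho * vol_int W (fun x => dot (normal x) (grad lam x) *
                            dot (normal x) (grad mu x)).

Definition normU u : R := Num.sqrt (Ah u u).
Definition normM mu : R := Num.sqrt (Mform mu mu).

End Stabilized.

End Surface.

Section Mesh.
Variable R : realType.

Definition poly3 m (c : 'I_m.+1 -> 'I_m.+1 -> 'I_m.+1 -> R) (x : 'cV[R]_3) : R :=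
  \sum_(a < m.+1) \sum_(b < m.+1) \sum_(e < m.+1 | (a + b + e <= m)%N)
    c a b e * x 0 0 ^+ a * x 1 0 ^+ b * x 2%:R 0 ^+ e.

(* A tetrahedron is given by the 3 x 4 matrix whose columns are its vertices. *)
Definition tetra := 'M[R]_(3, 4).
Implicit Types (T : tetra) (ts : seq tetra) (Omega Gam : set 'cV[R]_3).

Definition bary (I : {set 'I_4}) : set 'cV[R]_4 :=
  [set lam | [/\ forall i, 0 <= lam i 0, \sum_i lam i 0 = 1 &
                 forall i, i \notin I -> lam i 0 = 0]].

(* face spanned by the vertices in I (empty if I is empty) *)
Definition face T (I : {set 'I_4}) : set 'cV[R]_3 :=
  [set T *m lam | lam in bary I].

Definition hull T : set 'cV[R]_3 := face T [set: 'I_4].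

Definition nondegenerate T : Prop :=
  \rank (col_mx T (const_mx 1 : 'rV[R]_4)) = 4%N.

Definition diam T : R :=
  sup [set enorm (z.1 - z.2) | z in hull T `*` hull T].

Definition inradius T : R :=
  sup [set r : R | 0 <= r /\
        exists c, forall x, enorm (x - c) <= r -> hull T x].

Definition cover ts : set 'cV[R]_3 := \bigcup_(T in [set` ts]) hull T.

Definition polygonal_domain Omega : Prop :=
  connected Omega /\
  exists ts, (forall T, T \in ts -> nondegenerate T) /\
             Omega = interior (cover ts).

Definition triangulation Omega ts : Prop :=
  [/\ forall T, T \in ts -> nondegenerate T,
      closure Omega = cover ts &
      forall T1 T2, T1 \in ts -> T2 \in ts ->
        exists I1 I2 : {set 'I_4},
          hull T1 `&` hull T2 = face T1 I1 /\ face T1 I1 = face T2 I2].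

Section Cut.
Variables (Gam : set 'cV[R]_3) (ts : seq tetra).

Definition cut_mesh : set tetra :=
  [set T | T \in ts /\ (hull T `&` Gam) !=set0].

Definition cut_cover : set 'cV[R]_3 := \bigcup_(T in cut_mesh) hull T.

Definition cut_domain : set 'cV[R]_3 := interior (closure cut_cover).

(* V_h^m, as functions on the closure of the cut domain; the values elsewhere
   are irrelevant. *)
Definition Vh (m : nat) : set ('cV[R]_3 -> R) :=
  [set v | {within cut_cover, continuous v} /\
    forall T, cut_mesh T -> exists c : 'I_m.+1 -> 'I_m.+1 -> 'I_m.+1 -> R,
      forall x, hull T x -> v x = poly3 c x].

Definition Uh (k : nat) : set ('cV[R]_3 -> 'cV[R]_3) :=
  [set u | forall i : 'I_3, Vh k (fun x => u x i 0)].

(* Lagrange nodes: the points of the principal lattices of order m *)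
Definition nodes (m : nat) : set 'cV[R]_3 :=
  [set x | exists T (a : 'I_4 -> nat),
    [/\ cut_mesh T, (\sum_i a i = m)%N &
        x = T *m (\col_i ((a i)%:R / m%:R))]].

(* PM lam is the finite element function with vector of nodal values lam, for
   some numbering nd of the nodes. *)
Definition nodal_map_M (l m : nat) (PM : 'cV[R]_m -> 'cV[R]_3 -> R) : Prop :=
  exists nd : 'I_m -> 'cV[R]_3,
    set_bij setT (nodes l) nd /\
    forall lam, [/\ Vh l (PM lam), forall i, PM lam (nd i) = lam i 0 &
      forall v, Vh l v -> (forall i, v (nd i) = lam i 0) ->
        forall x, cut_cover x -> v x = PM lam x].

(* The same for vector functions; a degree of freedom is a component at a
   node. *)
Definition nodal_map_U (k n : nat)
    (PU : 'cV[R]_n -> 'cV[R]_3 -> 'cV[R]_3) : Prop :=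
  exists nd : 'I_n -> 'cV[R]_3 * 'I_3,
    set_bij setT (nodes k `*` [set: 'I_3]) nd /\
    forall w, [/\ Uh k (PU w), forall i, PU w (nd i).1 (nd i).2 0 = w i 0 &
      forall v, Uh k v -> (forall i, v (nd i).1 (nd i).2 0 = w i 0) ->
        forall x, cut_cover x -> v x = PU w x].

End Cut.

End Mesh.

Section Matrices.
Variable R : realType.

Definition lemx n (X Y : 'M[R]_n) : Prop :=
  forall v : 'cV[R]_n, 0 <= dot ((Y - X) *m v) v.

Definition spd n (X : 'M[R]_n) : Prop :=
  X^T = X /\ forall v : 'cV[R]_n, v != 0 -> 0 < dot (X *m v) v.

Definition spectrum n (X : 'M[R]_n) : set R[i] :=
  [set z | eigenvalue (map_mx (real_complex R) X) z].

End Matrices.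

(* The surface Gam in another position, g = (O, t) with O orthogonal. *)
Definition moved (R : realType) (g : 'M[R]_3 * 'cV[R]_3)
    (Gam : set 'cV[R]_3) : set 'cV[R]_3 :=
  [set g.1 *m x + g.2 | x in Gam].

(* Main.v *)
Require Import Defs.
From mathcomp Require Import all_boot all_order all_algebra.
From mathcomp Require Import all_classical all_reals all_analysis.
From mathcomp Require Import complex.
From mathcomp Require Import measurable_realfun ring lra zify.

Set Implicit Arguments.
Unset Strict Implicit.
Unset Printing Implicit Defensive.

Import Order.TTheory GRing.Theory Num.Theory.
Import numFieldNormedType.Exports.

Local Open Scope classical_set_scope.
Local Open Scope ring_scope.

(** Write |u|_A, |u|_QA and |p|_SM for the norms given by the symmetric positive
    definite matrices. An eigenvalue of the preconditioned matrix is an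
    eigenvalue of the symmetric pencil A u + B^T p = t QA u, B u = t SM p, hence
    real ([spectrum_pencil]). Linear algebra then bounds t away from zero and
    from infinity ([saddle_spectrum]), provided that the coupling satisfies
    2 p.B u <= |u|_A^2 + |p|_SM^2, that SM is positive definite, and that every p
    has a supremizer w with p.B w >= c |p|_SM |w|_A. All constants are explicit in
    gamma1, gamma2 and c, and c only depends on d1, d2, calpha, alpha and h0
    ([infsup_factor]). It remains to verify the three properties for each mesh
    and each position of the surface.

    The bound on the coupling ([coupling_le]) is the inequality between the
    geometric and the arithmetic mean under the integrals. It uses that the
    normal, as gradient of a function with Lipschitz constant 1, has length at
    most 1, and that the strain is a symmetric matrix, so that the trace of its
    square is nonnegative; the symmetry of the curvature matrix is the equality
    of mixed second derivatives ([derive_comm]). Splitting the integrals needs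
    measurability and finiteness. On the surface, closed sets are measurable
    for the Hausdorff measure because it is a metric outer measure
    ([closed_caratheodory]), and the surface has finite measure because it is
    covered by finitely many Lipschitz graphs ([surface_finite]). The strain of a
    finite element function need not be continuous where the mesh has faces; for
    it boundedness and the monotonicity of the integral suffice
    ([le_Rintegral_lower]). In the volume, the derivatives of a piecewise
    polynomial function are measurable because its one-sided derivatives are
    limits of difference quotients ([derive_measurable]).

    For the definiteness of SM ([multiplier_spd]), let mu have vanishing M-norm.
    Since every piece of the surface cut out by a ball around one of its points
    has positive measure ([surface_positive]), mu vanishes on the surface, and the
    integral of its squared normal derivative is zero. The closest point map has
    values in the surface ([proj_in]), so the vector field mu e_0 has zero
    strain, and its whole energy is zero ([Mform_eq0]). It is a finite element
    velocity because l <= k, and A is positive definite; hence mu = 0.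

    The supremizer ([supremizer]) comes from the discrete inf-sup inequality. The
    functions there are arbitrary off the cut mesh, whereas the matrices only
    know nodal values; both descriptions agree because the forms depend only on
    the values in the cut mesh, which contains a neighborhood of the surface
    ([surface_nbhs], [Ah_congr], [bform_congr]). *)

(** * Saddle point matrices *)

Section LinearAlgebra.
Variable R : realType.

Lemma dotC n (u v : 'cV[R]_n) : dot u v = dot v u.
Proof. by apply: eq_bigr => i _; rewrite mulrC. Qed.

Lemma dotDl n (u v w : 'cV[R]_n) : dot (u + v) w = dot u w + dot v w.
Proof. by rewrite -big_split; apply: eq_bigr => i _; rewrite !mxE mulrDl. Qed.

Lemma dotZl n a (u v : 'cV[R]_n) : dot (a *: u) v = a * dot u v.
Proof. by rewrite big_distrr; apply: eq_bigr => i _; rewrite /= !mxE mulrA. Qed.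

Lemma dotNl n (u v : 'cV[R]_n) : dot (- u) v = - dot u v.
Proof. by rewrite -scaleN1r dotZl mulN1r. Qed.

Lemma dotBl n (u v w : 'cV[R]_n) : dot (u - v) w = dot u w - dot v w.
Proof. by rewrite dotDl dotNl. Qed.

Lemma dotDr n (u v w : 'cV[R]_n) : dot u (v + w) = dot u v + dot u w.
Proof. by rewrite dotC dotDl !(dotC u). Qed.

Lemma dotZr n a (u v : 'cV[R]_n) : dot u (a *: v) = a * dot u v.
Proof. by rewrite dotC dotZl dotC. Qed.

Lemma dotNr n (u v : 'cV[R]_n) : dot u (- v) = - dot u v.
Proof. by rewrite dotC dotNl dotC. Qed.

Lemma dot0l n (u : 'cV[R]_n) : dot 0 u = 0.
Proof. by rewrite /dot big1// => i _; rewrite mxE mul0r. Qed.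

Lemma dot_mxE n (u v : 'cV[R]_n) : dot u v = (u^T *m v) 0 0.
Proof. by rewrite mxE; apply: eq_bigr => i _; rewrite mxE. Qed.

Lemma dot_mulmx n m (A : 'M[R]_(m, n)) u v :
  dot (A *m u) v = dot u (A^T *m v).
Proof. by rewrite !dot_mxE trmx_mul mulmxA. Qed.

Lemma dot_ge0 n (u : 'cV[R]_n) : 0 <= dot u u.
Proof. by apply: sumr_ge0 => i _; rewrite -expr2 sqr_ge0. Qed.

Lemma dot_eq0 n (u : 'cV[R]_n) : dot u u = 0 -> u = 0.
Proof.
move=> /eqP; rewrite psumr_eq0 => [/allP h|i _]; last by rewrite -expr2 sqr_ge0.
apply/colP => i; rewrite mxE; apply/eqP.
by have := h i (mem_index_enum _); rewrite -expr2 sqrf_eq0.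
Qed.

Lemma dot_inj n (u v : 'cV[R]_n) : (forall w, dot u w = dot v w) -> u = v.
Proof.
move=> h; apply/eqP; rewrite -subr_eq0; apply/eqP/dot_eq0.
by rewrite dotBl h subrr.
Qed.

Lemma dot_block n m (u u' : 'cV[R]_n) (p p' : 'cV[R]_m) :
  dot (col_mx u p) (col_mx u' p') = dot u u' + dot p p'.
Proof. by rewrite !dot_mxE tr_col_mx mul_row_col !mxE. Qed.

Lemma form_cauchy (a b d : R) :
  (forall s t, 0 <= s ^+ 2 * a + 2 * s * t * b + t ^+ 2 * d) ->
  b ^+ 2 <= a * d.
Proof.
move=> H.
have a0 : 0 <= a by have := H 1 0; nra.
have d0 : 0 <= d by have := H 0 1; nra.
have [dE|dN0] := eqVneq d 0; last first.
  have : 0 < d by rewrite lt0r dN0.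
  (* up to scaling, the minimizer of the form *)
  by have := H d (- b); nra.
(* if d = 0 the form takes the value - (a + 2) b^2 at (b, - (a + 1)) *)
by have := H b (- (a + 1)); rewrite dE; nra.
Qed.

Lemma psd_cauchy n (X : 'M[R]_n) (u v : 'cV[R]_n) : X^T = X ->
  (forall w, 0 <= dot (X *m w) w) ->
  dot (X *m u) v ^+ 2 <= dot (X *m u) u * dot (X *m v) v.
Proof.
move=> Xs Xp; apply: form_cauchy => s t.
have := Xp (s *: u + t *: v).
rewrite mulmxDr -!scalemxAr !(dotDl, dotDr, dotZl, dotZr).
have -> : dot (X *m v) u = dot (X *m u) v by rewrite dot_mulmx Xs dotC.
by congr (0 <= _); ring.
Qed.

Lemma spd_ge0 n (X : 'M[R]_n) v : spd X -> 0 <= dot (X *m v) v.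
Proof.
move=> [_ Xp]; have [->|/Xp/ltW//] := eqVneq v 0.
by rewrite mulmx0 dot0l.
Qed.

Lemma spd_unitmx n (X : 'M[R]_n) : spd X -> X \in unitmx.
Proof.
move=> [Xs Xp]; rewrite -row_free_unit -kermx_eq0; apply/rowV0P => v.
move/sub_kermxP => vX; apply/eqP; rewrite -trmx_eq0; apply/negPn/negP => /Xp.
by rewrite -[in X *m _]Xs -trmx_mul vX trmx0 dot0l ltxx.
Qed.

Lemma spd_block n m (X : 'M[R]_n) (Y : 'M[R]_m) :
  spd X -> spd Y -> spd (block_mx X 0 0 Y).
Proof.
move=> Xp Yp; split.
  by rewrite tr_block_mx !trmx0 (proj1 Xp) (proj1 Yp).
move=> v; rewrite -[v]vsubmxK mul_block_col !mul0mx addr0 add0r dot_block.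
set u := usubmx v; set p := dsubmx v => v0.
have := spd_ge0 u Xp; have := spd_ge0 p Yp.
have [u0|/(proj2 Xp)] := eqVneq u 0; last by lra.
have [p0|/(proj2 Yp)] := eqVneq p 0; last by lra.
by move: v0; rewrite u0 p0 col_mx0 eqxx.
Qed.

(** The symmetry of K and Q makes every eigenvalue of the pencil real: the real
    and imaginary parts of an eigenvector, tested against each other, leave
    only Im z times the energy of the eigenvector. *)
Lemma spectrum_pencil n (K Q : 'M[R]_n) z : spd Q -> K^T = K ->
  spectrum (invmx Q *m K) z ->
  exists (t : R) (x : 'cV[R]_n), [/\ z = real_complex R t, x != 0 & K *m x = t *: (Q *m x)].
Proof.
move=> Qp Ks; rewrite /spectrum /=.
set C := real_complex R => /eigenvalueP[v].
rewrite map_mxM map_invmx => vE v0.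
have Qu : map_mx C Q \in unitmx by rewrite map_unitmx spd_unitmx.
have [w vw] : exists w, v = w *m map_mx C Q.
  by exists (v *m invmx (map_mx C Q)); rewrite mulmxKV.
have w0 : w != 0 by apply: contraNneq v0 => w0; rewrite vw w0 mul0mx.
have {vE} : w *m map_mx C K = z *: (w *m map_mx C Q) by rewrite -vw -vE vw !mulmxA mulmxK.
move/(congr1 trmx); rewrite linearZ/= !trmx_mul !map_trmx Ks (proj1 Qp) => H.
pose a : 'cV[R]_n := \col_i complex.Re (w 0 i).
pose b : 'cV[R]_n := \col_i complex.Im (w 0 i).
have ReM (X : 'M[R]_n) i :
    complex.Re ((map_mx C X *m w^T) i 0) = (X *m a) i 0.
  rewrite !mxE (raddf_sum (@complex.Re R : Rcomplex R -> R)); apply: eq_bigr => j _.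
  rewrite !mxE. case: (w 0 j) => p q /=. by rewrite mul0r subr0.
have ImM (X : 'M[R]_n) i :
    complex.Im ((map_mx C X *m w^T) i 0) = (X *m b) i 0.
  rewrite !mxE (raddf_sum (@complex.Im R : Rcomplex R -> R)); apply: eq_bigr => j _.
  by rewrite !mxE; case: (w 0 j) => p q /=; rewrite mul0r addr0.
case: z H => s t H.
have Hi i : (map_mx C K *m w^T) i 0 = (s +i* t)%C * (map_mx C Q *m w^T) i 0.
  by rewrite H mxE.
have Ka : K *m a = s *: (Q *m a) - t *: (Q *m b).
  apply/colP => i; have -> : (s *: (Q *m a) - t *: (Q *m b)) i 0 =
    s * (Q *m a) i 0 - t * (Q *m b) i 0 by rewrite !mxE.
  by rewrite -!ReM -!ImM Hi; case: ((_ *m _) i 0).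
have Kb : K *m b = s *: (Q *m b) + t *: (Q *m a).
  apply/colP => i; have -> : (s *: (Q *m b) + t *: (Q *m a)) i 0 =
    s * (Q *m b) i 0 + t * (Q *m a) i 0 by rewrite !mxE.
  by rewrite -!ReM -!ImM Hi; case: ((_ *m _) i 0).
have ab : (a != 0) || (b != 0).
  rewrite -negb_and; apply: contra w0 => /andP[/eqP a0 /eqP b0].
  apply/eqP/rowP => i; have := congr1 (fun f : 'cV_n => f i 0) a0.
  have := congr1 (fun f : 'cV_n => f i 0) b0; rewrite !mxE.
  by case: (w 0 i) => p q /= -> ->.
have t0 : t = 0.
  have : dot (K *m a) b = dot (K *m b) a by rewrite dot_mulmx Ks dotC.
  rewrite Ka Kb dotBl dotDl !dotZl.
  have -> : dot (Q *m b) a = dot (Q *m a) b by rewrite dot_mulmx (proj1 Qp) dotC.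
  have a0 := spd_ge0 a Qp; have b0 := spd_ge0 b Qp => e.
  have /eqP : t * (dot (Q *m a) a + dot (Q *m b) b) = 0 by lra.
  rewrite mulf_eq0 => /orP[/eqP//|/eqP e0].
  by case/orP: ab => /(proj2 Qp); lra.
rewrite t0 scale0r subr0 in Ka; rewrite t0 scale0r addr0 in Kb; exists s.
by case/orP: ab => n0; [exists a|exists b]; split=> //; rewrite t0.
Qed.

(** Test the pencil A u + B^T p = t QA u, B u = t SM p with u, with p and with
    the supremizer w of p. The quantities a = |u|_A^2, q = |u|_QA^2 and
    s = |p|_SM^2 satisfy t s = p.B u and a = t (q - s). Their combination
    t (q + s) = a + 2 p.B u and the bound on the coupling give |t| <= K.
    A positive t is at least a / q >= gamma1. For negative t one has
    -t >= a / s, and the test with w, together with |t| <= K, yields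
    s <= D a. *)
Lemma saddle_spectrum n m (A QA : 'M[R]_n) (B : 'M[R]_(m, n)) (SM : 'M[R]_m)
    (gamma1 gamma2 c : R) :
  0 < gamma1 -> 0 < gamma2 -> 0 < c ->
  A^T = A -> spd QA -> spd SM ->
  lemx (gamma1 *: QA) A -> lemx A (gamma2 *: QA) ->
  (forall u p, 2 * dot (B *m u) p <= dot (A *m u) u + dot (SM *m p) p) ->
  (forall p, p != 0 -> exists2 w, w != 0 &
     c * Num.sqrt (dot (SM *m p) p) * Num.sqrt (dot (A *m w) w)
       <= dot (B *m w) p) ->
  let K := 2 * gamma2 + 1 in
  let D := ((1 + K / gamma1) / c) ^+ 2 in
  spectrum (invmx (block_mx QA 0 0 SM) *m block_mx A B^T B 0) `<=`
    (real_complex R) @` (`[- K - D^-1 - 1, - D^-1]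
                          `|` `[gamma1, K + gamma1 + 1]).
Proof.
move=> g10 g20 c0 As Qp Sp lo hi bnd infsup K D z.
have K0 : 0 < K by rewrite /K; lra.
have D0 : 0 < D by rewrite exprn_gt0// divr_gt0// addr_gt0// divr_gt0.
case/spectrum_pencil; first exact: spd_block.
  by rewrite tr_block_mx As trmxK trmx0.
move=> t [x [-> x0]]; rewrite -[x]vsubmxK !mul_block_col !mul0mx !addr0 add0r.
set u := usubmx x; set p := dsubmx x; rewrite scale_col_mx => /eq_col_mx[e1 e2].
exists t => //.
have loA v : gamma1 * dot (QA *m v) v <= dot (A *m v) v.
  by have := lo v; rewrite mulmxBl -scalemxAl dotBl dotZl subr_ge0.
have hiA v : dot (A *m v) v <= gamma2 * dot (QA *m v) v.
  by have := hi v; rewrite mulmxBl -scalemxAl dotBl dotZl subr_ge0.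
have A0 v : v != 0 -> 0 < dot (A *m v) v.
  by move=> /(proj2 Qp) q0; apply: lt_le_trans (loA v); rewrite mulr_gt0.
have Age0 v : 0 <= dot (A *m v) v.
  by have [->|/A0/ltW//] := eqVneq v 0; rewrite mulmx0 dot0l.
have e3 v : dot (A *m u) v + dot (B *m v) p = t * dot (QA *m u) v.
  have := congr1 (fun y => dot y v) e1; rewrite dotDl dotZl => <-.
  by rewrite (dotC _ v) (dot_mulmx B^T) trmxK (dotC p).
have e4 : dot (B *m u) p = t * dot (SM *m p) p.
  by have := congr1 (fun y => dot y p) e2; rewrite dotZl.
have u0 : u != 0.
  apply/negP => /eqP u0.
  have p0 : p != 0.
    apply: contraNneq x0 => p0.
    by rewrite -[x]vsubmxK -/u -/p u0 p0 col_mx0.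
  have [w w0 wp] := infsup p p0.
  have := e3 w; rewrite u0 !mulmx0 !dot0l mulr0 add0r => Bw.
  move: wp; rewrite Bw leNgt mulr_gt0// ?sqrtr_gt0 ?A0//.
  by rewrite mulr_gt0// sqrtr_gt0 (proj2 Sp).
have q0 := proj2 Qp u u0; have a0 := A0 u u0; have s0 := spd_ge0 p Sp.
have := e3 u; rewrite e4.
have la := loA u; have ha := hiA u.
have b1 := bnd u p; have b2 := bnd u (- p).
rewrite mulmxN !(dotNl, dotNr) opprK e4 in b2; rewrite e4 in b1.
move: infsup e3.
set a := dot (A *m u) u in a0 la ha b1 b2 *.
set q := dot (QA *m u) u in q0 la ha *.
set s := dot (SM *m p) p in s0 b1 b2 *.
move=> infsup e3 e.
have tK : `|t| <= K.
  rewrite ler_norml; apply/andP; split; rewrite /K; nra.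
have [tp|tn|t0] := ltgtP 0 t; last by move: e a0; rewrite -t0 !mul0r; lra.
  right; rewrite /= in_itv/=; move: tK; rewrite gtr0_norm// => tK.
  apply/andP; split; last lra.
  have ts : 0 <= t * s by apply: mulr_ge0; [exact: ltW|].
  have h : gamma1 * q <= t * q by lra.
  by rewrite ler_pM2r in h.
left; rewrite /= in_itv/=; move: tK; rewrite ltr0_norm// => tK.
have Di : 0 < D^-1 by rewrite invr_gt0.
apply/andP; split; first lra.
have p0 : p != 0.
  apply/negP => /eqP p0; move: e; rewrite /s p0 mulmx0 dot0l mulr0; nra.
suff sD : s <= D * a.
  (* a = t q - t s with t q <= 0 *)
  have tsD : - t * s <= - t * (D * a) by rewrite ler_wpM2l// oppr_ge0 ltW.
  have tq : t * q <= 0 by rewrite mulr_le0_ge0// ltW.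
  have : a <= - t * (D * a) by rewrite mulNr in tsD; lra.
  rewrite mulrA -[X in X <= _]mul1r ler_pM2r// => h.
  by rewrite lerNr -[X in X <= _]mul1r ler_pdivrMr.
have [w w0] := infsup p p0; have Aw := A0 w w0.
have -> : dot (B *m w) p = t * dot (QA *m u) w - dot (A *m u) w.
  by rewrite -e3 addrAC subrr add0r.
move=> key.
have cQ : `|dot (QA *m u) w| <= Num.sqrt a * Num.sqrt (dot (A *m w) w) / gamma1.
  rewrite -(ler_pXn2r (n := 2)) ?nnegrE// ?divr_ge0 ?mulr_ge0 ?sqrtr_ge0 ?(ltW g10)//.
  rewrite real_normK ?num_real// expr_div_n exprMn !sqr_sqrtr ?Age0//.
  have := psd_cauchy u w (proj1 Qp) (fun v => spd_ge0 v Qp).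
  move=> /le_trans; apply.
  rewrite ler_pdivlMr ?exprn_gt0//.
  have := loA w; have := spd_ge0 w Qp; rewrite -/q.
  set qw := dot (QA *m w) w; set aw := dot (A *m w) w => qw0 lw.
  have -> : q * qw * gamma1 ^+ 2 = (gamma1 * q) * (gamma1 * qw) by ring.
  by rewrite ler_pM// mulr_ge0// ltW.
have cA : `|dot (A *m u) w| <= Num.sqrt a * Num.sqrt (dot (A *m w) w).
  rewrite -(ler_pXn2r (n := 2)) ?nnegrE// ?mulr_ge0 ?sqrtr_ge0//.
  rewrite real_normK ?num_real// exprMn !sqr_sqrtr ?Age0//.
  exact: psd_cauchy.
have : c * Num.sqrt s <= Num.sqrt a * (1 + K / gamma1).
  have sw : 0 < Num.sqrt (dot (A *m w) w) by rewrite sqrtr_gt0.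
  rewrite -(ler_pM2r sw); apply: (le_trans key).
  rewrite (_ : _ * _ * _ = K * (Num.sqrt a * Num.sqrt (dot (A *m w) w) / gamma1) +
    Num.sqrt a * Num.sqrt (dot (A *m w) w)); last by ring.
  apply: (le_trans (ler_norm _)); apply: (le_trans (ler_normB _ _)).
  rewrite lerD// normrM ler_pM//; first by rewrite ltr0_norm.
rewrite mulrC -ler_pdivlMr// -mulrA => h.
have := h; rewrite -(ler_pXn2r (n := 2)) ?nnegrE ?sqrtr_ge0//; last first.
  by rewrite mulr_ge0 ?sqrtr_ge0// divr_ge0// ?ltW// addr_gt0// divr_gt0.
by rewrite exprMn !sqr_sqrtr ?(ltW a0)// mulrC.
Qed.

End LinearAlgebra.

(** * Calculus in three-dimensional space *)

Section Calculus.
Variable R : realType.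
Implicit Types (x y v : 'cV[R]_3) (f : 'cV[R]_3 -> R).

Lemma enorm_ge0 x : 0 <= enorm x. Proof. exact: sqrtr_ge0. Qed.

Lemma sqr_enorm x : enorm x ^+ 2 = dot x x.
Proof. by rewrite sqr_sqrtr// dot_ge0. Qed.

Lemma enorm0 : enorm (0 : 'cV[R]_3) = 0.
Proof. by rewrite /enorm dot0l sqrtr0. Qed.

Lemma enormZ a x : enorm (a *: x) = `|a| * enorm x.
Proof.
rewrite /enorm dotZl dotZr mulrA -expr2 sqrtrM ?sqr_ge0//.
by rewrite sqrtr_sqr.
Qed.

Lemma enormN x : enorm (- x) = enorm x.
Proof. by rewrite /enorm dotNl dotNr opprK. Qed.

Lemma enormB x y : enorm (x - y) = enorm (y - x).
Proof. by rewrite -enormN opprB. Qed.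

Lemma dot_cauchy x y : dot x y ^+ 2 <= dot x x * dot y y.
Proof.
have := @psd_cauchy R 3 1%:M x y (trmx1 _ _).
by rewrite !mul1mx; apply=> w; rewrite mul1mx dot_ge0.
Qed.

Lemma dot_le x y : `|dot x y| <= enorm x * enorm y.
Proof.
rewrite -(ler_pXn2r (n := 2)) ?nnegrE ?mulr_ge0 ?enorm_ge0//.
by rewrite real_normK ?num_real// exprMn !sqr_enorm dot_cauchy.
Qed.

Lemma enormD x y : enorm (x + y) <= enorm x + enorm y.
Proof.
rewrite -(ler_pXn2r (n := 2)) ?nnegrE ?addr_ge0 ?enorm_ge0//.
rewrite sqr_enorm dotDl !dotDr sqrrD !sqr_enorm (dotC y x).
have := le_trans (ler_norm _) (dot_le x y).
lra.
Qed.

Lemma enorm_dist x y z : enorm (x - z) <= enorm (x - y) + enorm (y - z).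
Proof. by apply: le_trans (enormD _ _); rewrite addrA subrK. Qed.

Lemma coord_le_enorm x i : `|x i 0| <= enorm x.
Proof.
rewrite -sqrtr_sqr ler_sqrt ?dot_ge0// /dot (bigD1 i)//= expr2 lerDl.
by apply: sumr_ge0 => j _; rewrite -expr2 sqr_ge0.
Qed.

Lemma enorm_le_coord x r : (forall i, `|x i 0| <= r) -> enorm x <= 2 * r.
Proof.
move=> xr; have r0 : 0 <= r by exact: le_trans (xr 0).
rewrite -(ler_pXn2r (n := 2)) ?nnegrE ?enorm_ge0 ?mulr_ge0//.
rewrite sqr_enorm /dot !big_ord_recl big_ord0.
have H i : x i 0 * x i 0 <= r ^+ 2.
  by rewrite -expr2 -[x i 0 ^+ 2]real_normK ?num_real// ler_pXn2r ?nnegrE.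
set a := (X in X + _); set b := (X in _ + (X + _)); set c := (X in _ + (_ + (X + _))).
have : a <= r ^+ 2 by exact: H.
have : b <= r ^+ 2 by exact: H.
have : c <= r ^+ 2 by exact: H.
have := sqr_ge0 r; rewrite exprMn; lra.
Qed.

Lemma enorm_eq0 x : enorm x = 0 -> x = 0.
Proof. by move=> x0; apply: dot_eq0; rewrite -sqr_enorm x0 expr0n. Qed.

Lemma norm_coord x : `|x| = \big[Num.max/0]_(i < 3) `|x i 0|.
Proof.
rewrite /Num.norm/= mx_normrE; apply/le_anti/andP; split.
  apply/bigmax_leP; split; first exact: bigmax_ge_id.
  by move=> [i j] _ /=; rewrite ord1; exact: (le_bigmax _ (fun i => `|x i 0|)).
apply/bigmax_leP; split; first exact: bigmax_ge_id.
move=> i _; exact: (le_bigmax _ (fun ij : 'I_3 * 'I_1 => `|x ij.1 ij.2|) (i, 0)).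
Qed.

Lemma coord_le_norm x i : `|x i 0| <= `|x|.
Proof. by rewrite norm_coord; exact: (le_bigmax _ (fun i => `|x i 0|)). Qed.

Lemma norm_le_coord x r : 0 <= r -> (forall i, `|x i 0| <= r) -> `|x| <= r.
Proof. by move=> r0 xr; rewrite norm_coord; apply/bigmax_leP; split. Qed.

Lemma enorm_le_norm x : enorm x <= 2 * `|x|.
Proof. by apply: enorm_le_coord => i; exact: coord_le_norm. Qed.

Lemma norm_le_enorm x : `|x| <= enorm x.
Proof.
by apply: norm_le_coord => [|i]; [exact: enorm_ge0|exact: coord_le_enorm].
Qed.

Lemma nbhs_enormP x (A : set 'cV[R]_3) :
  nbhs x A <-> exists2 e, 0 < e & forall y, enorm (y - x) < e -> A y.
Proof.
split=> [/nbhs_ballP[e /= e0 eA]|[e e0 eA]].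
  exists e => // y yx; apply: eA; rewrite -ball_normE/=.
  by apply: le_lt_trans yx; rewrite enormB norm_le_enorm.
apply/nbhs_ballP; exists (e / 2); first by rewrite /= divr_gt0.
move=> y; rewrite -ball_normE/= => yx; apply: eA.
by apply: (le_lt_trans (enorm_le_norm _)); rewrite distrC mulrC -ltr_pdivlMr.
Qed.

Lemma near_line x v (A : set 'cV[R]_3) : nbhs x A ->
  \forall t \near (0 : R), A (x + t *: v).
Proof.
move=> xA; have : (fun t : R => x + t *: v) @ (0 : R) --> x.
  have h : (fun t : R => t) @ (0 : R) --> (0 : R) by exact: cvg_id.
  have := cvgD (cvg_cst x) (cvgZ h (cvg_cst v)).
  by rewrite scale0r addr0 => {}h; exact: h.
by move=> h; exact: h.
Qed.

(** Where the derivative does not exist its default value is 0, so that a bound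
    on the difference quotients always bounds it. *)
Lemma derive_le f x v L : 0 <= L ->
  (\forall t \near (0 : R), `|f (x + t *: v) - f x| <= L * `|t|) ->
  `|'D_v f x| <= L.
Proof.
move=> L0 H; rewrite /derive.
have [cv|dv] := pselect (cvg ((fun h => h^-1 *: ((f \o shift x) (h *: v) - f x)) @ 0^'));
  last by rewrite (dvgP dv) normr0.
have Q : \forall t \near 0^', `|t^-1 *: ((f \o shift x) (t *: v) - f x)| <= L.
  near=> t; rewrite normrZ normfV ler_pdivrMl ?normr_gt0; last first.
    by near: t; exact: nbhs_dnbhs_neq.
  rewrite mulrC /= (addrC (t *: v)); near: t.
  by apply: nbhs_dnbhs; exact: H.
rewrite ler_norml; apply/andP; split.
  apply: limr_ge cv _; near=> t; suff : `|t^-1 *: ((f \o shift x) (t *: v) - f x)| <= L.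
    by rewrite ler_norml => /andP[].
  by near: t.
apply: limr_le cv _; near=> t; apply: (le_trans (ler_norm _)); by near: t.
Unshelve. all: by end_near. Qed.

Lemma derive_line f x v (t : R) :
  is_derive t 1 (fun s => f (x + s *: v)) ('D_v f (x + t *: v)) <->
  derivable f (x + t *: v) v.
Proof.
have E : (fun h : R => h^-1 *: (((fun s => f (x + s *: v)) \o shift t) (h *: 1)
      - f (x + t *: v))) =
    (fun h => h^-1 *: ((f \o shift (x + t *: v)) (h *: v) - f (x + t *: v))).
  apply/funext => h /=; congr (_ *: (f _ - _)).
  by rewrite scalerDl addrCA /GRing.scale/= mulr1.
split=> [[]|d]; first by rewrite /derivable E.
by apply: DeriveDef; rewrite /derivable /derive E.
Qed.

Lemma line_mvt f x v :
  (forall t, 0 <= t <= 1 -> derivable f (x + t *: v) v) ->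
  exists2 t, 0 <= t <= 1 & f (x + v) - f x = 'D_v f (x + t *: v).
Proof.
move=> d; have [||t] := @MVT_segment R (fun s => f (x + s *: v))
    (fun s => 'D_v f (x + s *: v)) 0 1 ler01.
- move=> t; rewrite in_itv/= => /andP[t0 t1]; apply/derive_line/d.
  by rewrite !ltW.
- apply: derivable_within_continuous => t; rewrite in_itv/= => /d.
  by move=> /derive_line[].
rewrite in_itv/= scale1r scale0r addr0 subr0 mulr1 => t01 e.
by exists t.
Qed.

Lemma derive_grad f x v : differentiable f x -> 'D_v f x = dot (grad f x) v.
Proof.
move=> d; rewrite [in LHS](matrix_sum_delta v) deriveE// raddf_sum.
apply: eq_bigr => i _; rewrite big_ord1 [LHS]linearZ mxE deriveE//.
by rewrite mulrC.
Qed.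

Lemma derive_shiftE f x c v :
  derivable (fun y => f (y + c)) x v = derivable f (x + c) v /\
  'D_v (fun y => f (y + c)) x = 'D_v f (x + c).
Proof.
have E : (fun h : R => h^-1 *: (((fun y => f (y + c)) \o shift x) (h *: v) - f (x + c)))
    = (fun h : R => h^-1 *: ((f \o shift (x + c)) (h *: v) - f (x + c))).
  by apply/funext => h /=; rewrite addrA.
by rewrite /derivable /derive E.
Qed.

(** The mean value theorem is applied along e1 to the increment of f along e2,
    and then along e2 to the derivative along e1. The second difference is
    symmetric in e1 and e2, so it compares both mixed derivatives. *)
Lemma second_difference f x e1 e2 (r t : R) : 0 < t ->
  (forall y, enorm (y - x) < r -> differentiable f y) ->
  (forall y, enorm (y - x) < r -> differentiable ('D_e1 f) y) ->
  t * (enorm e1 + enorm e2) < r ->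
  exists2 y, enorm (y - x) < r &
    f (x + t *: e1 + t *: e2) - f (x + t *: e1) - f (x + t *: e2) + f x =
      t ^+ 2 * 'D_e2 ('D_e1 f) y.
Proof.
move=> t0 df ddf tr.
have near_x a b : 0 <= a <= 1 -> 0 <= b <= 1 ->
    enorm (x + a *: (t *: e1) + b *: (t *: e2) - x) < r.
  move=> /andP[a0 a1] /andP[b0 b1]; apply: le_lt_trans tr.
  rewrite addrAC [x + _]addrC addrK mulrDr.
  apply: (le_trans (enormD _ _)); rewrite !enormZ.
  rewrite !(ger0_norm a0, ger0_norm b0, gtr0_norm t0).
  by rewrite lerD// ler_piMl// mulr_ge0 ?enorm_ge0// ltW.
have DZ (g : 'cV[R]_3 -> R) y e : differentiable g y ->
    'D_(t *: e) g y = t * 'D_e g y.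
  by move=> dg; rewrite !derive_grad// dotZr.
pose g y := f (y + t *: e2) - f y.
have dg a : 0 <= a <= 1 -> derivable g (x + a *: (t *: e1)) (t *: e1) /\
    'D_(t *: e1) g (x + a *: (t *: e1)) =
      'D_(t *: e1) f (x + a *: (t *: e1) + t *: e2) -
      'D_(t *: e1) f (x + a *: (t *: e1)).
  move=> a01; set y := x + a *: (t *: e1).
  have d1 : differentiable f (y + t *: e2).
    by apply: df; rewrite -[t *: e2]scale1r; apply: near_x; rewrite // ler01 lexx.
  have d0 : differentiable f y.
    by apply: df; have := near_x a 0; rewrite scale0r addr0; apply; rewrite // lexx ler01.
  have [s1 s2] := @derive_shiftE f y (t *: e2) (t *: e1).
  have h0 := @diff_derivable _ _ _ _ _ (t *: e1) d0.
  have h1 := @diff_derivable _ _ _ _ _ (t *: e1) d1; rewrite -s1 in h1.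
  by split; [exact: derivableB|rewrite -s2 -deriveB].
have [a a01] := @line_mvt g x (t *: e1) (fun a a01 => (dg a a01).1).
rewrite (dg a a01).2 !DZ; last 2 first.
- by apply: df; have := near_x a 0; rewrite scale0r addr0; apply; rewrite // lexx ler01.
- by apply: df; rewrite -[t *: e2]scale1r; apply: near_x; rewrite // ler01 lexx.
rewrite -mulrBr => E.
have [|b b01 E'] := @line_mvt ('D_e1 f) (x + a *: (t *: e1)) (t *: e2).
  by move=> b b01; apply: diff_derivable; apply: ddf; apply: near_x.
exists (x + a *: (t *: e1) + b *: (t *: e2)); first exact: near_x.
have dy : differentiable ('D_e1 f) (x + a *: (t *: e1) + b *: (t *: e2)).
  by apply: ddf; apply: near_x.
rewrite expr2 -mulrA -(DZ _ _ _ dy). rewrite -E' -E /g.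
by rewrite opprB -[LHS]addrA (addrC _ (f x)).
Qed.

Lemma near_dist f x e : {for x, continuous f} -> 0 < e ->
  \forall y \near x, `|f x - f y| < e.
Proof. by move=> c e0; exact: (cvgr_dist_lt f (f x) c). Qed.

(** Second differences over shrinking parallelograms approximate both mixed
    derivatives at x. *)
Lemma derive_comm (W : set 'cV[R]_3) f x (i j : 'I_3) : open W -> Ck 2 W f -> W x ->
  'D_(delta_mx j 0) ('D_(delta_mx i 0) f) x =
  'D_(delta_mx i 0) ('D_(delta_mx j 0) f) x.
Proof.
move=> oW /= [df H] Wx.
set e1 := delta_mx i 0; set e2 := delta_mx j 0.
apply/eqP; rewrite -subr_eq0 -normr_le0; apply/ler_addgt0Pr => e e0; rewrite add0r.
have close (a b c d : R) : `|a - b| < e / 2 -> `|c - d| < e / 2 -> b = d ->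
    `|a - c| < e.
  move=> ab cd bd; rewrite (splitr e) -(subrKA b) bd.
  by apply: (le_lt_trans (ler_normD _ _)); rewrite ltrD -?bd// bd distrC.
have [c12 c21] : {for x, continuous ('D_e2 ('D_e1 f))} /\
                 {for x, continuous ('D_e1 ('D_e2 f))}.
  by split; apply: (proj2 (H _)).
have e20 : 0 < e / 2 by rewrite divr_gt0.
have n0 : nbhs x W by apply: open_nbhs_nbhs.
have n1 := near_dist c12 e20.
have n2 := near_dist c21 e20.
have : nbhs x (W `&` ([set y | `|'D_e2 ('D_e1 f) x - 'D_e2 ('D_e1 f) y| < e / 2]
    `&` [set y | `|'D_e1 ('D_e2 f) x - 'D_e1 ('D_e2 f) y| < e / 2])).
  by apply: filterI n0 _; apply: filterI n1 n2.
move=> /nbhs_enormP[r r0 rH].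
have s0 : 0 < enorm e1 + enorm e2 + 1 by rewrite ltr_wpDl// addr_ge0// enorm_ge0.
pose t := r / (enorm e1 + enorm e2 + 1).
have t0 : 0 < t by rewrite divr_gt0.
have tr : t * (enorm e1 + enorm e2) < r.
  by rewrite /t mulrAC ltr_pdivrMr// ltr_pM2l// ltrDl.
have [|||y yr E] := @second_difference f x e1 e2 r t t0 => //.
- by move=> y /rH[/df].
- by move=> y /rH[Wy _]; exact: (proj1 (H i)).
have [|||z zr] := @second_difference f x e2 e1 r t t0 => //.
- by move=> z /rH[/df].
- by move=> z /rH[Wz _]; exact: (proj1 (H j)).
- by rewrite addrC.
rewrite (addrAC x) (addrAC _ (- _) (- _)) E => E'.
have t20 : t ^+ 2 != 0 by rewrite expf_neq0 ?gt_eqF.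
have [_ [h1 _]] := rH _ yr; have [_ [_ h2]] := rH _ zr; apply: ltW.
have yz := mulfI t20 E'; move: h1 h2 => /= h1 h2.
exact: (close _ _ _ _ h1 h2 yz).
Qed.

End Calculus.

(** * The signed distance *)

Section Distance.
Variable R : realType.
Variable S : set 'cV[R]_3.
Implicit Types x y : 'cV[R]_3.

Lemma lipschitz_continuous (f : 'cV[R]_3 -> R) L : 0 <= L ->
  (forall x y, `|f x - f y| <= L * enorm (x - y)) -> continuous f.
Proof.
move=> L0 fL x; apply/(@cvgrPdist_le _ _ _ (nbhs x)) => e e0.
apply: (proj2 (nbhs_enormP _ _)); exists (e / (L + 1)).
  by rewrite divr_gt0// ltr_wpDl.
move=> y; rewrite ltr_pdivlMr ?ltr_wpDl// => h; apply: (le_trans (fL _ _)).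
rewrite enormB; apply: le_trans (ltW h).
by rewrite mulrC ler_wpM2l ?enorm_ge0// lerDl.
Qed.

Lemma enorm_dist_continuous (x : 'cV[R]_3) : continuous (fun y => enorm (y - x)).
Proof.
apply: (@lipschitz_continuous _ 1) => // u v; rewrite mul1r ler_norml.
have := enormD (u - v) (v - x); have := enormD (v - u) (u - x).
by rewrite !addrA !subrK (enormB v u); lra.
Qed.

Definition udist x : R := inf [set enorm (x - y) | y in S].

Lemma sdistE x :
  sdist S x = if `[< inside S x >] then - udist x else udist x.
Proof. by []. Qed.

Lemma sdist_norm x : 0 <= udist x -> `|sdist S x| = udist x.
Proof. move=> h; rewrite sdistE; case: asbool; first by rewrite normrN ger0_norm.
by rewrite ger0_norm. Qed.

Hypothesis S0 : S !=set0.

Lemma udist_has_inf x : has_inf [set enorm (x - y) | y in S].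
Proof.
split; first by case: S0 => y Sy; exists (enorm (x - y)), y.
by exists 0 => _ [y _ <-]; exact: enorm_ge0.
Qed.

Lemma udist_le x y : S y -> udist x <= enorm (x - y).
Proof. by move=> Sy; apply: ge_inf; [exact: (udist_has_inf x).2|exists y]. Qed.

Lemma le_udist x r : (forall y, S y -> r <= enorm (x - y)) -> r <= udist x.
Proof.
move=> h; apply: lb_le_inf; first exact: (udist_has_inf x).1.
by move=> _ [y Sy <-]; exact: h.
Qed.

Lemma udist_ge0 x : 0 <= udist x.
Proof. by apply: le_udist => y _; exact: enorm_ge0. Qed.

Lemma udist_lip_le x y : udist x <= udist y + enorm (x - y).
Proof.
rewrite -lerBlDr; apply: le_udist => z Sz; rewrite lerBlDr addrC.
exact: le_trans (udist_le x Sz) (enorm_dist _ _ _).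
Qed.

Lemma udist_lip x y : `|udist x - udist y| <= enorm (x - y).
Proof.
rewrite ler_norml; have := udist_lip_le x y; have := udist_lip_le y x.
by rewrite (enormB y x); lra.
Qed.

Lemma udist_in x : S x -> udist x = 0.
Proof.
move=> Sx; apply/le_anti; rewrite udist_ge0 andbT.
by apply: (le_trans (udist_le x Sx)); rewrite subrr enorm0.
Qed.

Lemma sdist_in x : S x -> sdist S x = 0.
Proof. by move=> Sx; apply/eqP; rewrite -normr_eq0 sdist_norm ?udist_ge0// udist_in. Qed.

Lemma sdist_le x y : S y -> `|sdist S x| <= enorm (x - y).
Proof. by move=> Sy; rewrite sdist_norm ?udist_ge0// udist_le. Qed.

Lemma inside_segment x y : (forall t, 0 <= t <= 1 -> ~ S (x + t *: (y - x))) ->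
  inside S x <-> inside S y.
Proof.
move=> h.
have cc : connected_component (~` S) x y.
  apply: (@connected_component_max _ _ ((fun t : R => x + t *: (y - x)) @` `[0, 1])).
  - by exists 0; rewrite /= ?in_itv/= ?lexx ?ler01// scale0r addr0.
  - by move=> _ [t /= t01 <-]; apply: h; move: t01; rewrite in_itv.
  - apply: connected_continuous_connected; first exact: segment_connected.
    apply: continuous_subspaceT => t.
    have h0 : (fun t : R => t) @ t --> t by exact: cvg_id.
    by have := cvgD (cvg_cst x) (cvgZ h0 (cvg_cst (y - x))); apply.
  - by exists 1; rewrite /= ?in_itv/= ?lexx ?ler01// scale1r addrC subrK.
have Sx : ~ S x by have := h 0; rewrite scale0r addr0 lexx ler01; exact.
have Sy : ~ S y by have := h 1; rewrite scale1r addrC subrK lexx ler01; exact.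
rewrite /inside /= (same_connected_component cc).
by split=> -[].
Qed.

Lemma sdist_segment x y : (forall t, 0 <= t <= 1 -> ~ S (x + t *: (y - x))) ->
  exists s : R, [/\ s ^+ 2 = 1, sdist S x = s * udist x & sdist S y = s * udist y].
Proof.
move=> /inside_segment xy; rewrite !sdistE (asbool_equiv_eq xy).
case: ifP => _; first by exists (-1); rewrite sqrrN expr1n !mulN1r.
by exists 1; rewrite expr1n !mul1r.
Qed.

(** Where the segment from x to y misses S the sign is constant; where it meets
    S at z both distances are controlled by the two pieces of the segment. *)
Lemma sdist_lip x y : `|sdist S x - sdist S y| <= enorm (x - y).
Proof.
have [[t [t01 St]]|h] := pselect (exists t, 0 <= t <= 1 /\ S (x + t *: (y - x))).
  apply: (le_trans (ler_normB _ _)).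
  apply: (le_trans (lerD (sdist_le x St) (sdist_le y St))).
  have -> : x - (x + t *: (y - x)) = t *: (x - y).
    by rewrite opprD addrA subrr add0r -scalerN opprB.
  have -> : y - (x + t *: (y - x)) = (1 - t) *: (y - x).
    by rewrite opprD addrA scalerBl scale1r.
  case/andP: t01 => t0 t1; rewrite !enormZ (enormB y) -mulrDl.
  by rewrite !ger0_norm ?subr_ge0// addrC subrK mul1r.
have [|s [s1 -> ->]] := @sdist_segment x y.
  by move=> t t01 St; apply: h; exists t.
rewrite -mulrBr normrM (_ : `|s| = 1) ?mul1r; first exact: udist_lip.
by apply/eqP; rewrite -(@eqrXn2 _ 2)// real_normK ?num_real// expr1n s1.
Qed.

Lemma sdist_derive_le x v : `|'D_v (sdist S) x| <= enorm v.
Proof.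
apply: derive_le; first exact: enorm_ge0.
near=> t; apply: (le_trans (sdist_lip _ _)).
by rewrite addrAC subrr add0r enormZ mulrC.
Unshelve. all: by end_near.
Qed.

(** The gradient n is tested with itself: |n|^2 is the derivative along n, which
    the Lipschitz bound limits to |n|. *)
Lemma normal_le1 x : differentiable (sdist S) x -> dot (normal S x) (normal S x) <= 1.
Proof.
move=> d; have := sdist_derive_le x (normal S x); rewrite derive_grad// -/(normal S x).
rewrite -sqr_enorm ger0_norm ?sqr_ge0// => h.
have := enorm_ge0 (normal S x); nra.
Qed.

Hypothesis Sc : compact S.

Lemma udist_attained x : exists2 y, S y & udist x = enorm (x - y).
Proof.
have := @compact_EVT_min _ R (fun y => enorm (x - y)) S S0 Sc.
case=> [|y /set_mem Sy ymin].
  apply: continuous_subspaceT; under eq_fun do rewrite enormB.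
  exact: enorm_dist_continuous.
exists y => //; apply/le_anti; rewrite udist_le//=.
by apply: le_udist => z Sz; apply: ymin; exact: mem_set.
Qed.

Lemma udist_eq0 x : udist x = 0 -> S x.
Proof.
move=> d0; have [y Sy] := udist_attained x; rewrite d0 => /esym/enorm_eq0/eqP.
by rewrite subr_eq0 => /eqP ->.
Qed.

(** Along the segment from x to a nearest point of S the distance decreases at
    unit rate, so the gradient, which has length at most one, points along this
    segment. *)
Lemma proj_in x : differentiable (sdist S) x -> S (Defs.proj S x).
Proof.
move=> dx; have [Sx|nSx] := pselect (S x).
  by rewrite /Defs.proj sdist_in// scale0r subr0.
have [y Sy dE] := udist_attained x; set d := udist x in dE.
have d0 : 0 < d.
  rewrite lt0r udist_ge0 andbT; apply/eqP => d0.
  exact/nSx/udist_eq0.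
have [e eE] : exists e, e = d^-1 *: (y - x) by eexists.
have e1 : enorm e = 1.
  by rewrite eE enormZ enormB -dE ger0_norm ?invr_ge0 ?ltW// mulVf ?gt_eqF.
have ye : y = x + d *: e by rewrite eE scalerA divff ?gt_eqF// scale1r addrC subrK.
have du t : 0 <= t < d -> udist (x + t *: e) = d - t.
  move=> /andP[t0 td]; apply/le_anti/andP; split.
    apply: (le_trans (udist_le _ Sy)).
    rewrite [in leLHS]ye opprD addrACA subrr add0r -scalerBl enormZ e1 mulr1.
    by rewrite distrC gtr0_norm ?subr_gt0.
  have := udist_lip_le x (x + t *: e); rewrite opprD addrA subrr add0r enormN.
  by rewrite enormZ e1 mulr1 ger0_norm// lerBlDr.
have /cid[s [s1 sx sd]] : exists s : R, [/\ s ^+ 2 = 1, sdist S x = s * d &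
    forall t, 0 <= t < d -> sdist S (x + t *: e) = s * (d - t)].
  have seg t : 0 <= t < d -> exists s : R,
      [/\ s ^+ 2 = 1, sdist S x = s * d & sdist S (x + t *: e) = s * (d - t)].
    move=> t0d; have [|s [s1 h1 h2]] := @sdist_segment x (x + t *: e); last first.
      by exists s; split=> //; rewrite h2 du.
    move=> r /andP[r0 r1]; rewrite addrAC subrr add0r scalerA.
    case/andP: t0d => t0 td.
    have rt : r * t < d by apply: le_lt_trans td; rewrite ler_piMl.
    move=> /udist_in; rewrite du ?mulr_ge0//.
    by move/eqP; rewrite subr_eq0 gt_eqF.
  have [|s [s1 sx _]] := seg 0; first by rewrite lexx.
  exists s; split=> // t /seg[s' [_ sx' ->]].
  by move: sx'; rewrite sx => /mulIf -> //; rewrite gt_eqF.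
(* the derivative exists, hence equals the right derivative *)
have ne : dot (normal S x) e = - s.
  rewrite -derive_grad//.
  have /cvg_at_rightE := diff_derivable dx : derivable (sdist S) x e.
  rewrite /derive => ->.
  apply: cvg_lim => //; apply: (@cvg_trans _ ((fun=> - s) @ (0 : R)^'+)); last exact: cvg_cst.
  apply: near_eq_cvg; near=> t => /=.
  have t0 : 0 < t by near: t; exact: nbhs_right_gt.
  have td : t < d by near: t; exact: nbhs_right_lt.
  rewrite (addrC (t *: e)) sd ?(ltW t0) ?td// sx -mulrBr addrAC subrr add0r.
  by rewrite /GRing.scale/= mulrCA mulrN mulVf ?gt_eqF// mulrN1.
(* equality in the Cauchy-Schwarz inequality *)
have nE : normal S x = - (s *: e).
  apply/eqP; rewrite -subr_eq0 opprK; apply/eqP/dot_eq0/le_anti.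
  rewrite dot_ge0 andbT dotDl !dotDr !dotZl !dotZr (dotC e) ne (_ : dot e e = 1); last first.
    by rewrite -sqr_enorm e1 expr1n.
  have := normal_le1 dx; nra.
rewrite /Defs.proj sx nE scalerN opprK scalerA mulrAC -expr2 s1 mul1r -ye.
exact: Sy.
Unshelve. all: by end_near. Qed.

End Distance.

(** * Tetrahedra and the cut mesh *)

Section Tetrahedra.
Variable R : realType.
Implicit Types (x y : 'cV[R]_3) (T : tetra R) (ts : seq (tetra R)).

(** The barycentric coordinates with respect to a nondegenerate tetrahedron are
    affine functions. *)
Lemma hullP T : Defs.nondegenerate T -> exists (A : 'M[R]_(4, 3)) (c : 'cV[R]_4),
  forall x, hull T x <-> forall i, 0 <= (A *m x + c) i 0.
Proof.
rewrite /Defs.nondegenerate => rk; set M := col_mx T _ in rk.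
have Mu : (M : 'M[R]_4) \in unitmx by rewrite -row_free_unit /row_free rk.
pose G : 'M[R]_(4, 3 + 1) := invmx (M : 'M[R]_4).
have GM : G *m M = 1%:M by exact: mulVmx Mu.
have MG : M *m G = 1%:M by exact: mulmxV Mu.
exists (lsubmx G), (rsubmx G) => x.
have E : lsubmx G *m x + rsubmx G = G *m col_mx x 1%:M.
  by rewrite -[G in RHS]hsubmxK mul_row_col mulmx1.
have one (lam : 'cV[R]_4) : (const_mx 1 : 'rV[R]_4) *m lam = (\sum_i lam i 0)%:M.
  apply/matrixP => i j; rewrite !mxE !ord1 mulr1n.
  by apply: eq_bigr => k _; rewrite mxE mul1r.
rewrite E; split=> [[lam [l0 l1 _] <-] i|h].
  have -> : col_mx (T *m lam) 1%:M = M *m lam by rewrite mul_col_mx one l1.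
  by rewrite mulmxA GM mul1mx.
exists (G *m col_mx x 1%:M); last first.
  have : M *m (G *m col_mx x 1%:M) = col_mx x 1%:M by rewrite mulmxA MG mul1mx.
  by rewrite mul_col_mx => /eq_col_mx[].
split=> [//||i]; last by rewrite inE.
have : M *m (G *m col_mx x 1%:M) = col_mx x 1%:M by rewrite mulmxA MG mul1mx.
rewrite mul_col_mx => /eq_col_mx[_]; rewrite one => /matrixP/(_ 0 0).
by rewrite !mxE !mulr1n.
Qed.

Lemma hull_closed T : Defs.nondegenerate T -> closed (hull T).
Proof.
move=> /hullP[A [c Ac]].
have -> : hull T = \bigcap_(i : 'I_4) [set x | 0 <= (A *m x + c) i 0].
  apply/seteqP; split=> x; first by move=> /Ac h i _; exact: h.
  by move=> h; apply/Ac => i; exact: h.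
apply: closed_bigI => i _.
apply: (@closed_comp _ _ (fun x => (A *m x + c) i 0) [set r : R | 0 <= r]).
  move=> x _; apply: (@lipschitz_continuous _ _ (\sum_j `|A i j|)) => [|y z].
    by apply: sumr_ge0.
  have -> : (A *m y + c) i 0 - (A *m z + c) i 0 = \sum_j A i j * (y - z) j 0.
    rewrite !mxE opprD addrACA subrr addr0 -sumrB; apply: eq_bigr => j _.
    by rewrite !mxE mulrBr.
  apply: (le_trans (ler_norm_sum _ _ _)); rewrite mulr_suml; apply: ler_sum => j _.
  by rewrite normrM ler_wpM2l// coord_le_enorm.
exact: closed_ge.
Qed.

Lemma hull_convex T x y t : hull T x -> hull T y -> 0 <= t <= 1 ->
  hull T (x + t *: (y - x)).
Proof.
move=> [l [l0 l1 _] <-] [m [m0 m1 _] <-] /andP[t0 t1].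
exists (l + t *: (m - l)); last by rewrite mulmxDr -scalemxAr mulmxBr.
split=> [i||i]; last by rewrite inE.
  rewrite !mxE (_ : _ + _ = (1 - t) * l i 0 + t * m i 0); last by ring.
  by rewrite addr_ge0// mulr_ge0// subr_ge0.
under eq_bigr do rewrite !mxE.
by rewrite big_split/= -mulr_sumr sumrB l1 m1 subrr mulr0 addr0.
Qed.

Lemma hull_bounded T x : hull T x -> forall i, `|x i 0| <= \sum_j `|T i j|.
Proof.
move=> [l [l0 l1 _] <-] i; rewrite mxE; apply: (le_trans (ler_norm_sum _ _ _)).
apply: ler_sum => j _; rewrite normrM ler_piMr// ger0_norm//.
by rewrite -l1 (bigD1 j)//= lerDl sumr_ge0.
Qed.

(** The finitely many tetrahedra that miss x are closed, so a neighborhood of x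
    misses them. *)
Lemma near_hull ts x : (forall T, T \in ts -> Defs.nondegenerate T) ->
  \forall y \near x, forall T, T \in ts -> hull T y -> hull T x.
Proof.
elim: ts => [_|T ts IH nd]; first by near=> y.
have h1 : \forall y \near x, hull T y -> hull T x.
  have [Tx|nTx] := pselect (hull T x); first by near=> y.
  have : nbhs x (~` hull T).
    by apply: open_nbhs_nbhs; split=> //; apply/closed_openC/hull_closed/nd/mem_head.
  by apply: filterS => y.
have h2 : \forall y \near x, forall T, T \in ts -> hull T y -> hull T x.
  by apply: IH => T' T't; apply: nd; rewrite inE T't orbT.
near=> y => T'; rewrite inE => /orP[/eqP ->|T't].
  by near: y.
by move: T' T't; near: y.
Unshelve. all: by end_near. Qed.

End Tetrahedra.

Section CutMesh.
Variable R : realType.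
Variables (S Omega : set 'cV[R]_3) (ts : seq (tetra R)).
Hypotheses (nd : forall T, T \in ts -> Defs.nondegenerate T).
Implicit Types (x y : 'cV[R]_3) (T : tetra R).

Lemma near_cut x : nbhs x (cut_cover S ts) ->
  \forall y \near x, exists T, [/\ cut_mesh S ts T, hull T x & hull T y].
Proof.
move=> h; have h2 := near_hull x nd.
near=> y.
have [T [Tts TS] Ty] : cut_cover S ts y by near: y.
exists T; split=> //; move: T Tts TS Ty.
have : forall T, T \in ts -> hull T y -> hull T x by near: y.
by move=> H T Tts _; exact: H.
Unshelve. all: by end_near. Qed.

Lemma cut_cover_closed : closed (cut_cover S ts).
Proof.
apply: closed_bigcup => [|T [/nd + _]]; last exact: hull_closed.
apply: (@sub_finite_set _ _ [set` ts]); last exact: finite_seq.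
by move=> T [].
Qed.

Lemma cut_domain_open : open (cut_domain S ts).
Proof. exact: open_interior. Qed.

Lemma cut_domain_nbhs x : cut_domain S ts x -> nbhs x (cut_cover S ts).
Proof.
rewrite /cut_domain -(closure_id _).1; last exact: cut_cover_closed.
by move=> h; exact: h.
Qed.

(** A tetrahedron that meets a small neighborhood of a surface point x contains x,
    hence belongs to the cut mesh. *)
Lemma surface_nbhs x : Omega `<=` Defs.cover ts -> open Omega -> S `<=` Omega ->
  S x -> nbhs x (cut_cover S ts).
Proof.
move=> Ots oO SO Sx; have h2 := near_hull x nd.
near=> y.
have : Omega y by near: y; apply: open_nbhs_nbhs; split=> //; exact: SO.
move=> /Ots[T /= Tts Ty]; exists T => //; split=> //.
exists x; split=> //; move: Ty.
have : forall T, T \in ts -> hull T y -> hull T x by near: y.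
by apply.
Unshelve. all: by end_near. Qed.

End CutMesh.

(** * One-sided derivatives *)

Section OneSided.
Variable R : realType.
Implicit Types (x e : 'cV[R]_3) (f : 'cV[R]_3 -> R).

Definition right_derivative f x e (a : R) : Prop :=
  h^-1 * (f (x + h *: e) - f x) @[h --> (0 : R)^'+] --> a.

(** The derivative along e exists exactly if the one-sided derivatives along e
    and -e are opposite; otherwise its default value is 0. *)
Lemma derive_right f x e a b :
  right_derivative f x e a -> right_derivative f x (- e) b ->
  'D_e f x = if a == - b then a else 0.
Proof.
move=> ha hb; set q := fun h => h^-1 *: ((f \o shift x) (h *: e) - f x).
have qa : q h @[h --> (0 : R)^'+] --> a.
  have -> : q = fun h => h^-1 * (f (x + h *: e) - f x).
    by apply/funext => h; rewrite /q/= (addrC (h *: e)).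
  exact: ha.
have qb : q h @[h --> (0 : R)^'-] --> - b.
  apply/cvg_at_leftNP; rewrite oppr0.
  have -> : q \o -%R = fun h => - (h^-1 * (f (x + h *: - e) - f x)).
    apply/funext => h; rewrite /q/= (addrC (_ *: e)) invrN -mulNr.
    by rewrite (scaleNr h e) (scalerN h e).
  exact: cvgN hb.
rewrite /derive -/q; case: eqVneq => [ab|ab].
  by apply: cvg_lim => //; apply: (@cvg_at_right_left_dnbhs _ R^o) => //; rewrite ab.
have [/cvg_ex[/= l ql]|/dvgP -> //] := pselect (cvg (q @ (0 : R)^')).
move/eqP: ab; case.
rewrite -(cvg_unique _ (cvg_dnbhs_at_right ql) qa)//.
by rewrite (cvg_unique _ (cvg_dnbhs_at_left ql) qb).
Qed.

Lemma right_derivative_seq f x e a : right_derivative f x e a ->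
  n.+1%:R * (f (x + n.+1%:R^-1 *: e) - f x) @[n --> \oo] --> a.
Proof.
move=> /cvg_at_rightP /(_ (fun n => n.+1%:R^-1)).
have -> : (fun n => n.+1%:R * (f (x + n.+1%:R^-1 *: e) - f x)) =
  (fun n : nat => n.+1%:R^-1^-1 * (f (x + n.+1%:R^-1 *: e) - f x)).
  by apply/funext => n; rewrite invrK.
apply; split; first by move=> n; rewrite invr_gt0.
exact: cvg_harmonic.
Qed.

Lemma differentiable_right f x e : differentiable f x ->
  right_derivative f x e ('D_e f x).
Proof.
move=> df; have := diff_derivable df : derivable f x e.
rewrite /derivable => h; apply: cvg_dnbhs_at_right.
have -> : (fun h : R => h^-1 * (f (x + h *: e) - f x)) =
  (fun h : R => h^-1 *: ((f \o shift x) (h *: e) - f x)).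
  by apply/funext => k; rewrite /= (addrC (k *: e)).
exact: h.
Qed.

End OneSided.

(** * Finite element functions *)

Section Polynomials.
Variable R : realType.
Implicit Types (f g : 'cV[R]_3 -> R).

Section Closure.
Variable P : ('cV[R]_3 -> R) -> Prop.
Hypothesis P_cst : forall a, P (fun=> a).
Hypothesis P_coord : forall i, P (fun x => x i 0).
Hypothesis PD : forall f g, P f -> P g -> P (fun x => f x + g x).
Hypothesis PM : forall f g, P f -> P g -> P (fun x => f x * g x).

Lemma closure_sum (I : Type) (r : seq I) (C : pred I) F :
  (forall i, P (F i)) -> P (fun x => \sum_(i <- r | C i) F i x).
Proof.
move=> PF; elim: r => [|i r IH].
  by under eq_fun do rewrite big_nil; exact: P_cst.
under eq_fun do rewrite big_cons; case: (C i) => //.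
exact: PD.
Qed.

Lemma closure_exp f n : P f -> P (fun x => f x ^+ n).
Proof.
move=> Pf; elim: n => [|n IH]; first by under eq_fun do rewrite expr0.
by under eq_fun do rewrite exprS; exact: PM.
Qed.

(** Polynomials inherit every property of functions that is stable under sums
    and products; this is used for differentiability and for Lipschitz bounds. *)
Lemma closure_poly3 m (c : 'I_m.+1 -> 'I_m.+1 -> 'I_m.+1 -> R) : P (poly3 c).
Proof.
apply: closure_sum => a; apply: closure_sum => b; apply: closure_sum => d.
by apply: PM; [apply: PM; [apply: PM|]|]; try exact: closure_exp.
Qed.

End Closure.

Lemma poly3_differentiable m (c : 'I_m.+1 -> 'I_m.+1 -> 'I_m.+1 -> R) x :
  differentiable (poly3 c) x.
Proof.
move: x; apply: (closure_poly3 (P := fun f => forall x, differentiable f x)).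
- by move=> a x; exact: differentiable_cst.
- by move=> i x; exact: differentiable_coord.
- by move=> f g df dg x; exact: differentiableD.
- by move=> f g df dg x; exact: differentiableM.
Qed.

Definition bounded_lipschitz (D : set 'cV[R]_3) f L : Prop :=
  forall x y, D x -> D y -> `|f x| <= L /\ `|f x - f y| <= L * enorm (x - y).

Lemma bounded_lipschitz_le D f L L' : L <= L' ->
  bounded_lipschitz D f L -> bounded_lipschitz D f L'.
Proof.
move=> LL h x y Dx Dy; have [h1 h2] := h x y Dx Dy.
split; first exact: le_trans LL.
by apply: (le_trans h2); rewrite ler_wpM2r// enorm_ge0.
Qed.

Lemma poly3_bounded_lipschitz m (c : 'I_m.+1 -> 'I_m.+1 -> 'I_m.+1 -> R)
    (D : set 'cV[R]_3) r :
  (forall x i, D x -> `|x i 0| <= r) ->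
  exists2 L, 0 <= L & bounded_lipschitz D (poly3 c) L.
Proof.
move=> Dr; apply: (closure_poly3
  (P := fun f => exists2 L, 0 <= L & bounded_lipschitz D f L)).
- move=> a; exists `|a| => // x y _ _; split=> //.
  by rewrite subrr normr0 mulr_ge0 ?enorm_ge0.
- move=> i; exists (Num.max `|r| 1); first by rewrite le_max normr_ge0.
  move=> x y Dx Dy; split; first by rewrite le_max (le_trans (Dr _ _ Dx)) ?ler_norm.
  have -> : x i 0 - y i 0 = (x - y) i 0 by rewrite !mxE.
  apply: (le_trans (coord_le_enorm _ _)); rewrite ler_peMl ?enorm_ge0//.
  by rewrite le_max lexx orbT.
- move=> f g [L L0 hf] [M M0 hg]; exists (L + M); first exact: addr_ge0.
  move=> x y Dx Dy; have [f1 f2] := hf x y Dx Dy; have [g1 g2] := hg x y Dx Dy.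
  split; first by apply: (le_trans (ler_normD _ _)); exact: lerD.
  rewrite opprD addrACA mulrDl.
  by apply: (le_trans (ler_normD _ _)); exact: lerD.
- move=> f g [L L0 hf] [M M0 hg]; exists (L * M + 2 * (L * M)).
    by rewrite addr_ge0 ?mulr_ge0.
  move=> x y Dx Dy; have [f1 f2] := hf x y Dx Dy; have [g1 g2] := hg x y Dx Dy.
  have [g3 _] := hg y x Dy Dx.
  split.
    rewrite normrM; apply: (@le_trans _ _ (L * M)); first exact: ler_pM.
    by rewrite lerDl !mulr_ge0.
  have -> : f x * g x - f y * g y = f x * (g x - g y) + (f x - f y) * g y by ring.
  apply: (le_trans (ler_normD _ _)); rewrite !normrM.
  have n0 := enorm_ge0 (x - y).
  have h1 : `|f x| * `|g x - g y| <= L * (M * enorm (x - y)) by exact: ler_pM.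
  have h2 : `|f x - f y| * `|g y| <= (L * enorm (x - y)) * M by exact: ler_pM.
  have h3 : 0 <= L * M * enorm (x - y) by rewrite !mulr_ge0.
  apply: (le_trans (lerD h1 h2)).
  have -> : L * (M * enorm (x - y)) + L * enorm (x - y) * M =
    2 * (L * M) * enorm (x - y) by ring.
  by rewrite ler_wpM2r// lerDr mulr_ge0.
Qed.

End Polynomials.

Section FiniteElements.
Variable R : realType.
Variables (S : set 'cV[R]_3) (ts : seq (tetra R)).
Hypotheses (nd : forall T, T \in ts -> Defs.nondegenerate T).
Implicit Types (x y e : 'cV[R]_3) (T : tetra R) (v : 'cV[R]_3 -> R).

Lemma Vh_bounded_lipschitz m v : Vh S ts m v -> exists2 L, 0 <= L &
  forall T, cut_mesh S ts T -> bounded_lipschitz (hull T) v L.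
Proof.
move=> [_ vp].
suff : exists2 L, 0 <= L & forall T, T \in ts -> (hull T `&` S) !=set0 ->
    bounded_lipschitz (hull T) v L.
  by move=> [L L0 h]; exists L => // T [Tts TS]; exact: h.
have : forall T, T \in ts -> (hull T `&` S) !=set0 ->
    exists2 L, 0 <= L & bounded_lipschitz (hull T) v L.
  move=> T Tts TS; have [c vc] := vp T (conj Tts TS).
  have [|L L0 h] := @poly3_bounded_lipschitz R m c (hull T)
      (\sum_i \sum_j `|T i j|).
    move=> x i Tx; apply: (le_trans (hull_bounded Tx i)).
    rewrite [leRHS](bigD1 i)//= lerDl; apply: sumr_ge0 => k _.
    by apply: sumr_ge0.
  by exists L => // x y Tx Ty; rewrite !vc//; exact: h.
elim: (ts) => [|T r IH] H; first by exists 0.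
have [L L0 hL] := IH (fun T' T'r => H T' (mem_behead (s := T :: r) T'r)).
have [[TS]|nTS] := pselect ((hull T `&` S) !=set0).
  move=> HT; have [M M0 hM] := H T (mem_head _ _) (ex_intro _ _ HT).
  exists (Num.max L M); first by rewrite le_max L0.
  move=> T'; rewrite inE => /orP[/eqP -> _|T'r T'S].
    by apply: bounded_lipschitz_le hM; rewrite le_max lexx orbT.
  by apply: bounded_lipschitz_le (hL _ T'r T'S); rewrite le_max lexx.
by exists L => // T'; rewrite inE => /orP[/eqP -> //|]; exact: hL.
Qed.

(** A point y near x shares a tetrahedron with x, so that the bounds on the single
    elements suffice although the segment from x to y may cross faces. *)
Lemma near_lipschitz v x L : nbhs x (cut_cover S ts) ->
  (forall T, cut_mesh S ts T -> bounded_lipschitz (hull T) v L) ->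
  \forall y \near x, `|v y - v x| <= L * enorm (y - x).
Proof.
move=> hx vL; have := near_cut nd hx; apply: filterS => y [T [cT Tx Ty]].
exact: (vL T cT y x Ty Tx).2.
Qed.

Lemma near_bounded_lipschitz v x L e : nbhs x (cut_cover S ts) -> 0 <= L ->
  (forall T, cut_mesh S ts T -> bounded_lipschitz (hull T) v L) ->
  `|'D_e v x| <= L * enorm e.
Proof.
move=> hx L0 vL; apply: derive_le; first by rewrite mulr_ge0 ?enorm_ge0.
have := near_line e (near_lipschitz hx vL); apply: filterS => t.
by rewrite addrAC subrr add0r enormZ mulrA mulrAC.
Qed.

(** By convexity a short segment that starts at x stays in one tetrahedron, where
    the function is a polynomial. *)
Lemma Vh_right m v x e : Vh S ts m v -> nbhs x (cut_cover S ts) ->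
  exists a, right_derivative v x e a.
Proof.
move=> [_ vp] hx.
have /nbhs_ballP[d /= d0 hd] := near_line e (near_cut nd hx).
have : ball (0 : R) d (d / 2).
  rewrite -ball_normE/= sub0r normrN gtr0_norm ?divr_gt0// ltr_pdivrMr//.
  by rewrite mulr2n mulrDr mulr1 ltrDl.
move=> /hd[T [cT Tx Ty]]; have [c vc] := vp T cT.
exists ('D_e (poly3 c) x).
have := @differentiable_right _ (poly3 c) x e (poly3_differentiable c x).
apply: cvg_trans; apply: near_eq_cvg; near=> t.
have t0 : 0 < t by near: t; exact: nbhs_right_gt.
have td : t < d / 2 by near: t; apply: nbhs_right_lt; rewrite divr_gt0.
rewrite !vc//.
have := hull_convex Tx Ty (t := t / (d / 2)).
rewrite addrAC subrr add0r scalerA divfK ?gt_eqF ?divr_gt0//; apply.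
have d20 : 0 < d / 2 by rewrite divr_gt0.
apply/andP; split; first by apply: divr_ge0; exact: ltW.
by rewrite ler_pdivrMr// mul1r; exact: ltW.
Unshelve. all: by end_near. Qed.

Lemma poly3_widen l k (c : 'I_l.+1 -> 'I_l.+1 -> 'I_l.+1 -> R) : (l <= k)%N ->
  exists c' : 'I_k.+1 -> 'I_k.+1 -> 'I_k.+1 -> R, poly3 c = poly3 c'.
Proof.
move=> lk; exists (fun a b d => if (a + b + d <= l)%N
  then c (inord a) (inord b) (inord d) else 0); apply/funext => x; rewrite /poly3.
have W (F : nat -> R) : (forall i, (l < i)%N -> F i = 0) ->
    \sum_(i < l.+1) F i = \sum_(i < k.+1) F i.
  move=> F0; rewrite (big_ord_widen _ F (lk : (l.+1 <= k.+1)%N)) [LHS]big_mkcond.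
  by apply: eq_bigr => i _; case: ltnP => // /F0.
pose G (a b d : nat) : R := if (a + b + d <= l)%N
  then c (inord a) (inord b) (inord d) * x 0 0 ^+ a * x 1 0 ^+ b * x 2%:R 0 ^+ d
  else 0.
have G0 a b d : (l < a)%N || (l < b)%N || (l < d)%N -> G a b d = 0.
  by rewrite /G => h; case: ifP => // abe; exfalso; lia.
transitivity (\sum_(a < l.+1) \sum_(b < l.+1) \sum_(d < l.+1) G a b d).
  apply: eq_bigr => a _; apply: eq_bigr => b _; rewrite big_mkcond.
  by apply: eq_bigr => d _; rewrite /G !inord_val.
rewrite (W (fun a => \sum_(b < l.+1) \sum_(d < l.+1) G a b d)) => [|a la]; last first.
  by rewrite big1// => b _; rewrite big1// => d _; rewrite G0// la.
apply: eq_bigr => a _.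
rewrite (W (fun b => \sum_(d < l.+1) G a b d)) => [|b lb]; last first.
  by rewrite big1// => d _; rewrite G0// lb orbT.
apply: eq_bigr => b _; rewrite (W (fun d => G a b d)) => [|d le]; last first.
  by rewrite G0// le orbT.
rewrite [RHS]big_mkcond; apply: eq_bigr => d _; rewrite /G.
case: ifP => abe; first by rewrite (leq_trans abe lk).
by case: ifP => // _; rewrite !mul0r.
Qed.

Lemma Vh_le l k v : (l <= k)%N -> Vh S ts l v -> Vh S ts k v.
Proof.
move=> lk [cv vp]; split=> // T /vp[c vc]; have [c' cc'] := poly3_widen c lk.
by exists c' => x Tx; rewrite -cc' vc.
Qed.

Lemma Vh0 m : Vh S ts m (fun=> 0).
Proof.
split; first exact: cst_continuous.
move=> T _; exists (fun _ _ _ => 0) => x _; apply/esym.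
by do 3 (apply: big1 => ? _); rewrite !mul0r.
Qed.

End FiniteElements.

(** * The Hausdorff measure is a metric outer measure *)

Section MetricOuterMeasure.
Variable R : realType.
Local Open Scope ereal_scope.
Implicit Types A B E X C : set 'cV[R]_3.

Definition separated_by (eta : R) A B : Prop :=
  forall x y, A x -> B y -> (eta <= enorm (x - y))%R.

(** E if it meets A, and the empty set otherwise: what remains of a member of a
    cover when the cover is restricted to A. *)
Let meet A E : set 'cV[R]_3 := [set x | E x /\ (E `&` A) !=set0].

(** A set of diameter less than eta cannot meet both A and B. *)
Lemma hweight_split (delta eta : R) A B E : (0 < delta < eta)%R ->
  separated_by eta A B ->
  hweight delta (meet A E) + hweight delta (meet B E) <= hweight delta E.
Proof.
move=> /andP[d0 de] AB.
have meet0 D : ~ ((E `&` D) !=set0) -> meet D E = set0.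
  by move=> n; apply/seteqP; split=> // x [_ /n].
have meetE D : (E `&` D) !=set0 -> meet D E = E.
  by move=> n; apply/seteqP; split=> // x; case.
have [EA|/meet0 ->] := pselect ((E `&` A) !=set0); last first.
  rewrite hweight0// add0e.
  have [EB|/meet0 ->] := pselect ((E `&` B) !=set0); first by rewrite meetE.
  by rewrite hweight0// hweight_ge0.
have [EB|/meet0 ->] := pselect ((E `&` B) !=set0); last first.
  by rewrite hweight0// adde0 meetE.
apply: (le_trans (leey _)); apply: le_ereal_inf_tmp => _ [r [/andP[_ rd] rE] <-].
exfalso; case: EA => x [Ex Ax]; case: EB => y [Ey By].
have := AB x y Ax By; have := rE x y Ex Ey => h1 h2.
by have := le_lt_trans (le_trans h2 (le_trans h1 rd)) de; rewrite ltxx.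
Qed.

Lemma mu_ext_separated (delta eta : R) A B : (0 < delta < eta)%R ->
  separated_by eta A B ->
  mu_ext (hweight delta) A + mu_ext (hweight delta) B <=
  mu_ext (hweight delta) (A `|` B).
Proof.
move=> de AB; apply: le_ereal_inf_tmp => _ [F [_ FAB] <-].
have cov D : D `<=` A `|` B -> mu_ext (hweight delta) D <=
    \sum_(k <oo) hweight delta (meet D (F k)).
  move=> DAB; apply: ereal_inf_lbound; exists (fun k => meet D (F k)) => //.
  split; first by move=> k; exact: sub_sigma_algebra.
  move=> x Dx; have [k _ Fkx] := FAB x (DAB x Dx).
  by exists k => //; split=> //; exists x.
apply: (le_trans (leeD (cov A _) (cov B _))); [exact: subsetUl|exact: subsetUr|].
rewrite -nneseriesD; last 2 first.
- by move=> i _ _; exact: hweight_ge0.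
- by move=> i _ _; exact: hweight_ge0.
apply: lee_nneseries => [i _ _|i _]; last exact: hweight_split de AB.
by rewrite adde_ge0// hweight_ge0.
Qed.

Lemma le_hweight (d1 d2 : R) E : (d1 <= d2)%R -> hweight d2 E <= hweight d1 E.
Proof.
move=> d12; apply: ereal_inf_le_tmp => _ [r [/andP[r0 rd] rE] <-].
by exists r => //; split=> //; rewrite r0 (le_trans rd).
Qed.

Lemma le_mu_ext_hweight (d1 d2 : R) A : (d1 <= d2)%R ->
  mu_ext (hweight d2) A <= mu_ext (hweight d1) A.
Proof.
move=> d12; apply: le_ereal_inf_tmp => _ [F FA <-].
apply: le_trans (lee_nneseries _ _).
- by apply: ereal_inf_lbound; exists F.
- by move=> i _ _; exact: hweight_ge0.
- by move=> i _; exact: le_hweight.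
Qed.

Lemma hausdorff2_separated (eta : R) A B : (0 < eta)%R -> separated_by eta A B ->
  hausdorff2 A + hausdorff2 B <= hausdorff2 (A `|` B).
Proof.
move=> e0 AB.
(* The outer measures grow as delta decreases, so different values of delta can
   be replaced by a common smaller one. *)
have main d1 d2 : (0 < d1)%R -> (0 < d2)%R ->
    mu_ext (hweight d1) A + mu_ext (hweight d2) B <= hausdorff2 (A `|` B).
  move=> d10 d20; pose d : R := Num.min (Num.min d1 d2) (eta / 2)%R.
  have d0 : (0 < d)%R by rewrite !lt_min d10 d20 divr_gt0.
  have dd1 : (d <= d1)%R by rewrite !ge_min lexx.
  have dd2 : (d <= d2)%R by rewrite !ge_min lexx orbT.
  have de : (d < eta)%R.
    by rewrite gt_min orbC ltr_pdivrMr// mulr_natr mulr2n ltrDl e0.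
  apply: (le_trans (leeD (le_mu_ext_hweight A dd1) (le_mu_ext_hweight B dd2))).
  apply: (le_trans (@mu_ext_separated d eta A B _ AB)); first by rewrite d0.
  by apply: ereal_sup_ubound; exists d.
have [->|hAB] := eqVneq (hausdorff2 (A `|` B)) +oo; first exact: leey.
have fin x : 0 <= x -> x <= hausdorff2 (A `|` B) -> x \is a fin_num.
  by move=> x0 xle; rewrite ge0_fin_numE// (le_lt_trans xle)// ltey.
have fA : hausdorff2 A \is a fin_num.
  by apply: fin; [exact: hausdorff2_ge0|exact: le_hausdorff2].
rewrite addeC -leeBrDr//; apply: ge_ereal_sup => _ [d2 /= d20 <-].
have fB : mu_ext (hweight d2) B \is a fin_num.
  apply: fin; first exact/mu_ext_ge0/hweight_ge0.
  apply: (@le_trans _ _ (hausdorff2 B)); last exact: le_hausdorff2.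
  by apply: ereal_sup_ubound; exists d2.
rewrite leeBrDr// addeC -leeBrDr//; apply: ge_ereal_sup => _ [d1 /= d10 <-].
by rewrite leeBrDr//; exact: main.
Qed.

(** The part of X at positive distance from C is exhausted by shells. Every
    other shell is separated from the next, so that the measures of the shells
    have a finite sum and the tail of the exhaustion is negligible. *)
Lemma closed_caratheodory C : closed C ->
  (@hausdorff2_outer R).-caratheodory C.
Proof.
move=> cC; apply: le_caratheodory_measurable => X.
have [->|/set0P C0] := eqVneq C set0.
  rewrite setI0 setC0 setIT outer_measure0 add0e; exact: lexx.
change (hausdorff2 (X `&` C) + hausdorff2 (X `&` ~` C) <= hausdorff2 X).
have [->|Xfin] := eqVneq (hausdorff2 X) +oo; first exact: leey.
pose a k : R := (k.+1%:R^-1)%R.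
have a0 k : (0 < a k)%R by rewrite invr_gt0.
have adec k m : (k < m)%N -> (a m < a k)%R.
  by move=> km; rewrite ltf_pV2 ?posrE// ltr_nat ltnS.
have ale k m : (k <= m)%N -> (a m <= a k)%R.
  by move=> km; rewrite lef_pV2 ?posrE// ler_nat ltnS.
have usep (c1 c2 : R) A B : (forall x, A x -> (udist C x <= c1)%R) ->
    (forall x, B x -> (c2 <= udist C x)%R) -> separated_by (c2 - c1) A B.
  move=> Ac Bc x y /Ac Ax /Bc By.
  have := udist_lip_le C0 y x; rewrite enormB; lra.
pose out n : set 'cV[R]_3 := X `&` [set x | (a n < udist C x)%R].
pose shell k : set 'cV[R]_3 :=
  X `&` [set x | (a k.+1 < udist C x)%R && (udist C x <= a k)%R].
have CE x : C x <-> udist C x = 0%R.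
  split; first exact: udist_in.
  move=> d0; apply: contrapT => nCx.
  have /nbhs_enormP[e e0 eC] : nbhs x (~` C).
    by apply: open_nbhs_nbhs; split=> //; exact: closed_openC.
  have : (e <= udist C x)%R.
    apply: le_udist => // y Cy; rewrite leNgt enormB; apply/negP => /eC.
    by apply.
  by rewrite d0 leNgt e0.
have XC n : X `&` ~` C `<=` out n `|` \bigcup_(k in ~` `I_n) shell k.
  move=> x [Xx nCx].
  have dx : (0 < udist C x)%R.
    by rewrite lt0r udist_ge0// andbT; apply/eqP => /CE.
  have [an|an] := ltP (a n) (udist C x); first by left.
  right.
  have : exists k, (a k < udist C x)%R.
    have [k _ kk] := near_infty_natSinv_lt (PosNum dx).
    by exists k; exact: (kk k (leqnn k)).
  case/ex_minnP => k ak kmin.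
  have nk : (n < k)%N by rewrite ltnNge; apply/negP => /ale; rewrite leNgt (lt_le_trans ak an).
  exists k.-1.
    move=> /=; rewrite -ltnS prednK ?(leq_ltn_trans _ nk)//.
    by apply/negP; rewrite -leqNgt.
  split=> //=; rewrite prednK ?(leq_ltn_trans _ nk)// ak/= leNgt.
  apply/negP => /kmin; rewrite leqNgt prednK ?leqnn//.
  exact: leq_ltn_trans nk.
have shells (p n : nat) : \sum_(k < n) hausdorff2 (shell (k.*2 + p)%N) <= hausdorff2 X.
  pose U n : set 'cV[R]_3 := \big[setU/set0]_(k < n) shell (k.*2 + p)%N.
  have UX m : U m `<=` X.
    by rewrite /U -(bigcup_mkord m (fun k => shell (k.*2 + p)%N)) => x [k _ []].
  apply: (@le_trans _ _ (hausdorff2 (U n))); last exact/le_hausdorff2/UX.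
  elim: n => [|n IH]; first by rewrite big_ord0 hausdorff2_ge0.
  rewrite big_ord_recr/= /U big_ord_recr/= -/(U n).
  apply: (le_trans (leeD IH (lexx _))).
  have [->|n0] := posnP n.
    by rewrite /U big_ord0 hausdorff2_0 add0e set0U.
  rewrite addeC setUC.
  (* the omitted shell of index 2 n + p - 1 separates the new one from the others *)
  apply: (@hausdorff2_separated (a (n.*2 + p).-1%N - a (n.*2 + p)%N)%R).
    by rewrite subr_gt0; apply: adec; lia.
  apply: usep => x; first by move=> [_ /andP[]].
  rewrite /U -(bigcup_mkord n (fun k => shell (k.*2 + p)%N)) => -[k /= kn [_ /andP[h _]]].
  by apply: ltW; apply: le_lt_trans h; apply: ale; lia.
have sumfin : \sum_(0 <= k <oo) hausdorff2 (shell k) < +oo.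
  apply: (@le_lt_trans _ _ (hausdorff2 X + hausdorff2 X)); last first.
    by rewrite lte_add_pinfty// ltey.
  apply: lime_le.
    by apply: is_cvg_nneseries => k _ _; exact: hausdorff2_ge0.
  apply: nearW => n; apply: (@le_trans _ _ (\sum_(0 <= k < n.*2) hausdorff2 (shell k))).
    apply: lee_sum_nneg_natr => //; [by move=> k _ _; exact: hausdorff2_ge0|].
    by rewrite -addnn leq_addr.
  have := leeD (shells 0%N n) (shells 1%N n); apply: le_trans.
  rewrite big_mkord; elim: n => [|n IH]; first by rewrite !big_ord0 adde0.
  rewrite doubleS !big_ord_recr/= addn0 addn1.
  by rewrite addeACA -[leLHS]addeA; apply: leeD; rewrite ?lexx//; exact: IH.
have tail := nneseries_tail_cvg sumfin (fun k _ => hausdorff2_ge0 _).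
apply/lee_addgt0Pr => e e0.
have e0' : 0 < e%:E by rewrite lte_fin.
have [n _ /(_ n (leqnn n))/= tn] := tail _ (open_ereal_lt' e0').
apply: (le_trans (leeD (lexx _) (le_hausdorff2 (XC n)))).
have h1 := @outer_measureU2 _ _ (@hausdorff2_outer R) (out n) (\bigcup_(k in ~` `I_n) shell k).
have h2 := @outer_measure_sigma_subadditive_tail _ _ (@hausdorff2_outer R) n shell.
apply: (le_trans (leeD (lexx _) (le_trans h1 (leeD (lexx _) h2)))).
rewrite addeA leeD//; last exact: ltW.
apply: (@le_trans _ _ (hausdorff2 ((X `&` C) `|` out n))); last first.
  by apply: le_hausdorff2 => x [[]|[]].
apply: (@hausdorff2_separated (a n - 0)%R); first by rewrite subr0.
apply: usep => x; first by move=> [_ /CE ->].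
by move=> [_ /ltW].
Qed.

End MetricOuterMeasure.

(** * Surface measure of pieces of a regular surface *)

Section SurfacePatches.
Variable R : realType.
Implicit Types (x y z : 'cV[R]_3) (A : set 'cV[R]_3) (j : 'I_3).

Lemma hausdorff2_isometry (f : 'cV[R]_3 -> 'cV[R]_3) A :
  (forall x y, enorm (f x - f y) = enorm (x - y)) ->
  (hausdorff2 (f @` A) <= hausdorff2 A)%E.
Proof.
move=> fi; apply: ge_ereal_sup => _ [d d0 <-].
apply: (@le_trans _ _ (mu_ext (hweight d) A)); last by apply: ereal_sup_ubound; exists d.
apply: le_ereal_inf_tmp => _ [F [_ FA] <-].
apply: (@le_trans _ _ (\sum_(k <oo) hweight d (f @` F k))%E).
  apply: ereal_inf_lbound; exists (fun k => f @` F k) => //; split.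
    by move=> k; exact: sub_sigma_algebra.
  by move=> _ [x /FA[k _ Fx] <-]; exists k => //; exists x.
apply: lee_nneseries => [k _ _|k _]; first exact: hweight_ge0.
apply: le_ereal_inf_tmp => _ [r [r0 rF] <-]; apply: ereal_inf_lbound.
by exists r => //; split=> // _ _ [x Fx <-] [y Fy <-]; rewrite fi; exact: rF.
Qed.

Lemma neq0_coord (v : 'cV[R]_3) : v != 0 -> exists j, v j 0 != 0.
Proof.
move=> v0; apply: contrapT => h; move/eqP: v0; apply; apply/colP => j.
by rewrite mxE; apply: contrapT => /eqP vj; apply: h; exists j.
Qed.

Definition other_coords j y z : R := \sum_(k < 2) `|y (lift j k) 0 - z (lift j k) 0|.

(** Where the j-th partial derivative of the defining function stays away from
    zero, the mean value theorem bounds the j-th coordinate of a chord of its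
    zero set by the other two. *)
Lemma zero_set_graph (f : 'cV[R]_3 -> R) x (W : set 'cV[R]_3) j :
  open W -> W x -> Ck 2 W f -> grad f x j 0 != 0 ->
  exists2 L, 0 <= L & exists2 r, 0 < r & forall y z,
    enorm (y - x) < r -> enorm (z - x) < r -> f y = 0 -> f z = 0 ->
    `|y j 0 - z j 0| <= L * other_coords j y z.
Proof.
move=> oW Wx /= [df H] gj.
have gc i : {for x, continuous (fun y => grad f y i 0)}.
  have -> : (fun y => grad f y i 0) = 'D_(delta_mx i 0) f.
    by apply/funext => y; rewrite mxE.
  exact/differentiable_continuous/(H i).1.
set d := `|grad f x j 0|.
have d0 : 0 < d by rewrite normr_gt0.
pose M := \sum_i `|grad f x i 0| + 1.
have M0 : 0 < M by rewrite ltr_wpDl// sumr_ge0.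
have d20 : 0 < d / 2 by rewrite divr_gt0.
have : nbhs x (W `&` ([set y | `|grad f x j 0 - grad f y j 0| < d / 2] `&`
    [set y | forall i, `|grad f x i 0 - grad f y i 0| < 1])).
  apply: filterI; first exact: open_nbhs_nbhs.
  apply: filterI; first exact: near_dist (gc j) d20.
  apply: (@filter_forall _ _ (fun i =>
    [set y | `|grad f x i 0 - grad f y i 0| < 1]) (nbhs x)) => i.
  exact: near_dist (gc i) ltr01.
move=> /nbhs_enormP[r r0 rH].
exists (M / (d / 2)); first by rewrite divr_ge0// ltW.
exists r => // y z yr zr fy fz.
have seg t : 0 <= t <= 1 -> enorm (y + t *: (z - y) - x) < r.
  move=> /andP[t0 t1].
  have -> : y + t *: (z - y) - x = (1 - t) *: (y - x) + t *: (z - x).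
    by apply/colP => i; rewrite !mxE; ring.
  apply: (le_lt_trans (enormD _ _)); rewrite !enormZ !ger0_norm ?subr_ge0//.
  have [->|tN0] := eqVneq t 0; first by rewrite subr0 mul1r mul0r addr0.
  have tp : 0 < t by rewrite lt0r tN0.
  have h1 : t * enorm (z - x) < t * r by rewrite ltr_pM2l.
  have h2 : (1 - t) * enorm (y - x) <= (1 - t) * r.
    by rewrite ler_wpM2l ?subr_ge0// ltW.
  lra.
have [t t01] := @line_mvt R f y (z - y) (fun t t01 =>
  @diff_derivable _ _ _ _ _ (z - y) (df _ (rH _ (seg t t01)).1)).
rewrite [y + _]addrC subrK fy fz subrr.
have /rH[/df dxi [/= xi1 xi2]] := seg t t01.
set xi := y + _ in dxi xi1 xi2 *.
rewrite derive_grad// /dot (bigD1_ord j)//= => /esym/eqP.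
rewrite addr_eq0 => /eqP E.
have gxi : d / 2 <= `|grad f xi j 0|.
  have := ler_normD (grad f xi j 0) (grad f x j 0 - grad f xi j 0).
  by rewrite addrCA subrr addr0 -/d; lra.
have key : `|grad f xi j 0| * `|y j 0 - z j 0| <= M * other_coords j y z.
  rewrite -normrM (_ : _ * _ = - (grad f xi j 0 * (z - y) j 0)); last first.
    by rewrite !mxE; ring.
  rewrite normrN E normrN; apply: (le_trans (ler_norm_sum _ _ _)).
  rewrite /other_coords mulr_sumr; apply: ler_sum => k _.
  rewrite normrM; apply: ler_pM => //; last by rewrite !mxE distrC.
  have := ler_normB (grad f x (lift j k) 0) (grad f x (lift j k) 0 - grad f xi (lift j k) 0).
  rewrite opprB addrCA subrr addr0 => /le_trans; apply.
  apply: lerD; last exact/ltW/xi2.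
  by rewrite (bigD1 (lift j k))//= lerDl sumr_ge0.
rewrite mulrAC ler_pdivlMr// mulrC; apply: le_trans key.
by rewrite ler_wpM2r.
Qed.

(** The graph over a square of side 2 r is cut into the parts over N^2 small
    squares; as their number grows the diameters shrink like 1 / N, so that the
    weighted sum does not depend on N. *)
Lemma graph_finite A x j L r : 0 <= L -> 0 < r ->
  (forall y, A y -> enorm (y - x) < r) ->
  (forall y z, A y -> A z -> `|y j 0 - z j 0| <= L * other_coords j y z) ->
  (hausdorff2 A < +oo)%E.
Proof.
move=> L0 r0 Ar AL.
pose D : R := 2 * (1 + L) * (4 * r).
have D0 : 0 < D by rewrite !mulr_gt0// ltr_pwDl.
apply: (@le_lt_trans _ _ (pi / 4 * D ^+ 2)%:E); last exact: ltey.
apply: ge_ereal_sup => _ [d /= d0 <-].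
have [N N0 DN] : exists2 N : nat, (0 < N)%N & D / N%:R <= d.
  exists (Num.truncn (D / d)).+1 => //.
  rewrite ler_pdivrMr// mulrC -ler_pdivrMr//.
  exact/ltW/truncnS_gt.
have NR0 : 0 < N%:R :> R by rewrite ltr0n.
pose s := 2 * r / N%:R.
have s0 : 0 < s by rewrite divr_gt0// mulr_gt0.
pose cell i (a : nat) : set 'cV[R]_3 :=
  [set y | a%:R * s <= y i 0 - x i 0 + r <= a.+1%:R * s].
pose F n : set 'cV[R]_3 := if (n < N * N)%N
  then A `&` (cell (lift j ord0) (n %/ N)%N `&` cell (lift j ord_max) (n %% N)%N) else set0.
have wF n : (hweight d (F n) <= (pi / 4 * (D / N%:R) ^+ 2)%:E)%E.
  apply: ereal_inf_lbound; exists (D / N%:R) => //; split.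
    by rewrite DN andbT divr_ge0// ltW.
  rewrite /F => y z; case: ifP => // _ [Ay [y0 y1]] [Az [z0 z1]].
  have near2 i a : cell i a y -> cell i a z -> `|y i 0 - z i 0| <= s.
    rewrite /cell/= -(addn1 a) natrD mulrDl mul1r => /andP[h1 h2] /andP[h3 h4].
    rewrite ler_norml; lra.
  have oc : other_coords j y z <= 2 * s.
    rewrite /other_coords !big_ord_recl big_ord0 addr0.
    have := near2 _ _ y0 z0; have := near2 _ _ y1 z1.
    have -> : lift ord0 ord0 = ord_max :> 'I_2 by apply/val_inj.
    by lra.
  have ocs : (1 + L) * (2 * s) = D / N%:R / 2.
    by rewrite /D /s; field; rewrite gt_eqF.
  have -> : D / N%:R = 2 * ((1 + L) * (2 * s)) by rewrite ocs [RHS]mulrC divfK.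
  apply: enorm_le_coord => i; rewrite !mxE.
  have Ls : 0 <= L * (2 * s) by rewrite !mulr_ge0// ltW.
  case: (unliftP j i) => [k ->|->]; last first.
    apply: (le_trans (AL y z Ay Az)).
    have : L * other_coords j y z <= L * (2 * s) by rewrite ler_wpM2l.
    by rewrite mulrDl mul1r; lra.
  have : `|y (lift j k) 0 - z (lift j k) 0| <= s.
    case: (unliftP ord0 k) => [k' ->|->]; last exact: near2 y0 z0.
    rewrite (_ : lift ord0 k' = ord_max); first exact: near2 y1 z1.
    by apply/val_inj; rewrite (ord1 k').
  by rewrite mulrDl mul1r; lra.
apply: (@le_trans _ _ (\sum_(n <oo) hweight d (F n))%E).
  apply: ereal_inf_lbound; exists F => //; split.
    by move=> n; exact: sub_sigma_algebra.
  move=> y Ay.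
  have idx i : exists2 a, (a < N)%N & cell i a y.
    have := le_lt_trans (coord_le_enorm (y - x) i) (Ar y Ay).
    rewrite !mxE ltr_norml => /andP[h1 h2].
    have t0 : 0 <= (y i 0 - x i 0 + r) / s by rewrite divr_ge0 ?(ltW s0)//; lra.
    have /andP[ta tb] := truncn_itv t0.
    exists (Num.truncn ((y i 0 - x i 0 + r) / s)); last first.
      by rewrite /cell/= -ler_pdivlMr// ta/= -ler_pdivrMr// ltW.
    rewrite -(ltr_nat R); apply: (le_lt_trans ta).
    rewrite ltr_pdivrMr// /s mulrCA divff ?gt_eqF// mulr1; lra.
  have [a aN ca] := idx (lift j ord0); have [b bN cb] := idx (lift j ord_max).
  exists (a * N + b)%N => //; rewrite /F ifT; last by nia.
  by rewrite divnMDl// divn_small// addn0 modnMDl modn_small.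
rewrite (@nneseries_split _ _ 0%N (N * N)%N); last by move=> n _; exact: hweight_ge0.
rewrite [X in (_ + X)%E]eseries0 ?adde0; last first.
  by move=> n nN _; rewrite /F ltnNge nN/= hweight0.
rewrite add0n big_mkord.
apply: (@le_trans _ _ (\sum_(n < N * N) (pi / 4 * (D / N%:R) ^+ 2)%:E)%E).
  by apply: lee_sum => n _; exact: wF.
rewrite sumEFin lee_fin sumr_const card_ord -(mulr_natr _ (N * N)) natrM.
rewrite (_ : _ * (N%:R * N%:R) = pi / 4 * D ^+ 2)//.
by field; rewrite gt_eqF.
Qed.

(** By compactness finitely many graphs cover the surface. *)
Lemma surface_finite (S : set 'cV[R]_3) : closed_surface S -> (hausdorff2 S < +oo)%E.
Proof.
move=> [Sc _ chart].
have loc x : exists V : set 'cV[R]_3, [/\ open V, S x -> V x &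
    (hausdorff2 (S `&` V) < +oo)%E].
  have [Sx|nSx] := pselect (S x); last first.
    by exists set0; split=> //; rewrite setI0 hausdorff2_0 ltry.
  have [W [f [oW Wx Cf gf WS]]] := chart x Sx.
  have [j gj] := neq0_coord (gf x Wx).
  have [L L0 [r r0 H]] := zero_set_graph oW Wx Cf gj.
  have fz y : W y -> S y -> f y = 0.
    by move=> Wy Sy; have [_ //] : (W `&` [set y | f y = 0]) y by rewrite -WS.
  exists (W `&` [set y | enorm (y - x) < r]); split.
  - apply: openI => //; apply: (@open_comp _ _ (fun y => enorm (y - x)) [set t | t < r]).
      by move=> y _; exact: enorm_dist_continuous.
    exact: open_lt.
  - by move=> _; split=> //=; rewrite subrr enorm0.
  - apply: (@graph_finite _ x j L r) => //; first by move=> y [_ []].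
    move=> y z [Sy [Wy yr]] [Sz [Wz zr]]; apply: H => //; exact: fz.
have [V HV] := choice loc.
move: Sc; rewrite compact_cover => /(_ _ setT V).
case=> [x _|x Sx|D' _ SD']; first by have [] := HV x.
  by exists x => //; have [_ h _] := HV x; exact: h.
have main (s : seq 'cV[R]_3) :
    (hausdorff2 (S `&` \bigcup_(x in [set` s]) V x) < +oo)%E.
  elim: s => [|x s IH]; first by rewrite set_nil bigcup_set0 setI0 hausdorff2_0 ltry.
  apply: (@le_lt_trans _ _ (hausdorff2 (S `&` V x) +
    hausdorff2 (S `&` \bigcup_(x in [set` s]) V x))%E).
    apply: le_trans (outer_measureU2 (@hausdorff2_outer R) _ _).
    apply: le_hausdorff2 => y [Sy [z /= + Vy]]; rewrite inE => /orP[/eqP zx|zs].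
      by left; split=> //; rewrite -zx.
    by right; split=> //; exists z.
  by rewrite lte_add_pinfty//; have [] := HV x.
apply: le_lt_trans (main (finmap.enum_fset D')).
by apply: le_hausdorff2 => y Sy; split=> //; exact: SD'.
Qed.

Definition shadow j y : measurableTypeR R * measurableTypeR R :=
  (y (lift j ord0) 0, y (lift j ord_max) 0).

Let area : {measure set (measurableTypeR R * measurableTypeR R) -> \bar R} :=
  (@lebesgue_measure R \x @lebesgue_measure R)%E.

Lemma area_rectangle (a b c d : R) : a <= b -> c <= d ->
  area (`[a, b] `*` `[c, d]) = ((b - a) * (d - c))%:E.
Proof.
have len (u v : R) : u <= v -> lebesgue_measure (`[u, v]%classic : set R) = (v - u)%:E.
  move=> uv; rewrite lebesgue_measure_itv/= lte_fin; case: ltP => [_|vu].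
    by rewrite -EFinB.
  by have -> : u = v by [apply/le_anti/andP]; rewrite subrr.
move=> ab cd; rewrite EFinM -(len a b)// -(len c d)//.
exact: product_measure1E.
Qed.

(** A cover of A projects to a cover of the shadow of A by sets that lie in squares
    whose side is twice the diameter r: their area is 4 r^2, against the weight
    pi / 4 r^2 in the Hausdorff measure. *)
Lemma shadow_le_hausdorff2 j A :
  ((pi / 16)%:E * mu_ext area (shadow j @` A) <= hausdorff2 A)%E.
Proof.
have p0 : 0 <= (pi / 16 : R) by rewrite divr_ge0// pi_ge0.
apply: (@le_trans _ _ (mu_ext (hweight 1) A)); last first.
  by apply: ereal_sup_ubound; exists 1 => //=.
apply: le_ereal_inf_tmp => _ [F [_ FA] <-].
apply: (@le_trans _ _ (\sum_(k <oo) (pi / 16)%:E * mu_ext area (shadow j @` F k))%E).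
  rewrite nneseriesZl//; last by move=> k _; exact/mu_ext_ge0/measure_ge0.
  apply: lee_wpmul2l; first by rewrite lee_fin.
  apply: le_trans (mu_ext_sigma_subadditive (measure_ge0 area) _).
  apply: le_mu_ext => p [y Ay yp]; have [k _ Fy] := FA y Ay.
  by exists k => //; exists y.
apply: lee_nneseries => [k _ _|k _].
  by rewrite mule_ge0 ?lee_fin//; exact/mu_ext_ge0/measure_ge0.
apply: le_ereal_inf_tmp => _ [r [/andP[r0 _] rF] <-].
have [[y Fy]|F0] := pselect (F k !=set0); last first.
  rewrite (_ : shadow j @` F k = set0); last first.
    by apply/seteqP; split=> // p [y Fy _]; apply: F0; exists y.
  rewrite (mu_ext0 (measure0 area) (measure_ge0 area)) mule0 lee_fin.
  by rewrite mulr_ge0 ?sqr_ge0// divr_ge0// pi_ge0.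
pose Q : set (measurableTypeR R * measurableTypeR R) :=
  `[y (lift j ord0) 0 - r, y (lift j ord0) 0 + r] `*`
  `[y (lift j ord_max) 0 - r, y (lift j ord_max) 0 + r].
have mQ : measurable Q by apply: measurableX; exact: measurable_itv.
have -> : pi / 4 * r ^+ 2 = pi / 16 * ((y (lift j ord0) 0 + r - (y (lift j ord0) 0 - r)) *
    (y (lift j ord_max) 0 + r - (y (lift j ord_max) 0 - r))) by field.
rewrite [leRHS]EFinM -area_rectangle; [|lra|lra].
rewrite lee_wpmul2l ?lee_fin// -(measurable_mu_extE area mQ).
apply: le_mu_ext => _ [z Fz <-]; rewrite /Q/= !in_itv/=.
have yz i : y i 0 - r <= z i 0 <= y i 0 + r.
  have := le_trans (coord_le_enorm (z - y) i) (rF z y Fz Fy).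
  by rewrite !mxE ler_norml; lra.
by split; exact: yz.
Qed.

(** A nonzero partial derivative changes the sign of the defining function
    across the surface; by the intermediate value theorem every point of a small
    square is then the shadow of a point of the surface. *)
Lemma surface_positive (S : set 'cV[R]_3) x (rho : R) : closed_surface S -> S x ->
  0 < rho -> (0 < hausdorff2 (S `&` [set y | (enorm (y - x) < rho)%R]))%E.
Proof.
move=> [_ _ chart] Sx rho0.
have [W [f [oW Wx [df H] gf WS]]] := chart x Sx.
have [j gj] := neq0_coord (gf x Wx).
have fz y : W y -> S y <-> f y = 0.
  move=> Wy; have := congr1 (fun A : set _ => A y) WS; rewrite /setI/= => E.
  split=> h; first by have : (W y /\ S y) by []; rewrite E => -[].
  by have : (W y /\ f y = 0) by []; rewrite -E => -[].
set e : 'cV[R]_3 := delta_mx j 0; set c := grad f x j 0 in gj.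
have gE : 'D_e f x = c by rewrite /c mxE.
have c20 : 0 < c * c by rewrite -expr2 exprn_even_gt0.
(* the factor c makes the j-th derivative of c f positive for either sign *)
have cD : nbhs x [set y | 0 < c * 'D_e f y].
  have gc : {for x, continuous ('D_e f)}.
    exact: differentiable_continuous ((H j).1 x Wx).
  have e0 : 0 < `|c| by rewrite normr_gt0.
  apply: filterS (near_dist gc e0) => y /=; rewrite gE ltr_norml.
  move: gj; rewrite neq_lt => /orP[cn|cp].
    by rewrite ltr0_norm// => /andP[h1 h2]; rewrite nmulr_rgt0//; lra.
  by rewrite gtr0_norm// => /andP[h1 h2]; rewrite pmulr_rgt0//; lra.
have [r r0 rH] : exists2 r, 0 < r & forall y, enorm (y - x) < r ->
    [/\ W y, 0 < c * 'D_e f y & enorm (y - x) < rho].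
  have /nbhs_enormP[r r0 rH] : nbhs x (W `&` [set y | 0 < c * 'D_e f y]).
    by apply: filterI cD; exact: open_nbhs_nbhs.
  exists (Num.min r rho); first by rewrite lt_min r0.
  by move=> y; rewrite lt_min => /andP[/rH[]].
have en : enorm e = 1.
  rewrite /enorm /dot (bigD1 j)//= big1 => [|i ij]; last first.
    by rewrite !mxE (negbTE ij) mul0r.
  by rewrite mxE !eqxx mulr1 addr0 sqrtr1.
pose t := r / 2.
have t0 : 0 < t by rewrite divr_gt0.
have tr : t < r by rewrite /t; lra.
have step (u : R) : `|u| <= t -> exists2 d, 0 < c * d & f (x + u *: e) = u * d.
  move=> ut.
  have seg a : 0 <= a <= 1 -> enorm (x + a *: (u *: e) - x) < r.
    move=> /andP[a0 a1]; rewrite addrAC subrr add0r !enormZ en mulr1.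
    apply: le_lt_trans tr; apply: le_trans ut.
    by rewrite ger0_norm// ler_piMl.
  have [a a01] := @line_mvt R f x (u *: e) (fun a a01 =>
    @diff_derivable _ _ _ _ _ (u *: e) (df _ (let: And3 w _ _ := rH _ (seg a a01) in w))).
  have [Wy cy _] := rH _ (seg a a01).
  rewrite derive_grad ?dotZr -?derive_grad; [|exact: df..].
  by rewrite (fz x Wx).1// subr0 => ->; exists ('D_e f (x + a *: (u *: e))).
have cont y (P : set R) : W y -> open P -> P (c * f y) -> nbhs y [set z | P (c * f z)].
  move=> Wy oP Py.
  have cc : {for y, continuous (fun z => c * f z)}.
    by apply: continuousM; [exact: cst_continuous|exact/differentiable_continuous/df].
  by apply: cc; apply: open_nbhs_nbhs.
have inW (u : R) : `|u| <= t -> W (x + u *: e).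
  move=> ut; have [|//] := rH (x + u *: e).
  by rewrite addrAC subrr add0r enormZ en mulr1; exact: le_lt_trans tr.
have nt : `|t| <= t by rewrite gtr0_norm.
have nNt : `|- t| <= t by rewrite normrN.
have [ep ep0 epH] : exists2 ep, 0 < ep & forall z,
    enorm (z - (x + t *: e)) < ep -> 0 < c * f z.
  apply/nbhs_enormP/(cont _ [set v | 0 < v]); [exact: inW|exact: open_gt|].
  by have [d cd ->] := step t nt; rewrite /= mulrCA mulr_gt0.
have [em em0 emH] : exists2 em, 0 < em & forall z,
    enorm (z - (x + (- t) *: e)) < em -> c * f z < 0.
  apply/nbhs_enormP/(cont _ [set v | v < 0]); [exact: inW|exact: open_lt|].
  by have [d cd ->] := step (- t) nNt; rewrite /= mulrCA nmulr_rlt0// oppr_lt0.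
pose eta := Num.min t (Num.min ep em) / 4.
have eta0 : 0 < eta by rewrite divr_gt0// !lt_min t0 ep0 em0.
have [et eep eem] : [/\ 2 * eta < t, 2 * eta < ep & 2 * eta < em].
  have m0 : 0 < Num.min t (Num.min ep em) by rewrite !lt_min t0 ep0 em0.
  have h1 : Num.min t (Num.min ep em) <= t by rewrite ge_min lexx.
  have h2 : Num.min t (Num.min ep em) <= ep by rewrite !ge_min lexx orbT.
  have h3 : Num.min t (Num.min ep em) <= em by rewrite !ge_min lexx !orbT.
  by rewrite /eta; split; lra.
set k0 := lift j ord0; set k1 := lift j ord_max.
pose Q : set (measurableTypeR R * measurableTypeR R) :=
  `[x k0 0 - eta, x k0 0 + eta] `*` `[x k1 0 - eta, x k1 0 + eta].
have mQ : measurable Q by apply: measurableX; exact: measurable_itv.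
have QS : Q `<=` shadow j @` (S `&` [set y | enorm (y - x) < rho]).
  move=> [p q]; rewrite /Q/= !in_itv/= => -[/andP[p1 p2] /andP[q1 q2]].
  pose w : 'cV[R]_3 := \col_i (if i == k0 then p - x k0 0
    else if i == k1 then q - x k1 0 else 0).
  have wn : enorm w <= 2 * eta.
    apply: enorm_le_coord => i; rewrite mxE.
    case: ifP => _; first by rewrite ler_norml; lra.
    case: ifP => _; first by rewrite ler_norml; lra.
    by rewrite normr0 ltW.
  have cancel a : x + w + a - (x + a) = w by rewrite (addrAC x w) [LHS]addrAC subrr add0r.
  have wr (u : R) : `|u| <= t -> enorm (x + w + u *: e - x) < r.
    move=> ut; rewrite -[x + w + _]addrA addrAC subrr add0r.
    apply: (le_lt_trans (enormD _ _)); rewrite enormZ en mulr1.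
    by rewrite /t in et ut *; lra.
  have dl (u : R) : `|u| <= t -> derivable f (x + w + u *: e) e.
    by move=> /wr /rH[/df d _ _]; exact: diff_derivable.
  have [|||u] := @IVT R (fun u => c * f (x + w + u *: e)) (- t) t 0.
  - lra.
  - apply: derivable_within_continuous => u; rewrite in_itv/= -ler_norml => ut.
    by apply: derivableM; [exact: derivable_cst|have [] := (derive_line f (x + w) e u).2 (dl u ut)].
  - rewrite ge_min le_max; apply/andP; split; apply/orP; [left|right].
    + apply/ltW/emH; rewrite cancel.
      exact: le_lt_trans eem.
    + apply/ltW/epH; rewrite cancel.
      exact: le_lt_trans eep.
  rewrite in_itv/= -ler_norml => ut /eqP; rewrite mulf_eq0 (negbTE gj)/= => /eqP fu.
  have [Wu _ ur] := rH _ (wr u ut).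
  exists (x + w + u *: e); first by split=> //; exact/(fz _ Wu).
  have wk0 : w k0 0 = p - x k0 0 by rewrite mxE eqxx.
  have wk1 : w k1 0 = q - x k1 0.
    by rewrite mxE eqxx ifF//; apply/negbTE; rewrite (inj_eq lift_inj).
  have ek k : e (lift j k) 0 = 0 by rewrite mxE eq_sym (negbTE (neq_lift _ _)).
  rewrite /shadow -/k0 -/k1 ![(x + w + u *: e) _ _]mxE ![(x + w) _ _]mxE ![(u *: e) _ _]mxE.
  by rewrite wk0 wk1 !ek mulr0 !addr0 !(addrC (x _ _)) !subrK.
apply: lt_le_trans (shadow_le_hausdorff2 j _).
apply: (@lt_le_trans _ _ ((pi / 16)%:E * area Q)%E); last first.
  rewrite lee_wpmul2l ?lee_fin ?divr_ge0 ?pi_ge0// -(measurable_mu_extE area mQ).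
  exact: le_mu_ext.
rewrite area_rectangle; [|lra|lra].
rewrite -EFinM lte_fin mulr_gt0 ?divr_gt0 ?pi_gt0// mulr_gt0//; lra.
Qed.

End SurfacePatches.

(** * Surface integrals *)

Section LowerIntegral.
Context d (T : measurableType d) (R : realType).
Variable mu : {measure set T -> \bar R}.
Implicit Types (D : set T) (f g : T -> R).
Local Open Scope ereal_scope.

(** The integral of a nonnegative function is a supremum over simple functions
    below it, hence monotone without any measurability. *)
Lemma le_integral_lower D (f g : T -> \bar R) : (forall x, D x -> 0 <= f x) ->
  (forall x, D x -> f x <= g x) ->
  \int[mu]_(x in D) f x <= \int[mu]_(x in D) g x.
Proof.
move=> f0 fg.
rewrite !ge0_integralE//; last by move=> x Dx; apply: le_trans (fg x Dx); exact: f0.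
apply: ereal_sup_le => _ [h hf <-]; exists h => //= x; apply: (le_trans (hf x)).
by rewrite /patch; case: ifPn => // /set_mem; exact: fg.
Qed.

Lemma le_Rintegral_lower D f g (M : R) : measurable D -> mu D < +oo ->
  (forall x, D x -> (0 <= f x)%R) -> (forall x, D x -> (f x <= g x)%R) ->
  (forall x, D x -> (g x <= M)%R) ->
  (\int[mu]_(x in D) f x <= \int[mu]_(x in D) g x)%R.
Proof.
move=> mD Dfin f0 fg gM.
have g0 x : D x -> (0 <= g x)%R by move=> Dx; exact: le_trans (f0 x Dx) (fg x Dx).
have h1 : \int[mu]_(x in D) (f x)%:E <= \int[mu]_(x in D) (g x)%:E.
  by apply: le_integral_lower => x Dx; rewrite lee_fin; [exact: f0|exact: fg].
have h2 : \int[mu]_(x in D) (g x)%:E < +oo.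
  apply: (@le_lt_trans _ _ (\int[mu]_(x in D) (cst `|M|%:E x))).
    apply: le_integral_lower => x Dx; rewrite lee_fin; first exact: g0.
    exact: le_trans (gM x Dx) (ler_norm _).
  by rewrite integral_cst// lte_mul_pinfty.
have h0 : 0 <= \int[mu]_(x in D) (f x)%:E.
  by apply: integral_ge0 => x Dx; rewrite lee_fin; exact: f0.
rewrite /Rintegral fine_le//.
  by rewrite ge0_fin_numE// (le_lt_trans h1).
by rewrite ge0_fin_numE// (le_trans h0).
Qed.

Lemma bounded_integrable D f (M : R) : measurable D -> mu D < +oo ->
  measurable_fun D f -> (forall x, D x -> (`|f x| <= M)%R) ->
  mu.-integrable D (EFin \o f).
Proof.
move=> mD Dfin mf fM; apply: measurable_bounded_integrable => //.
exists M; split; first exact: num_real.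
by move=> N MN x Dx; exact: le_trans (fM x Dx) (ltW MN).
Qed.

Lemma Rintegral_young D f g : measurable D ->
  mu.-integrable D (EFin \o (fun x => f x * g x)%R) ->
  mu.-integrable D (EFin \o (fun x => f x * f x)%R) ->
  mu.-integrable D (EFin \o (fun x => g x * g x)%R) ->
  (2 * \int[mu]_(x in D) (f x * g x) <=
   \int[mu]_(x in D) (f x * f x) + \int[mu]_(x in D) (g x * g x))%R.
Proof.
move=> mD ifg iff igg.
rewrite -RintegralZl// -RintegralD//; apply: le_Rintegral => //.
- exact: (integrableZl mD 2%R ifg).
- exact: (integrableD mD iff igg).
- by move=> x _ /=; have := sqr_ge0 (f x - g x)%R; nra.
Qed.

End LowerIntegral.

Section SurfaceIntegral.
Variable R : realType.
Variable S : set 'cV[R]_3.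
Hypotheses (Sc : compact S) (Sfin : (hausdorff2 S < +oo)%E).
Implicit Types (f g : 'cV[R]_3 -> R).

Definition continuous_at_surface f : Prop := forall x, S x -> {for x, continuous f}.

Lemma S_closed : closed S.
Proof. by apply: compact_closed => //; exact: norm_hausdorff. Qed.

Notation T := (caratheodory_type (@hausdorff2_outer R)).

Lemma measurable_closed (C : set 'cV[R]_3) : closed C -> measurable (C : set T).
Proof. exact: closed_caratheodory. Qed.

Lemma measurable_surface : measurable (S : set T).
Proof. exact/measurable_closed/S_closed. Qed.

(** Superlevel sets on the surface are closed, and closed sets are measurable. *)
Lemma surface_measurable_fun f : continuous_at_surface f ->
  measurable_fun (S : set T) (f : T -> R).
Proof.
move=> cf; apply: (measurability (@measurable_realfun.RGenCInfty.G R)) => [|_ [_ [r ->] <-]].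
  exact: measurable_realfun.RGenCInfty.measurableE.
apply: measurable_closed => x xcl.
have Sx : S x by apply: S_closed => A /xcl[y [[Sy _] Ay]]; exists y.
split=> //=; rewrite in_itv/= andbT leNgt; apply/negP => fr.
have r0 : 0 < r - f x by rewrite subr_gt0.
have [y [[_ /=]]] := xcl _ (near_dist (cf x Sx) r0).
rewrite in_itv/= andbT => ry; rewrite /= ltr_norml => /andP[h _]; lra.
Qed.

Lemma surface_bounded f : continuous_at_surface f ->
  exists M, forall x, S x -> `|f x| <= M.
Proof.
move=> cf.
have : bounded_set (f @` S).
  apply/compact_bounded/continuous_compact => //.
  by apply: continuous_in_subspaceT => x /set_mem; exact: cf.
move=> [M [_ MS]]; exists (M + 1) => x Sx.
by apply: MS; [rewrite ltrDl|exists x].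
Qed.

Lemma surface_integrable f : continuous_at_surface f ->
  (@hausdorff2_measure R).-integrable (S : set T) (EFin \o f).
Proof.
move=> cf; have [M fM] := surface_bounded cf.
apply: (@bounded_integrable _ _ _ _ _ _ M) => //; first exact: measurable_surface.
exact: surface_measurable_fun.
Qed.

Lemma surf_int_young f g : continuous_at_surface f -> continuous_at_surface g ->
  2 * surf_int S (fun x => f x * g x) <=
  surf_int S (fun x => f x * f x) + surf_int S (fun x => g x * g x).
Proof.
move=> cf cg; apply: Rintegral_young; first exact: measurable_surface.
- by apply: surface_integrable => x Sx; apply: continuousM; [exact: cf|exact: cg].
- by apply: surface_integrable => x Sx; apply: continuousM; exact: cf.
- by apply: surface_integrable => x Sx; apply: continuousM; exact: cg.
Qed.

Lemma le_surf_int f g M : (forall x, S x -> 0 <= f x) ->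
  (forall x, S x -> f x <= g x) -> (forall x, S x -> g x <= M) ->
  surf_int S f <= surf_int S g.
Proof.
move=> f0 fg gM; apply: (@le_Rintegral_lower _ T R (@hausdorff2_measure R) S f g M) => //.
exact: measurable_surface.
Qed.

Hypothesis Spos : forall x (rho : R), S x -> 0 < rho ->
  (0 < hausdorff2 (S `&` [set y | (enorm (y - x) < rho)%R]))%E.

(** A nonzero value persists on a ball, which cuts a piece of positive measure out
    of the surface. *)
Lemma surf_int_eq0 f : continuous_at_surface f ->
  surf_int S (fun x => f x * f x) = 0 -> forall x, S x -> f x = 0.
Proof.
move=> cf I0 x Sx; apply/eqP/negPn/negP => fx0.
have fx : 0 < `|f x| / 2 by rewrite divr_gt0// normr_gt0.
have /nbhs_enormP[r r0 rH] := near_dist (cf x Sx) fx.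
set B := S `&` [set y | enorm (y - x) < r].
have cB : closed [set y : 'cV[R]_3 | r <= enorm (y - x)].
  have := @closed_comp _ _ (fun y : 'cV[R]_3 => enorm (y - x)) [set t : R | r <= t].
  apply; last exact: closed_ge.
  by move=> y _; exact: enorm_dist_continuous.
have mB : measurable (B : set T).
  rewrite /B (_ : _ `&` _ = S `\` [set y | r <= enorm (y - x)]); last first.
    apply/seteqP; split=> y /= [Sy h]; split=> //.
      by apply/negP; rewrite -ltNge.
    by rewrite ltNge; apply/negP.
  apply: measurableD; first exact: measurable_surface.
  exact: measurable_closed cB.
have c2 : 0 < (`|f x| / 2) ^+ 2 by rewrite exprn_gt0.
have fB y : B y -> (`|f x| / 2) ^+ 2 <= f y * f y.
  move=> [Sy /rH /= h]; rewrite -expr2 -[leRHS]real_normK ?num_real//.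
  rewrite ler_pXn2r ?nnegrE ?normr_ge0 ?(ltW fx)//.
  have := ler_normD (f y) (f x - f y); rewrite addrCA subrr addr0; lra.
have mff : measurable_fun (S : set T) (EFin \o (fun y : T => f y * f y)).
  apply/measurable_EFinP/surface_measurable_fun => y Sy.
  by apply: continuousM; exact: cf.
have : (0 < \int[@hausdorff2_measure R]_(y in S) (f y * f y)%:E)%E.
  apply: (@lt_le_trans _ _ (\int[@hausdorff2_measure R]_(y in B) (f y * f y)%:E)%E).
    apply: (@lt_le_trans _ _ (\int[@hausdorff2_measure R]_(y in B)
        cst ((`|f x| / 2) ^+ 2)%:E y)%E).
      rewrite integral_cst//; apply: mule_gt0; first by rewrite lte_fin.
      exact: Spos.
    apply: le_integral_lower => y By; rewrite lee_fin; first exact: ltW.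
    exact: fB.
  apply: ge0_subset_integral => //; [exact: measurable_surface| |].
    by move=> y Sy; rewrite lee_fin -expr2 sqr_ge0.
  by move=> y [].
have iff : (@hausdorff2_measure R).-integrable (S : set T) (EFin \o (fun y : T => f y * f y)).
  by apply: surface_integrable => y Sy; apply: continuousM; exact: cf.
have := integrable_fin_num measurable_surface iff.
move: I0; rewrite /surf_int /Rintegral /=.
by case: (integral _ _ _) => //= r' ->; rewrite ltxx.
Qed.

End SurfaceIntegral.

(** * Volume integrals *)

Section VolumeIntegral.
Variable R : realType.
Implicit Types (W : set 'cV[R]_3) (f g : 'cV[R]_3 -> R).

Notation R3 := (measurableTypeR R * measurableTypeR R * measurableTypeR R)%type.

Lemma ord3E (i : 'I_3) : [\/ i = 0, i = 1 | i = 2%:R].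
Proof.
by case: i => [[|[|[|//]]] i3]; [constructor 1|constructor 2|constructor 3];
  apply/val_inj.
Qed.

Definition pt_box (a b : 'I_3 -> R) : set R3 :=
  (`]a 0, b 0[ `*` `]a 1, b 1[) `*` `]a 2%:R, b 2%:R[.

Lemma pt_boxP a b (p : R3) : pt_box a b p <-> forall i, a i < pt3 p i 0 < b i.
Proof.
case: p => -[p q] s; rewrite /pt_box/= !in_itv/=; split=> [[[h0 h1] h2] i|h].
  by rewrite mxE; case: (ord3E i) => ->.
by have := h 0; have := h 1; have := h 2%:R; rewrite !mxE/=.
Qed.

Lemma measurable_pt_box a b : measurable (pt_box a b).
Proof. by apply: measurableX; [apply: measurableX|]; exact: measurable_itv. Qed.

(** Every point of an open set lies in a box with rational corners inside it. *)
Lemma measurable_open W : open W -> measurable (@pt3 R @^-1` W : set R3).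
Proof.
move=> oW.
pose box (q : rat ^ 3 * rat ^ 3) := pt_box (fun i => ratr (q.1 i)) (fun i => ratr (q.2 i)).
pose F k : set R3 := if unpickle k is Some q
  then [set p | box q p /\ box q `<=` @pt3 R @^-1` W] else set0.
have -> : @pt3 R @^-1` W = \bigcup_k F k.
  apply/seteqP; split=> [p Wp|p [k _]]; last first.
    by rewrite /F; case: unpickle => // q [bp]; exact.
  have /nbhs_enormP[e e0 eW] : nbhs (pt3 p) W by exact: open_nbhs_nbhs.
  have lo i : {q : rat | pt3 p i 0 - e / 2 < ratr q < pt3 p i 0}.
    apply: cid; have [|q] := @rat_in_itvoo R (pt3 p i 0 - e / 2) (pt3 p i 0); first lra.
    by rewrite in_itv/= => ?; exists q.
  have hi i : {q : rat | pt3 p i 0 < ratr q < pt3 p i 0 + e / 2}.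
    apply: cid; have [|q] := @rat_in_itvoo R (pt3 p i 0) (pt3 p i 0 + e / 2); first lra.
    by rewrite in_itv/= => ?; exists q.
  pose q : rat ^ 3 * rat ^ 3 := ([ffun i => sval (lo i)], [ffun i => sval (hi i)]).
  exists (pickle q) => //; rewrite /F pickleK; split.
    apply/pt_boxP => i /=; rewrite !ffunE.
    by case: (lo i) => a /= /andP[_ ->]; case: (hi i) => b /= /andP[->].
  move=> y /pt_boxP yq; apply: eW.
  apply: (@le_lt_trans _ _ (2 * (Num.max 0 (\big[Num.max/0]_(i < 3) `|(pt3 y - pt3 p) i 0|)))).
    apply: enorm_le_coord => i; rewrite le_max; apply/orP; right.
    exact: (le_bigmax _ (fun i => `|(pt3 y - pt3 p) i 0|)).
  rewrite mulrC -ltr_pdivlMr// gt_max divr_gt0//=.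
  apply/bigmax_ltP; split; first by rewrite divr_gt0.
  move=> i _; have := yq i; rewrite /= !ffunE.
  case: (lo i) => a /= /andP[a1 a2]; case: (hi i) => b /= /andP[b1 b2] /andP[h1 h2].
  by rewrite !mxE in a1 a2 b1 b2 h1 h2 *; rewrite ltr_norml; lra.
apply: bigcupT_measurable => k; rewrite /F; case: unpickle => [q|]; last exact: measurable0.
have [h|h] := pselect (box q `<=` @pt3 R @^-1` W).
  rewrite (_ : [set p | _] = box q); first exact: measurable_pt_box.
  by apply/seteqP; split=> p; [case|split].
rewrite (_ : [set p | _] = set0); first exact: measurable0.
by apply/seteqP; split=> p //; case.
Qed.

Lemma continuous_measurable W f : open W -> (forall x, W x -> {for x, continuous f}) ->
  measurable_fun (@pt3 R @^-1` W : set R3) (fun p : R3 => f (pt3 p)).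
Proof.
move=> oW cf; apply: (measurability (@measurable_realfun.RGenOInfty.G R)) => [|_ [_ [r ->] <-]].
  exact: measurable_realfun.RGenOInfty.measurableE.
have -> : @pt3 R @^-1` W `&` (fun p : R3 => f (pt3 p)) @^-1` `]r, +oo[%classic =
    @pt3 R @^-1` (W `&` [set x | r < f x]).
  by apply/seteqP; split=> p /=; rewrite in_itv/= andbT.
apply: measurable_open; rewrite openE => x [Wx rf].
apply: filterI; first exact: open_nbhs_nbhs.
have r0 : 0 < f x - r by rewrite subr_gt0.
apply: filterS (near_dist (cf x Wx) r0) => y /=.
by rewrite ltr_norml => /andP[_ h]; lra.
Qed.

Definition measurable_bounded W f : Prop :=
  measurable_fun (@pt3 R @^-1` W : set R3) (fun p : R3 => f (pt3 p)) /\
  exists M, forall x, W x -> `|f x| <= M.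

Lemma measurable_bounded_cst W a : measurable_bounded W (fun=> a).
Proof. by split; [exact: measurable_cst|exists `|a|]. Qed.

Lemma measurable_boundedD W f g : measurable_bounded W f -> measurable_bounded W g ->
  measurable_bounded W (fun x => f x + g x).
Proof.
move=> [mf [M fM]] [mg [N gN]]; split; first exact: measurable_funD.
exists (M + N) => x Wx; apply: (le_trans (ler_normD _ _)).
by apply: lerD; [exact: fM|exact: gN].
Qed.

Lemma measurable_boundedM W f g : measurable_bounded W f -> measurable_bounded W g ->
  measurable_bounded W (fun x => f x * g x).
Proof.
move=> [mf [M fM]] [mg [N gN]]; split; first exact: measurable_funM.
exists (M * N) => x Wx; rewrite normrM.
by apply: ler_pM => //; [exact: fM|exact: gN].
Qed.

Lemma measurable_bounded_sum W (I : Type) (r : seq I) (F : I -> 'cV[R]_3 -> R) :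
  (forall i, measurable_bounded W (F i)) ->
  measurable_bounded W (fun x => \sum_(i <- r) F i x).
Proof.
move=> h; elim: r => [|i r IH].
  by under eq_fun do rewrite big_nil; exact: measurable_bounded_cst.
by under eq_fun do rewrite big_cons; exact: measurable_boundedD.
Qed.

Lemma measurable_bounded_dot W (u v : 'cV[R]_3 -> 'cV[R]_3) :
  (forall i, measurable_bounded W (fun x => u x i 0)) ->
  (forall i, measurable_bounded W (fun x => v x i 0)) ->
  measurable_bounded W (fun x => dot (u x) (v x)).
Proof.
by move=> hu hv; apply: measurable_bounded_sum => i; exact: measurable_boundedM.
Qed.

Section Bounded.
Variables (W : set 'cV[R]_3) (r : R).
Hypotheses (oW : open W) (Wr : forall x i, W x -> `|x i 0| < r).

Let D : set R3 := @pt3 R @^-1` W.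

Lemma lebesgue3_finite : (lebesgue3 R D < +oo)%E.
Proof.
have mD := measurable_open oW.
apply: (@le_lt_trans _ _ (lebesgue3 R (pt_box (fun=> - r) (fun=> r)))).
  apply: le_measure; rewrite ?inE//; first exact: measurable_pt_box.
  by move=> p Wp; apply/pt_boxP => i; rewrite -ltr_norml; exact: Wr.
have lfin : (lebesgue_measure (`](- r)%R, r[%classic : set R) < +oo)%E.
  by rewrite lebesgue_measure_itv/=; case: ifP => // _; rewrite -EFinB ltry.
set I : set (measurableTypeR R) := `]- r, r[%classic.
have mI : measurable I by exact: measurable_itv.
have e2 : (@lebesgue_measure R \x @lebesgue_measure R)%E (I `*` I) =
    (lebesgue_measure I * lebesgue_measure I)%E by exact: product_measure1E.
have e3 : lebesgue3 R ((I `*` I) `*` I) =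
    ((@lebesgue_measure R \x @lebesgue_measure R)%E (I `*` I) * lebesgue_measure I)%E.
  by apply: product_measure1E => //; exact: measurableX.
rewrite /pt_box -/I e3 e2.
have fI : lebesgue_measure I \is a fin_num by rewrite ge0_fin_numE.
by rewrite ltey_eq !fin_numM.
Qed.

Lemma measurable_bounded_integrable3 f : measurable_bounded W f ->
  (lebesgue3 R).-integrable D (EFin \o (fun p : R3 => f (pt3 p))).
Proof.
move=> [mf [M fM]]; apply: (@bounded_integrable _ _ _ _ _ _ M) => //.
- exact: measurable_open.
- exact: lebesgue3_finite.
- by move=> p Wp; exact: fM.
Qed.

Lemma vol_int_young f g : measurable_bounded W f -> measurable_bounded W g ->
  2 * vol_int W (fun x => f x * g x) <=
  vol_int W (fun x => f x * f x) + vol_int W (fun x => g x * g x).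
Proof.
move=> bf bg; apply: Rintegral_young; first exact: measurable_open.
- exact: (measurable_bounded_integrable3 (measurable_boundedM bf bg)).
- exact: (measurable_bounded_integrable3 (measurable_boundedM bf bf)).
- exact: (measurable_bounded_integrable3 (measurable_boundedM bg bg)).
Qed.

Lemma le_vol_int f g : measurable_bounded W f -> measurable_bounded W g ->
  (forall x, W x -> f x <= g x) -> vol_int W f <= vol_int W g.
Proof.
move=> bf bg fg; apply: le_Rintegral; first exact: measurable_open.
- exact: measurable_bounded_integrable3.
- exact: measurable_bounded_integrable3.
- by move=> p Wp; exact: fg.
Qed.

(** Nothing is known about f outside W; cut off there, its translates are
    measurable everywhere. *)
Lemma shift_measurable f c : (forall x, W x -> {for x, continuous f}) ->
  measurable_fun D (fun p : R3 => (f \_ W) (pt3 p + c)).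
Proof.
move=> cf; pose Wc : set 'cV[R]_3 := [set x | W (x + c)].
have cc (x : 'cV[R]_3) : {for x, continuous (fun y : 'cV[R]_3 => y + c)}.
  by apply: continuousD; [exact: cvg_id|exact: cst_continuous].
have oWc : open Wc.
  rewrite openE => x Wx; apply: cc; exact: open_nbhs_nbhs.
have -> : (fun p : R3 => (f \_ W) (pt3 p + c)) =
    (fun p : R3 => f (pt3 p + c)) \_ (@pt3 R @^-1` Wc).
  apply/funext => p; rewrite /patch.
  have [h|h] := pselect (W (pt3 p + c)); first by rewrite !mem_set.
  by rewrite !memNset.
apply/measurable_restrict; [exact: measurable_open|exact: measurable_open|].
apply: (@measurable_funS _ _ _ _ (@pt3 R @^-1` Wc)); first exact: measurable_open.
  by move=> p [].
apply: (@continuous_measurable Wc (fun x => f (x + c))) => // x Wx.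
by apply: continuous_comp; [exact: cc|exact: cf].
Qed.

(** The one-sided derivatives along e and -e are limits of difference quotients,
    hence measurable, and they determine the derivative. *)
Lemma derive_measurable f e : (forall x, W x -> {for x, continuous f}) ->
  (forall x v, W x -> exists a, right_derivative f x v a) ->
  measurable_fun D (fun p : R3 => 'D_e f (pt3 p)).
Proof.
move=> cf rd; have mD := measurable_open oW.
have mr v : exists2 a : 'cV[R]_3 -> R, forall x, W x -> right_derivative f x v (a x) &
    measurable_fun D (fun p : R3 => a (pt3 p)).
  have /choice[a aE] : forall x, exists a, W x -> right_derivative f x v a.
    move=> x; have [Wx|nW] := pselect (W x); last by exists 0.
    by have [b hb] := rd x v Wx; exists b.
  exists a => //.
  pose h n (p : R3) : R := n.+1%:R * ((f \_ W) (pt3 p + n.+1%:R^-1 *: v) - f (pt3 p)).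
  apply: (@measurable_fun_cvg _ _ _ _ h) => [n|p Wp].
    apply: measurable_funM; first exact: measurable_cst.
    apply: measurable_funB; first exact: shift_measurable.
    exact: continuous_measurable.
  have lim := right_derivative_seq (aE _ Wp).
  apply: cvg_trans lim; apply: near_eq_cvg.
  have : \forall t \near (0 : R), W (pt3 p + t *: v).
    by apply: near_line; exact: open_nbhs_nbhs.
  move=> /(@cvg_harmonic R) ev.
  have ev' : \forall n \near \oo, W (pt3 p + n.+1%:R^-1 *: v) by exact: ev.
  by apply: filterS ev' => n Wn; rewrite /h patchE mem_set.
have [a ha ma] := mr e; have [b hb mb] := mr (- e).
apply: (@eq_measurable_fun _ _ _ _ _
  (fun p : R3 => if a (pt3 p) == - b (pt3 p) then a (pt3 p) else 0)).
  by move=> p /set_mem Wp; rewrite (derive_right (ha _ Wp) (hb _ Wp)).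
apply: measurable_fun_if => //.
- by apply: measurable_fun_eqr => //; exact: measurable_funN.
- by apply: measurable_funS ma => // p [].
Qed.

End Bounded.
End VolumeIntegral.

(** * Energy, coupling form and multiplier form *)

Lemma normr_le_dist (R : realType) (a b : R) : `|b| <= `|a| + `|a - b|.
Proof. by have := ler_normB a (a - b); rewrite opprB addrCA subrr addr0. Qed.

Lemma eq_surf_int (R : realType) (S : set 'cV[R]_3) (f g : 'cV[R]_3 -> R) :
  (forall x, S x -> f x = g x) -> surf_int S f = surf_int S g.
Proof. by move=> fg; apply: eq_Rintegral => x /set_mem; exact: fg. Qed.

Lemma eq_vol_int (R : realType) (W : set 'cV[R]_3) (f g : 'cV[R]_3 -> R) :
  (forall x, W x -> f x = g x) -> vol_int W f = vol_int W g.
Proof. by move=> fg; apply: eq_Rintegral => p /set_mem; exact: fg. Qed.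

Section Forms.
Variable R : realType.
Variables (S V : set 'cV[R]_3) (ts : seq (tetra R)).
Implicit Types (x y e : 'cV[R]_3) (f g mu : 'cV[R]_3 -> R).
Implicit Types (u v : 'cV[R]_3 -> 'cV[R]_3).
Hypotheses (Sc : compact S) (S0 : S !=set0) (oV : open V) (SV : S `<=` V).
Hypothesis CV : Ck 2 V (sdist S).
Hypothesis nd : forall T, T \in ts -> Defs.nondegenerate T.
Hypothesis Scov : forall x, S x -> nbhs x (cut_cover S ts).

Let W := cut_domain S ts.
Hypothesis WV : W `<=` V.

Let n := normal S.

Lemma sdist_differentiable x : V x -> differentiable (sdist S) x.
Proof. exact: CV.1. Qed.

Lemma normalE i : (fun y => n y i 0) = 'D_(delta_mx i 0) (sdist S).
Proof. by apply/funext => y; rewrite mxE. Qed.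

Lemma normal_differentiable x i : V x -> differentiable (fun y => n y i 0) x.
Proof. by move=> Vx; rewrite normalE; exact: (CV.2 i).1. Qed.

Lemma normal_continuous x i : V x -> {for x, continuous (fun y => n y i 0)}.
Proof. by move=> Vx; exact/differentiable_continuous/normal_differentiable. Qed.

Lemma curvature_continuous x i j : V x ->
  {for x, continuous ('D_(delta_mx j 0) (fun y => n y i 0))}.
Proof. by move=> Vx; rewrite normalE; exact: (CV.2 i).2. Qed.

Lemma normal_dot_le1 x : V x -> dot (n x) (n x) <= 1.
Proof. by move=> Vx; apply: normal_le1 => //; exact: sdist_differentiable. Qed.

Lemma normal_enorm_le1 x : V x -> enorm (n x) <= 1.
Proof.
move=> /normal_dot_le1; rewrite -sqr_enorm => h.
by have := enorm_ge0 (n x); nra.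
Qed.

Lemma normal_coord_le1 x i : V x -> `|n x i 0| <= 1.
Proof. by move=> Vx; exact: le_trans (coord_le_enorm _ _) (normal_enorm_le1 Vx). Qed.

Lemma dot_normal_le x (w : 'cV[R]_3) : V x -> dot w (n x) ^+ 2 <= dot w w.
Proof.
move=> Vx; apply: (le_trans (dot_cauchy _ _)).
by rewrite ler_piMr ?dot_ge0// normal_dot_le1.
Qed.

(** The matrix is the Hessian of the signed distance. *)
Lemma Hmx_sym x : S x -> (Hmx S x)^T = Hmx S x.
Proof.
move=> Sx; apply/matrixP => i j; rewrite !mxE -/n !normalE.
exact: derive_comm oV CV (SV Sx).
Qed.

Lemma strain_sym u x : S x -> (strain S u x)^T = strain S u x.
Proof.
move=> Sx; rewrite /strain linearD !linearZ/= Hmx_sym//; congr (_ *: _ + _).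
have Ps : (Pmx S x)^T = Pmx S x.
  by rewrite /Pmx linearB/= trmx1 trmx_mul trmxK.
set J := jac _ x; have Js : (J + J^T)^T = J + J^T by rewrite linearD/= trmxK addrC.
by rewrite !trmx_mul Ps Js mulmxA.
Qed.

Lemma trace_sq_ge0 (M : 'M[R]_3) : M^T = M -> 0 <= \tr (M *m M).
Proof.
move=> Ms; rewrite /mxtrace; apply: sumr_ge0 => i _; rewrite mxE.
by apply: sumr_ge0 => k _; rewrite -{2}Ms mxE -expr2 sqr_ge0.
Qed.

Lemma cut_continuous m f x : Vh S ts m f -> nbhs x (cut_cover S ts) ->
  {for x, continuous f}.
Proof.
move=> Vf hx; have [L L0 fL] := Vh_bounded_lipschitz Vf.
apply/(@cvgrPdist_le _ _ _ (nbhs x)) => e e0.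
have /nbhs_enormP[r r0 rH] := near_lipschitz nd hx fL.
apply: (proj2 (nbhs_enormP _ _)); exists (Num.min r (e / (L + 1))).
  by rewrite lt_min r0 divr_gt0// ltr_wpDl.
move=> y; rewrite lt_min ltr_pdivlMr ?ltr_wpDl// => /andP[yr ye].
rewrite distrC; apply: (le_trans (rH y yr)); apply: le_trans (ltW ye).
by rewrite mulrC ler_wpM2l ?enorm_ge0// lerDl.
Qed.

Lemma domain_nbhs x : W x -> nbhs x (cut_cover S ts).
Proof. exact: cut_domain_nbhs. Qed.

Section SurfaceLipschitz.

(** A Lipschitz bound between points of the surface and nearby points. It is
    enough to bound derivatives on the surface, and it is stable under products
    although the factors are only compared with their values on the surface. *)
Definition surface_lipschitz f : Prop := exists2 L, 0 <= L &
  forall x, S x -> `|f x| <= L /\ \forall y \near x, `|f y - f x| <= L * enorm (y - x).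

Lemma surface_lipschitz_cst a : surface_lipschitz (fun=> a).
Proof.
exists `|a| => // x Sx; split=> //; near=> y.
by rewrite subrr normr0 mulr_ge0 ?enorm_ge0.
Unshelve. all: by end_near. Qed.

Lemma surface_lipschitzD f g : surface_lipschitz f -> surface_lipschitz g ->
  surface_lipschitz (fun x => f x + g x).
Proof.
move=> [L L0 fL] [M M0 gM]; exists (L + M); first exact: addr_ge0.
move=> x Sx; have [f1 f2] := fL x Sx; have [g1 g2] := gM x Sx; split.
  by apply: (le_trans (ler_normD _ _)); exact: lerD.
near=> y; rewrite opprD addrACA mulrDl; apply: (le_trans (ler_normD _ _)).
by apply: lerD; near: y.
Unshelve. all: by end_near. Qed.

Lemma surface_lipschitzM f g : surface_lipschitz f -> surface_lipschitz g ->
  surface_lipschitz (fun x => f x * g x).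
Proof.
move=> [L L0 fL] [M M0 gM]; exists ((L + L) * M + L * M).
  by rewrite addr_ge0 ?mulr_ge0 ?addr_ge0.
move=> x Sx; have [f1 f2] := fL x Sx; have [g1 g2] := gM x Sx; split.
  rewrite normrM; apply: (@le_trans _ _ (L * M)); first exact: ler_pM.
  by rewrite lerDr mulr_ge0 ?addr_ge0.
near=> y.
have fy : `|f y - f x| <= L * enorm (y - x) by near: y.
have gy : `|g y - g x| <= M * enorm (y - x) by near: y.
have y1 : enorm (y - x) < 1.
  by near: y; apply: (proj2 (nbhs_enormP _ _)); exists 1.
have fy2 : `|f y| <= L + L.
  apply: (le_trans (normr_le_dist (f x) _)); rewrite distrC.
  apply: lerD => //; apply: (le_trans fy).
  by rewrite ler_piMr// ltW.
rewrite (_ : f y * g y - f x * g x = f y * (g y - g x) + (f y - f x) * g x); last by ring.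
apply: (le_trans (ler_normD _ _)); rewrite !normrM mulrDl.
apply: lerD.
  by rewrite -mulrA; apply: ler_pM.
by rewrite mulrAC; apply: ler_pM.
Unshelve. all: by end_near. Qed.

Lemma surface_lipschitz_sum (I : Type) (r : seq I) (F : I -> 'cV[R]_3 -> R) :
  (forall i, surface_lipschitz (F i)) ->
  surface_lipschitz (fun x => \sum_(i <- r) F i x).
Proof.
move=> h; elim: r => [|i r IH].
  by under eq_fun do rewrite big_nil; exact: surface_lipschitz_cst.
by under eq_fun do rewrite big_cons; exact: surface_lipschitzD.
Qed.

Lemma surface_lipschitz_fe m f : Vh S ts m f -> surface_lipschitz f.
Proof.
move=> Vf; have [L L0 fL] := Vh_bounded_lipschitz Vf; exists L => // x Sx.
have h := near_lipschitz nd (Scov Sx) fL; split; last exact: h.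
have [T cT Tx] := nbhs_singleton (Scov Sx).
exact: (fL T cT x x Tx Tx).1.
Qed.

(** The derivatives of the normal are continuous, hence bounded on the surface, and
    near a point of the surface they exceed this bound by at most 1. *)
Lemma surface_lipschitz_normal i : surface_lipschitz (fun y => n y i 0).
Proof.
pose g j := 'D_(delta_mx j 0) (fun y => n y i 0).
have cg j : continuous_at_surface S (g j).
  by move=> x Sx; exact: curvature_continuous (SV Sx).
have /choice[M gM] : forall j, exists M, forall x, S x -> `|g j x| <= M.
  by move=> j; exact: surface_bounded.
pose L := \sum_j (`|M j| + 1).
have L1 : 1 <= L.
  rewrite /L (bigD1 ord0)//= -addrA addrCA lerDl addr_ge0//.
  by apply: sumr_ge0 => j _; rewrite addr_ge0.
exists L; first exact: le_trans L1.
move=> x Sx; split; first exact: le_trans (normal_coord_le1 i (SV Sx)) L1.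
have : nbhs x (V `&` [set y | forall j, `|g j x - g j y| < 1]).
  apply: filterI; first by apply: open_nbhs_nbhs; split=> //; exact: SV.
  apply: (@filter_forall _ _ (fun j => [set y | `|g j x - g j y| < 1]) (nbhs x)) => j.
  exact: near_dist (cg j x Sx) ltr01.
move=> /nbhs_enormP[r r0 rH]; apply: (proj2 (nbhs_enormP _ _)); exists r => // y yr.
have seg t : 0 <= t <= 1 -> enorm (x + t *: (y - x) - x) < r.
  move=> /andP[t0 t1]; rewrite addrAC subrr add0r enormZ ger0_norm//.
  by apply: le_lt_trans yr; rewrite ler_piMl ?enorm_ge0.
have dn t : 0 <= t <= 1 -> differentiable (fun y => n y i 0) (x + t *: (y - x)).
  by move=> /seg /rH[Vy _]; exact: normal_differentiable.
have [t t01] := @line_mvt R (fun y => n y i 0) x (y - x)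
  (fun t t01 => @diff_derivable _ _ _ _ _ (y - x) (dn t t01)).
rewrite [x + (y - x)]addrC subrK => ->.
rewrite derive_grad; last exact: dn.
rewrite /dot.
have [_ gt] := rH _ (seg t t01).
apply: (le_trans (ler_norm_sum _ _ _)); rewrite /L mulr_suml; apply: ler_sum => j _.
rewrite normrM; apply: ler_pM => //; last exact: coord_le_enorm.
rewrite mxE -/(g j _).
apply: (le_trans (normr_le_dist (g j x) _)).
apply: lerD; last exact: (ltW (gt j)).
exact: le_trans (gM j x Sx) (ler_norm _).
Qed.

Lemma proj_id x : S x -> Defs.proj S x = x.
Proof. by move=> Sx; rewrite /Defs.proj sdist_in// scale0r subr0. Qed.

Lemma proj_dist x y : S x -> V y -> enorm (Defs.proj S y - x) <= 2 * enorm (y - x).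
Proof.
move=> Sx Vy; rewrite /Defs.proj addrAC (_ : 2 = 1 + 1)// mulrDl !mul1r.
apply: (le_trans (enormD _ _)); rewrite lerD// enormN enormZ.
rewrite -[leRHS]mulr1; apply: ler_pM => //; first exact: enorm_ge0.
  exact: sdist_le.
exact: normal_enorm_le1.
Qed.

(** Near the surface the closest point map at most doubles distances to points
    of the surface. *)
Lemma derive_proj_bounded f e : surface_lipschitz f -> exists M, forall x, S x ->
  `|'D_e (f \o Defs.proj S) x| <= M.
Proof.
move=> [L L0 fL]; exists (L * (2 * enorm e)) => x Sx.
apply: derive_le; first by rewrite !mulr_ge0 ?enorm_ge0.
have [_ /nbhs_enormP[r r0 rH]] := fL x Sx.
have : nbhs x (V `&` [set y | enorm (y - x) < r / 2]).
  apply: filterI; first by apply: open_nbhs_nbhs; split=> //; exact: SV.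
  by apply: (proj2 (nbhs_enormP _ _)); exists (r / 2) => //; rewrite divr_gt0.
move=> /(near_line e); apply: filterS => t [Vt /=].
rewrite ltr_pdivlMr// mulrC => tr; rewrite /= (proj_id Sx).
have pd := proj_dist Sx Vt.
apply: (le_trans (rH _ (le_lt_trans pd tr))).
rewrite -[leRHS]mulrA ler_wpM2l// -[leRHS]mulrA (mulrC (enorm e)).
by move: pd; rewrite (addrAC x) subrr add0r enormZ.
Qed.

End SurfaceLipschitz.

Definition bounded_on f : Prop := exists M, forall x, S x -> `|f x| <= M.

Lemma bounded_on_cst a : bounded_on (fun=> a).
Proof. by exists `|a|. Qed.

Lemma bounded_onD f g : bounded_on f -> bounded_on g -> bounded_on (fun x => f x + g x).
Proof.
move=> [M fM] [N gN]; exists (M + N) => x Sx; apply: (le_trans (ler_normD _ _)).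
by apply: lerD; [exact: fM|exact: gN].
Qed.

Lemma bounded_onM f g : bounded_on f -> bounded_on g -> bounded_on (fun x => f x * g x).
Proof.
move=> [M fM] [N gN]; exists (M * N) => x Sx; rewrite normrM.
by apply: ler_pM => //; [exact: fM|exact: gN].
Qed.

Lemma bounded_on_sum (I : Type) (r : seq I) (F : I -> 'cV[R]_3 -> R) :
  (forall i, bounded_on (F i)) -> bounded_on (fun x => \sum_(i <- r) F i x).
Proof.
move=> h; elim: r => [|i r IH].
  by under eq_fun do rewrite big_nil; exact: bounded_on_cst.
by under eq_fun do rewrite big_cons; exact: bounded_onD.
Qed.

Definition bounded_mx (F : 'cV[R]_3 -> 'M[R]_3) : Prop :=
  forall i j, bounded_on (fun x => F x i j).

Lemma bounded_mxM (F G : 'cV[R]_3 -> 'M[R]_3) : bounded_mx F -> bounded_mx G ->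
  bounded_mx (fun x => F x *m G x).
Proof.
move=> bF bG i j; under eq_fun do rewrite mxE.
by apply: bounded_on_sum => k; exact: bounded_onM.
Qed.

Lemma bounded_surface_lipschitz f : surface_lipschitz f -> bounded_on f.
Proof. by move=> [L _ fL]; exists L => x /fL[]. Qed.

Lemma npart_lipschitz k u : Uh S ts k u -> surface_lipschitz (npart S u).
Proof.
move=> Uu; apply: surface_lipschitz_sum => i; apply: surface_lipschitzM.
  exact: surface_lipschitz_fe (Uu i).
exact: surface_lipschitz_normal.
Qed.

(** The strain is built from the normal, its derivatives and the derivatives of the
    tangential part composed with the closest point map; all of them are bounded
    on the compact surface. *)
Lemma strain_bounded k u : Uh S ts k u -> bounded_mx (strain S u).
Proof.
move=> Uu.
have bn i : bounded_on (fun x => n x i 0).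
  exact/bounded_surface_lipschitz/surface_lipschitz_normal.
have bP : bounded_mx (Pmx S).
  move=> i j; have -> : (fun x => Pmx S x i j) =
      (fun x => (i == j)%:R + (-1) * (n x i 0 * n x j 0)).
    by apply/funext => x; rewrite !mxE big_ord1 !mxE mulN1r.
  apply: bounded_onD; first exact: bounded_on_cst.
  by apply: bounded_onM; [exact: bounded_on_cst|exact: bounded_onM].
have bJ : bounded_mx (jac (tpart S u \o Defs.proj S)).
  move=> i j.
  have tl : surface_lipschitz (fun y => tpart S u y i 0).
    have -> : (fun y => tpart S u y i 0) =
        (fun y => u y i 0 + (-1) * (npart S u y * n y i 0)).
      by apply/funext => y; rewrite !mxE mulN1r.
    apply: surface_lipschitzD; first exact: surface_lipschitz_fe (Uu i).
    apply: surface_lipschitzM; first exact: surface_lipschitz_cst.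
    apply: surface_lipschitzM; first exact: npart_lipschitz Uu.
    exact: surface_lipschitz_normal.
  have [M MH] := derive_proj_bounded (delta_mx j 0) tl.
  by exists M => x Sx; rewrite mxE; exact: MH.
have bH : bounded_mx (Hmx S).
  move=> i j; have [M MH] := @surface_bounded R S Sc
    ('D_(delta_mx j 0) (fun y => n y i 0)) 
    (fun x Sx => curvature_continuous (x := x) (i := i) (j := j) (SV Sx)).
  by exists M => x Sx; rewrite mxE; exact: MH.
move=> i j; set J := jac _ in bJ.
have -> : (fun x => strain S u x i j) = (fun x => 2^-1 *
    (Pmx S x *m (J x + (J x)^T) *m Pmx S x) i j + npart S u x * Hmx S x i j).
  by apply/funext => x; rewrite [LHS]mxE; congr (_ + _); rewrite [LHS]mxE.
apply: bounded_onD; last first.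
  apply: bounded_onM; last exact: bH.
  exact/bounded_surface_lipschitz/(npart_lipschitz Uu).
apply: bounded_onM; first exact: bounded_on_cst.
have bJJ : bounded_mx (fun x => J x + (J x)^T).
  move=> i' j'; have -> : (fun x => (J x + (J x)^T) i' j') =
      (fun x => J x i' j' + J x j' i').
    by apply/funext => x; rewrite [LHS]mxE; congr (_ + _); rewrite [LHS]mxE.
  by apply: bounded_onD; exact: bJ.
exact: (bounded_mxM (bounded_mxM bP bJJ) bP).
Qed.

Lemma aform_density_bounded k u : Uh S ts k u ->
  bounded_on (fun x => \tr (strain S u x *m strain S u x) + dot (u x) (u x)).
Proof.
move=> Uu; apply: bounded_onD.
  apply: bounded_on_sum => i.
  have bs := strain_bounded Uu.
  exact: (bounded_mxM bs bs).
apply: bounded_on_sum => i.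
have h := bounded_surface_lipschitz (surface_lipschitz_fe (Uu i)).
exact: bounded_onM.
Qed.

Lemma fe_continuous_at_surface m f : Vh S ts m f -> continuous_at_surface S f.
Proof. by move=> Vf x Sx; exact: cut_continuous Vf (Scov Sx). Qed.

Hypothesis Sfin : (hausdorff2 S < +oo)%E.

Lemma dot_continuous_at_surface (p q : 'cV[R]_3 -> 'cV[R]_3) :
  (forall i, continuous_at_surface S (fun x => p x i 0)) ->
  (forall i, continuous_at_surface S (fun x => q x i 0)) ->
  continuous_at_surface S (fun x => dot (p x) (q x)).
Proof.
move=> cp cq x Sx; have -> : (fun x => dot (p x) (q x)) =
    (fun x => p x 0 0 * q x 0 0 + p x 1 0 * q x 1 0 + p x 2%:R 0 * q x 2%:R 0).
  apply/funext => y; rewrite /dot !big_ord_recl big_ord0 addr0 addrA.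
  have -> : lift ord0 (lift ord0 ord0) = 2%:R :> 'I_3 by apply/val_inj.
  by have -> : lift ord0 ord0 = 1 :> 'I_3 by apply/val_inj.
by apply: continuousD; [apply: continuousD|]; apply: continuousM;
  [exact: cp|exact: cq|exact: cp|exact: cq|exact: cp|exact: cq].
Qed.

(** The surface part of the coupling form is controlled because the strain term
    of the energy is nonnegative; its boundedness keeps the energy finite. *)
Lemma surf_coupling_le k l u mu : Uh S ts k u -> Vh S ts l mu ->
  2 * surf_int S (fun x => npart S u x * mu x) <=
  aform S u u + surf_int S (fun x => mu x * mu x).
Proof.
move=> Uu Vmu.
have cu i := fe_continuous_at_surface (Uu i).
have cn i : continuous_at_surface S (fun x => n x i 0).
  by move=> x Sx; exact: normal_continuous (SV Sx).
have cN : continuous_at_surface S (npart S u) by exact: dot_continuous_at_surface.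
apply: (le_trans (surf_int_young Sc Sfin cN (fe_continuous_at_surface Vmu))).
rewrite lerD2r /aform.
have [M MH] := aform_density_bounded Uu.
apply: (@le_surf_int R S Sc Sfin _ _ M) => x Sx.
- by rewrite -expr2 sqr_ge0.
- rewrite -expr2 ler_wpDl//; last exact: dot_normal_le (SV Sx).
  exact/trace_sq_ge0/strain_sym.
- exact: le_trans (ler_norm _) (MH x Sx).
Qed.

Lemma domain_bounded : exists r, forall x i, W x -> `|x i 0| < r.
Proof.
pose M := \sum_(T <- ts) \sum_i \sum_j `|T i j|.
have M0 (T : tetra R) : 0 <= \sum_i \sum_j `|T i j|.
  by apply: sumr_ge0 => i _; apply: sumr_ge0.
exists (M + 1) => x i /domain_nbhs/nbhs_singleton[T [Tts _] Tx].
apply: (@le_lt_trans _ _ M); last by rewrite ltrDl.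
apply: (le_trans (hull_bounded Tx i)).
apply: (@le_trans _ _ (\sum_i \sum_j `|T i j|)).
  rewrite [leRHS](bigD1 i)//= lerDl; apply: sumr_ge0 => k _; exact: sumr_ge0.
by rewrite /M (big_rem T Tts)/= lerDl; exact: sumr_ge0.
Qed.

Lemma derive_measurable_bounded m f e : Vh S ts m f ->
  measurable_bounded W ('D_e f).
Proof.
move=> Vf; split.
  apply: derive_measurable; first exact: cut_domain_open.
    by move=> x /domain_nbhs; exact: cut_continuous Vf.
  by move=> x v /domain_nbhs hx; exact: (Vh_right nd v Vf hx).
have [L L0 fL] := Vh_bounded_lipschitz Vf; exists (L * enorm e) => x /domain_nbhs hx.
have h := near_bounded_lipschitz nd e hx L0 fL. exact: h.
Qed.

Lemma normal_measurable_bounded i : measurable_bounded W (fun x => n x i 0).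
Proof.
split; last by exists 1 => x /WV; exact: normal_coord_le1.
apply: (@continuous_measurable R W (fun x => n x i 0)); first exact: cut_domain_open.
by move=> x /WV; exact: normal_continuous.
Qed.

Lemma jac_normal_measurable_bounded k u i : Uh S ts k u ->
  measurable_bounded W (fun x => (jac u x *m n x) i 0).
Proof.
move=> Uu; under eq_fun do rewrite mxE; apply: measurable_bounded_sum => j.
apply: measurable_boundedM; last exact: normal_measurable_bounded.
under eq_fun do rewrite mxE; exact: derive_measurable_bounded (Uu i).
Qed.

Lemma normal_grad_measurable_bounded m mu : Vh S ts m mu ->
  measurable_bounded W (fun x => dot (n x) (grad mu x)).
Proof.
move=> Vmu; apply: measurable_bounded_dot => i; first exact: normal_measurable_bounded.
under eq_fun do rewrite mxE; exact: derive_measurable_bounded Vmu.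
Qed.

(** The normal has length at most 1, so the normal component of the normal
    derivative is controlled by the whole normal derivative. *)
Lemma vol_coupling_le k l u mu : Uh S ts k u -> Vh S ts l mu ->
  2 * vol_int W (fun x => dot (n x) (jac u x *m n x) * dot (n x) (grad mu x)) <=
  vol_int W (fun x => dot (jac u x *m n x) (jac u x *m n x)) +
  vol_int W (fun x => dot (n x) (grad mu x) * dot (n x) (grad mu x)).
Proof.
move=> Uu Vmu; have [r rW] := domain_bounded.
have oW : open W by exact: cut_domain_open.
have bJ i := jac_normal_measurable_bounded i Uu.
have bg := normal_grad_measurable_bounded Vmu.
have bN : measurable_bounded W (fun x => dot (n x) (jac u x *m n x)).
  by apply: measurable_bounded_dot => // i; exact: normal_measurable_bounded.
apply: (le_trans (vol_int_young oW rW bN bg)); rewrite lerD2r.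
apply: (le_vol_int oW rW); [exact: measurable_boundedM|exact: measurable_bounded_dot|].
by move=> x /WV Vx; rewrite -expr2 dotC; exact: dot_normal_le.
Qed.

Variable rho : R.
Hypothesis rho0 : 0 < rho.

Lemma coupling_le k l u mu : Uh S ts k u -> Vh S ts l mu ->
  2 * bform S W rho u mu <= Ah S W rho u u + Mform S W rho mu mu.
Proof.
move=> Uu Vmu; rewrite /bform /Ah /Mform mulrDr addrACA.
apply: lerD; first exact: surf_coupling_le Uu Vmu.
by rewrite -mulrDr mulrCA ler_pM2l//; exact: vol_coupling_le Uu Vmu.
Qed.

Lemma Ah_sym u v : Ah S W rho u v = Ah S W rho v u.
Proof.
have e1 : aform S u v = aform S v u.
  by apply: eq_surf_int => x _; rewrite mxtrace_mulC dotC.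
have e2 : vol_int W (fun x => dot (jac u x *m n x) (jac v x *m n x)) =
    vol_int W (fun x => dot (jac v x *m n x) (jac u x *m n x)).
  by apply: eq_vol_int => x _; rewrite dotC.
by rewrite /Ah e1 e2.
Qed.

Lemma Mform_sym f g : Mform S W rho f g = Mform S W rho g f.
Proof.
have e1 : surf_int S (fun x => f x * g x) = surf_int S (fun x => g x * f x).
  by apply: eq_surf_int => x _; rewrite mulrC.
have e2 : vol_int W (fun x => dot (n x) (grad f x) * dot (n x) (grad g x)) =
    vol_int W (fun x => dot (n x) (grad g x) * dot (n x) (grad f x)).
  by apply: eq_vol_int => x _; rewrite mulrC.
by rewrite /Mform e1 e2.
Qed.

Lemma surf_int_sq_ge0 f : 0 <= surf_int S (fun x => f x * f x).
Proof. by apply: Rintegral_ge0 => x _; rewrite -expr2 sqr_ge0. Qed.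

Lemma vol_int_sq_ge0 f : 0 <= vol_int W (fun x => f x * f x).
Proof. by apply: Rintegral_ge0 => x _; rewrite -expr2 sqr_ge0. Qed.

Lemma Mform_ge0 mu : 0 <= Mform S W rho mu mu.
Proof. by rewrite addr_ge0 ?surf_int_sq_ge0// mulr_ge0 ?vol_int_sq_ge0// ltW. Qed.

Hypothesis Spos : forall x (r : R), S x -> 0 < r ->
  (0 < hausdorff2 (S `&` [set y | (enorm (y - x) < r)%R]))%E.

Definition first_component mu : 'cV[R]_3 -> 'cV[R]_3 := fun x => mu x *: delta_mx 0 0.

Lemma first_component_Uh m mu : Vh S ts m mu -> Uh S ts m (first_component mu).
Proof.
move=> Vmu i; have [->|i0] := eqVneq i 0.
  have -> : (fun x => first_component mu x 0 0) = mu => //.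
  by apply/funext => x; rewrite !mxE eqxx mulr1.
have -> : (fun x => first_component mu x i 0) = (fun=> 0); last exact: Vh0.
by apply/funext => x; rewrite !mxE (negbTE i0) mulr0.
Qed.

(** A function with vanishing M-norm is zero on the surface, and the integral of its
    squared normal derivative is zero, so the vector field mu e_0 has zero
    energy. The tangential
    strain vanishes because the closest point map takes values in the surface. *)
Lemma Mform_eq0 m mu : Vh S ts m mu -> Mform S W rho mu mu = 0 ->
  Ah S W rho (first_component mu) (first_component mu) = 0.
Proof.
move=> Vmu M0.
have s0 := surf_int_sq_ge0 mu.
have v0 := vol_int_sq_ge0 (fun x => dot (n x) (grad mu x)).
have rv0 : 0 <= rho * vol_int W (fun x => dot (n x) (grad mu x) * dot (n x) (grad mu x)).
  by rewrite mulr_ge0// ltW.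
have [/(surf_int_eq0 Sc Sfin Spos (fe_continuous_at_surface Vmu)) mu0 /eqP] :
    surf_int S (fun x => mu x * mu x) = 0 /\
    rho * vol_int W (fun x => dot (n x) (grad mu x) * dot (n x) (grad mu x)) = 0.
  by move: M0; rewrite /Mform => M0; split; lra.
rewrite mulf_eq0 gt_eqF//= => /eqP g0.
set u := first_component mu.
have u0 x : S x -> u x = 0 by move=> Sx; rewrite /u /first_component mu0// scale0r.
have N0 x : S x -> npart S u x = 0 by move=> Sx; rewrite /npart u0// dot0l.
have strain0 x : S x -> strain S u x = 0.
  move=> Sx; rewrite /strain N0// scale0r addr0 /Es.
  have -> : jac (tpart S u \o Defs.proj S) x = 0.
    apply/matrixP => i j; rewrite !mxE.
    rewrite (@near_eq_derive _ _ _ _ (cst 0)) ?derive_cst//.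
    have : nbhs x V by apply: open_nbhs_nbhs; split=> //; exact: SV.
    apply: filterS => y Vy /=.
    have Sy : S (Defs.proj S y) by apply: proj_in => //; exact: sdist_differentiable.
    by rewrite /tpart u0// N0// scale0r subr0 mxE.
  by rewrite trmx0 addr0 mulmx0 mul0mx scaler0.
have a0 : aform S u u = 0.
  rewrite /aform (@eq_surf_int _ _ _ (fun=> 0)) => [|x Sx].
    by rewrite /surf_int /Rintegral integral0.
  by rewrite strain0// mul0mx mxtrace0 add0r u0// dot0l.
rewrite /Ah a0 add0r; apply/eqP; rewrite mulf_eq0 gt_eqF//=; apply/eqP.
rewrite -[RHS]g0; apply: eq_vol_int => x _.
have ju : jac u x *m n x = dot (n x) (grad mu x) *: delta_mx 0 0.
  apply/colP => i; rewrite mxE [RHS]mxE /dot mulr_suml; apply: eq_bigr => j _.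
  rewrite !mxE; have [->|i0] := eqVneq i 0.
    rewrite mulr1 mulrC; congr (_ * _).
    congr ('D_(delta_mx j 0) _ x).
    by apply/funext => y; rewrite !mxE eqxx mulr1.
  rewrite mulr0 (_ : (fun y => u y i 0) = cst 0) ?derive_cst ?mul0r//.
  by apply/funext => y; rewrite !mxE (negbTE i0) mulr0.
rewrite ju dotZl dotZr; congr (_ * _); rewrite -[RHS]mulr1; congr (_ * _).
rewrite /dot (bigD1 0)//= big1 => [|i i0]; last by rewrite !mxE (negbTE i0) mul0r.
by rewrite !mxE mulr1 addr0.
Qed.

Section Congruence.
Variables (u v : 'cV[R]_3 -> 'cV[R]_3).
Hypothesis uv : forall x, cut_cover S ts x -> u x = v x.

Lemma npart_congr x : cut_cover S ts x -> npart S u x = npart S v x.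
Proof. by move=> cx; rewrite /npart uv. Qed.

(** The strain at x differentiates values at closest points, and near x the closest
    points lie in the cut mesh. *)
Lemma strain_congr x : S x -> strain S u x = strain S v x.
Proof.
move=> Sx.
suff J : jac (tpart S u \o Defs.proj S) x = jac (tpart S v \o Defs.proj S) x.
  by rewrite /strain /Es J npart_congr//; exact: (nbhs_singleton (Scov Sx)).
apply/matrixP => i j; rewrite !mxE; apply: near_eq_derive.
have /nbhs_enormP[r r0 rH] := Scov Sx.
have : nbhs x (V `&` [set y | enorm (y - x) < r / 2]).
  apply: filterI; first by apply: open_nbhs_nbhs; split=> //; exact: SV.
  by apply: (proj2 (nbhs_enormP _ _)); exists (r / 2) => //; rewrite divr_gt0.
apply: filterS => y [Vy /=]; rewrite ltr_pdivlMr// mulrC => yr.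
have cy : cut_cover S ts (Defs.proj S y).
  by apply: rH; exact: le_lt_trans (proj_dist Sx Vy) yr.
by rewrite /tpart npart_congr// uv.
Qed.

Lemma jac_congr x : W x -> jac u x = jac v x.
Proof.
move=> Wx; apply/matrixP => i j; rewrite !mxE; apply: near_eq_derive.
by apply: filterS (domain_nbhs Wx) => y /uv ->.
Qed.

Lemma Ah_congr : Ah S W rho u u = Ah S W rho v v.
Proof.
have e1 : aform S u u = aform S v v.
  apply: eq_surf_int => x Sx; rewrite strain_congr// uv//.
  exact: (nbhs_singleton (Scov Sx)).
have e2 : vol_int W (fun x => dot (jac u x *m n x) (jac u x *m n x)) =
    vol_int W (fun x => dot (jac v x *m n x) (jac v x *m n x)).
  by apply: eq_vol_int => x Wx; rewrite jac_congr.
by rewrite /Ah e1 e2.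
Qed.

Lemma bform_congr mu : bform S W rho u mu = bform S W rho v mu.
Proof.
have e1 : surf_int S (fun x => npart S u x * mu x) =
    surf_int S (fun x => npart S v x * mu x).
  apply: eq_surf_int => x Sx; rewrite npart_congr//.
  exact: (nbhs_singleton (Scov Sx)).
have e2 : vol_int W (fun x => dot (n x) (jac u x *m n x) * dot (n x) (grad mu x)) =
    vol_int W (fun x => dot (n x) (jac v x *m n x) * dot (n x) (grad mu x)).
  by apply: eq_vol_int => x Wx; rewrite jac_congr.
by rewrite /bform e1 e2.
Qed.

End Congruence.

End Forms.

(** * Positions of the surface and nodal vectors *)

Section MovedSurface.
Variable R : realType.
Variables (Gam0 : set 'cV[R]_3) (g : 'M[R]_3 * 'cV[R]_3).
Hypotheses (cs : closed_surface Gam0) (gO : g.1 *m g.1^T = 1%:M).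

Lemma orthogonal_isometry (O : 'M[R]_3) (t x y : 'cV[R]_3) : O^T *m O = 1%:M ->
  enorm ((O *m x + t) - (O *m y + t)) = enorm (x - y).
Proof.
move=> OO; rewrite opprD addrACA subrr addr0 -mulmxBr /enorm.
by rewrite dot_mulmx mulmxA OO mul1mx.
Qed.

Lemma moved_compact : compact (moved g Gam0).
Proof.
apply: continuous_compact; last by case: cs.
apply: continuous_subspaceT => x A /nbhs_enormP[e e0 eA].
apply: (proj2 (nbhs_enormP _ _)); exists e => // y yx; apply: eA.
by rewrite orthogonal_isometry//; exact: mulmx1C.
Qed.

Lemma moved_nonempty : moved g Gam0 !=set0.
Proof. by case: cs => _ [x Gx] _; exists (g.1 *m x + g.2); exists x. Qed.

Lemma moved_finite : (hausdorff2 (moved g Gam0) < +oo)%E.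
Proof.
apply: le_lt_trans (surface_finite cs).
apply: (hausdorff2_isometry (f := fun x => g.1 *m x + g.2)) => x y.
by rewrite orthogonal_isometry//; exact: mulmx1C.
Qed.

Lemma moved_positive x (r : R) : moved g Gam0 x -> 0 < r ->
  (0 < hausdorff2 (moved g Gam0 `&` [set y | (enorm (y - x) < r)%R]))%E.
Proof.
move=> [x0 Gx0 <-] r0; apply: (lt_le_trans (surface_positive cs Gx0 r0)).
pose f (y : 'cV[R]_3) := g.1^T *m y + (- (g.1^T *m g.2)).
apply: le_trans (hausdorff2_isometry (f := f) _ _); last first.
  by move=> y z; apply: orthogonal_isometry; rewrite trmxK.
apply: le_hausdorff2 => y [Gy yx]; exists (g.1 *m y + g.2).
  split; first by exists y.
  by rewrite /= orthogonal_isometry//; exact: mulmx1C.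
by rewrite /f mulmxDr addrK mulmxA (mulmx1C gO) mul1mx.
Qed.

End MovedSurface.

Lemma eq_mulmx_col (R : realType) m n (X Y : 'M[R]_(m, n)) :
  (forall u : 'cV[R]_n, X *m u = Y *m u) -> X = Y.
Proof.
move=> h; apply/matrixP => i j.
by have := congr1 (fun v : 'cV_m => v i 0) (h (delta_mx j 0)); rewrite -!colE !mxE.
Qed.

Lemma form_matrix_sym (R : realType) n (X : 'M[R]_n) :
  (forall u v : 'cV[R]_n, dot (X *m u) v = dot (X *m v) u) -> X^T = X.
Proof.
move=> Xs; apply: eq_mulmx_col => u; apply: dot_inj => v.
by rewrite dot_mulmx trmxK dotC Xs.
Qed.

(** The product of rho and h is calpha h^(2 - alpha), nondecreasing in h, so the
    upper bound on calpha keeps d2 times its square root below a constant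
    smaller than 1. *)
Lemma infsup_factor (R : realType) (h0 alpha calpha d2 : R) :
  0 < h0 -> 0 <= alpha <= 2 -> 0 < d2 ->
  0 < calpha < d2 ^- 2 * h0 `^ (alpha - 2) ->
  d2 * Num.sqrt (calpha * h0 `^ (2 - alpha)) < 1 /\
  forall h, 0 < h <= h0 -> Num.sqrt (calpha * h `^ (1 - alpha) * h)
    <= Num.sqrt (calpha * h0 `^ (2 - alpha)).
Proof.
move=> h00 /andP[a0 a2] d20 /andP[c0 c1]; split.
  rewrite -(@ltr_pXn2r _ 2) ?nnegrE ?mulr_ge0 ?sqrtr_ge0 ?(ltW d20)//.
  have p0 : 0 < h0 `^ (2 - alpha) by exact: powR_gt0.
  rewrite exprMn sqr_sqrtr ?mulr_ge0 ?(ltW c0) ?(ltW p0)// expr1n.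
  have d22 : 0 < d2 ^+ 2 by rewrite exprn_gt0.
  have e : h0 `^ (alpha - 2) * h0 `^ (2 - alpha) = 1.
    rewrite -powRD; last by rewrite (gt_eqF h00) implybT.
    by rewrite addrA subrK subrr powRr0.
  have : calpha * h0 `^ (2 - alpha) < d2 ^- 2.
    have -> : d2 ^- 2 = d2 ^- 2 * h0 `^ (alpha - 2) * h0 `^ (2 - alpha).
      by rewrite -mulrA e mulr1.
    by rewrite ltr_pM2r.
  by move=> H; rewrite mulrC -ltr_pdivlMr// mul1r.
move=> h /andP[h1 h2]; rewrite ler_sqrt; last first.
  by rewrite mulr_ge0 ?powR_ge0// ltW.
rewrite -mulrA ler_wpM2l ?(ltW c0)//.
rewrite -[X in _ * X](powRr1 (ltW h1)) -powRD; last by rewrite (gt_eqF h1) implybT.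
rewrite (_ : 1 - alpha + 1 = 2 - alpha); last by ring.
by apply: ge0_ler_powR; rewrite ?nnegrE ?subr_ge0// ltW.
Qed.

Lemma nodes_cut_cover (R : realType) (S : set 'cV[R]_3) ts l x : (0 < l)%N ->
  nodes S ts l x -> cut_cover S ts x.
Proof.
move=> l0 [T [a [cT al ->]]]; exists T => //.
exists (\col_i ((a i)%:R / l%:R)) => //; split=> [i||i]; last by rewrite inE.
  by rewrite mxE divr_ge0.
under eq_bigr do rewrite mxE.
by rewrite -mulr_suml -natr_sum al divff// pnatr_eq0 -lt0n.
Qed.

Lemma nodal_vector (R : realType) (S : set 'cV[R]_3) ts k n PU
    (v : 'cV[R]_3 -> 'cV[R]_3) : nodal_map_U (n := n) S ts k PU -> Uh S ts k v ->
  exists w, forall x, cut_cover S ts x -> v x = PU w x.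
Proof.
move=> [nd [_ H]] Uv; exists (\col_i v (nd i).1 (nd i).2 0).
by have [_ _ uniq] := H (\col_i v (nd i).1 (nd i).2 0); apply: uniq => // i; rewrite mxE.
Qed.

Lemma nodal_map_U0 (R : realType) (S : set 'cV[R]_3) ts k n PU :
  nodal_map_U (n := n) S ts k PU -> forall x, cut_cover S ts x -> PU 0 x = 0 :> 'cV[R]_3.
Proof.
move=> [nd [_ H]] x cx; have [_ _ uniq] := H 0.
rewrite -(uniq (fun=> 0))// => [i|i]; last by rewrite !mxE.
have -> : (fun x : 'cV[R]_3 => (0 : 'cV[R]_3) i 0) = (fun=> 0).
  by apply/funext => y; rewrite mxE.
exact: Vh0.
Qed.

(** * The spectrum for one position of the surface *)

Section Position.
Variable R : realType.
Variables (S V Omega : set 'cV[R]_3) (ts : seq (tetra R)) (k l : nat) (rho c : R).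
Hypotheses (Sc : compact S) (S0 : S !=set0) (oV : open V) (SV : S `<=` V).
Hypothesis CV : Ck 2 V (sdist S).
Hypothesis nd : forall T, T \in ts -> Defs.nondegenerate T.
Hypothesis Scov : forall x, S x -> nbhs x (cut_cover S ts).
Let W := cut_domain S ts.
Hypotheses (WV : W `<=` V) (Sfin : (hausdorff2 S < +oo)%E).
Hypothesis Spos : forall x (r : R), S x -> 0 < r ->
  (0 < hausdorff2 (S `&` [set y | (enorm (y - x) < r)%R]))%E.
Hypotheses (rho0 : 0 < rho) (lk : (1 <= l <= k)%N) (c0 : 0 < c).
Hypothesis infsup : forall mu, Vh S ts k mu -> 0 < normM S W rho mu ->
  exists2 v, Uh S ts k v &
    c * normM S W rho mu < bform S W rho v mu / normU S W rho v.

Variables (n m : nat) (PU : 'cV[R]_n -> 'cV[R]_3 -> 'cV[R]_3)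
  (PM : 'cV[R]_m -> 'cV[R]_3 -> R) (A QA : 'M[R]_n) (B : 'M[R]_(m, n)) (SM : 'M[R]_m)
  (gamma1 : R).
Hypotheses (nU : nodal_map_U S ts k PU) (nM : nodal_map_M S ts l PM).
Hypothesis AE : forall u v, dot (A *m u) v = Ah S W rho (PU u) (PU v).
Hypothesis BE : forall u lam, dot (B *m u) lam = bform S W rho (PU u) (PM lam).
Hypothesis SE : forall lam mu, dot (SM *m lam) mu = Mform S W rho (PM lam) (PM mu).
Hypotheses (Qp : spd QA) (g10 : 0 < gamma1) (lo : lemx (gamma1 *: QA) A).

Lemma PU_Uh w : Uh S ts k (PU w).
Proof. by case: nU => ? [_ H]; have [] := H w. Qed.

Lemma PM_Vh p : Vh S ts l (PM p).
Proof. by case: nM => ? [_ H]; have [] := H p. Qed.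

Lemma energy_gt0 w : w != 0 -> 0 < dot (A *m w) w.
Proof.
move=> w0; have := lo w; rewrite mulmxBl -scalemxAl dotBl dotZl subr_ge0.
by apply: lt_le_trans; rewrite mulr_gt0// Qp.2.
Qed.

(** A multiplier in the kernel would give a nonzero velocity of zero energy. *)
Lemma multiplier_spd : spd SM.
Proof.
split; first by apply: form_matrix_sym => u v; rewrite !SE Mform_sym.
move=> p p0; rewrite SE lt0r Mform_ge0// andbT; apply/eqP => M0.
have E := Mform_eq0 Sc S0 oV SV CV nd Scov Sfin rho0 Spos (PM_Vh p) M0.
case/andP: lk => l0 lek.
have Uu : Uh S ts k (first_component (PM p)).
  by move=> i; apply: (Vh_le lek); exact: (first_component_Uh (PM_Vh p)).
have [w wE] := nodal_vector nU Uu.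
have w0 : w = 0.
  apply/eqP/negPn/negP => /energy_gt0.
  by rewrite AE -(Ah_congr S0 oV SV CV nd Scov rho wE) E ltxx.
have pz x : cut_cover S ts x -> PM p x = 0.
  move=> cx; have := wE x cx; rewrite w0 (nodal_map_U0 nU)//.
  by move=> /(congr1 (fun v : 'cV_3 => v 0 0)); rewrite !mxE eqxx mulr1.
move/eqP: p0; apply; apply/colP => i; rewrite mxE.
case: nM => nd' [[ndin _ _] H]; have [_ <- _] := H p.
by apply: pz; apply: (nodes_cut_cover l0); exact: ndin.
Qed.

(** The inf-sup condition supplies a finite element function v, and the forms do not
    distinguish v from the function with the same nodal values. *)
Lemma supremizer p : p != 0 -> exists2 w, w != 0 &
  c * Num.sqrt (dot (SM *m p) p) * Num.sqrt (dot (A *m w) w) <= dot (B *m w) p.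
Proof.
move=> p0; have Sp := multiplier_spd.2 p p0.
have normME : normM S W rho (PM p) = Num.sqrt (dot (SM *m p) p) by rewrite SE.
have nM0 : 0 < normM S W rho (PM p) by rewrite normME sqrtr_gt0.
case/andP: lk => _ lek.
have [v Uv vp] := infsup (Vh_le lek (PM_Vh p)) nM0.
have [w wE] := nodal_vector nU Uv.
have AwE : Ah S W rho v v = dot (A *m w) w.
  by rewrite AE; exact: (Ah_congr S0 oV SV CV nd Scov rho wE).
have nv0 : 0 < normU S W rho v.
  rewrite lt0r sqrtr_ge0 andbT; apply/eqP => nv0.
  move: vp; rewrite nv0 invr0 mulr0 => /lt_trans => /(_ _ (mulr_gt0 c0 nM0)).
  by rewrite ltxx.
exists w.
  apply/eqP => w0; move: nv0; rewrite /normU AwE w0 mulmx0 dot0l sqrtr0.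
  by rewrite ltxx.
rewrite -normME -AwE BE -(bform_congr nd Scov rho wE).
by rewrite -ler_pdivlMr//; exact: ltW.
Qed.

Lemma saddle_spectrum_position (gamma2 : R) : 0 < gamma2 -> lemx A (gamma2 *: QA) ->
  let K := 2 * gamma2 + 1 in
  let D := ((1 + K / gamma1) / c) ^+ 2 in
  spectrum (invmx (block_mx QA 0 0 SM) *m block_mx A B^T B 0) `<=`
    (real_complex R) @` (`[- K - D^-1 - 1, - D^-1]
                          `|` `[gamma1, K + gamma1 + 1]).
Proof.
move=> g20 hi; apply: saddle_spectrum => //.
- by apply: form_matrix_sym => u v; rewrite !AE Ah_sym.
- exact: multiplier_spd.
- move=> u p; rewrite AE BE SE.
  exact: (coupling_le Sc S0 oV SV CV nd Scov WV Sfin rho0 (PU_Uh u) (PM_Vh p)).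
- exact: supremizer.
Qed.

End Position.
Theorem corollary6p3 (R : realType)
  (* reference surface, polygonal domain, positions of the surface *)
  (Gam0 Omega : set 'cV[R]_3) (pos : set ('M[R]_3 * 'cV[R]_3))
  (* mesh sizes and outer triangulations *)
  (hs : set R) (Th : R -> seq (tetra R))
  (k l : nat) (h0 alpha calpha d1 d2 gamma1 gamma2 : R) :
  let Gam g := moved g Gam0 in
  let rho h := calpha * h `^ (1 - alpha) in
  let OmegaG g h := cut_domain (Gam g) (Th h) in
  closed_surface Gam0 ->
  polygonal_domain Omega ->
  (forall g, pos g -> g.1 *m g.1^T = 1%:M /\ Gam g `<=` Omega) ->
  (forall h, hs h -> 0 < h <= h0) ->
  (forall h, hs h -> triangulation Omega (Th h)) ->
  (* shape regularity *)
  (exists kappa : R, forall h T, hs h -> T \in Th h ->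
     diam T <= kappa * inradius T) ->
  (* quasi-uniformity of the cut meshes *)
  (exists q1 q2 : R, 0 < q1 /\ forall g h T, pos g -> hs h ->
     cut_mesh (Gam g) (Th h) T -> q1 * h <= diam T <= q2 * h) ->
  (forall g h, pos g -> hs h -> exists W : set 'cV[R]_3,
     [/\ open W, Gam g `<=` W, OmegaG g h `<=` W & Ck 2 W (sdist (Gam g))]) ->
  (1 <= l <= k)%N ->
  h0 <= 1 ->
  0 <= alpha <= 2 ->
  0 < d1 -> 0 < d2 ->
  0 < calpha < d2 ^- 2 * h0 `^ (alpha - 2) ->
  (* discrete inf-sup property *)
  (forall g h mu, pos g -> hs h -> Vh (Gam g) (Th h) k mu ->
     ((d1 * (1 - d2 * Num.sqrt (rho h * h)) *
       normM (Gam g) (OmegaG g h) (rho h) mu)%:E <=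
      ereal_sup [set (bform (Gam g) (OmegaG g h) (rho h) v mu /
                      normU (Gam g) (OmegaG g h) (rho h) v)%:E
                | v in [set v | Uh (Gam g) (Th h) k v /\
                         exists x, OmegaG g h x /\ (v x != 0)%R]])%E) ->
  0 < gamma1 -> 0 < gamma2 ->
  exists Cm cm cp Cp : R,
    [/\ Cm < cm, cm < 0, 0 < cp & cp < Cp] /\
    forall g h, pos g -> hs h ->
    forall (n m : nat)
      (PU : 'cV[R]_n -> 'cV[R]_3 -> 'cV[R]_3) (PM : 'cV[R]_m -> 'cV[R]_3 -> R)
      (A QA : 'M[R]_n) (B : 'M[R]_(m, n)) (SM : 'M[R]_m),
    nodal_map_U (Gam g) (Th h) k PU ->
    nodal_map_M (Gam g) (Th h) l PM ->
    (forall u v, dot (A *m u) v =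
       Ah (Gam g) (OmegaG g h) (rho h) (PU u) (PU v)) ->
    (forall u lam, dot (B *m u) lam =
       bform (Gam g) (OmegaG g h) (rho h) (PU u) (PM lam)) ->
    (forall lam mu, dot (SM *m lam) mu =
       Mform (Gam g) (OmegaG g h) (rho h) (PM lam) (PM mu)) ->
    spd QA -> lemx (gamma1 *: QA) A -> lemx A (gamma2 *: QA) ->
    let AA := block_mx A B^T B 0 in
    let Q := block_mx QA 0 0 SM in
    spectrum (invmx Q *m AA) `<=`
      (real_complex R) @` (`[Cm, cm] `|` `[cp, Cp]).
Proof.
move=> Gam rho OmegaG cs [_ [ts0 [_ OmegaE]]] posH hsH triH _ _ nbH lk h01 aH d10 d20 cH
  infsup g10 g20.
have [[h1 hsh1]|nohs] := pselect (exists h, hs h); last first.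
  exists (- 2), (- 1), 1, 2; split; first by split; lra.
  by move=> g h _ hsh; exfalso; apply: nohs; exists h.
have h00 : 0 < h0 by have /andP[h10 h1le] := hsH h1 hsh1; exact: lt_le_trans h1le.
have [q1 qH] := infsup_factor h00 aH d20 cH.
set q := d2 * Num.sqrt _ in q1.
(* Half of the uniform inf-sup constant: the supremum need not be attained, but
   some function exceeds half of it. *)
pose c := d1 * (1 - q) / 2.
have dq0 : 0 < d1 * (1 - q) by rewrite mulr_gt0// subr_gt0.
have c0 : 0 < c by rewrite divr_gt0.
pose K := 2 * gamma2 + 1.
pose D := ((1 + K / gamma1) / c) ^+ 2.
have K0 : 0 < K by rewrite /K; lra.
have D0 : 0 < D^-1.
  by rewrite invr_gt0 exprn_gt0// divr_gt0// addr_gt0// divr_gt0.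
(* Beyond -K and K the outer bounds are enlarged only to keep both intervals
   nondegenerate. *)
exists (- K - D^-1 - 1), (- D^-1), gamma1, (K + gamma1 + 1).
split; first by split; lra.
move=> g h pg hsh n m PU PM A QA B SM nU nM AE BE SE Qp lo hi /=.
have [gO GO] := posH g pg.
have [ndT OT _] := triH h hsh.
have [V [oV GV WV CV]] := nbH g h pg hsh.
have hH := hsH h hsh.
have /andP[hh0 _] := hH.
have rho0 : 0 < rho h.
  by case/andP: cH => cc _; rewrite mulr_gt0// powR_gt0.
have oO : open Omega by rewrite OmegaE; exact: open_interior.
have OC : Omega `<=` Defs.cover (Th h) by rewrite -OT; exact: subset_closure.
have Scov x : Gam g x -> nbhs x (cut_cover (Gam g) (Th h)).
  by move=> Gx; exact: (surface_nbhs ndT OC oO GO Gx).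
apply: (saddle_spectrum_position (moved_compact cs gO) (moved_nonempty g cs) oV GV CV
  ndT Scov WV (moved_finite cs gO) (moved_positive cs gO) rho0 lk c0 _ nU nM AE BE SE
  Qp g10 lo g20 hi).
move=> mu Vmu mu0.
have : ((c * normM (Gam g) (OmegaG g h) (rho h) mu)%:E <
    (d1 * (1 - d2 * Num.sqrt (rho h * h)) *
     normM (Gam g) (OmegaG g h) (rho h) mu)%:E)%E.
  rewrite lte_fin ltr_pM2r//; apply: (@lt_le_trans _ _ (d1 * (1 - q))).
    by rewrite /c ltr_pdivrMr// mulr_natr mulr2n ltrDl.
  by rewrite ler_pM2l// lerB// /q ler_pM2l//; exact: qH.
move=> /lt_le_trans /(_ (infsup g h mu pg hsh Vmu)) /ereal_sup_gt[_ [v [Uv _] <-]].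
by rewrite lte_fin => vmu; exists v.
Qed.
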